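(* Let $n\ge2$, let $\Omega \subset \mathbb{R}^n$ be an open set, let $\mathbf{F} \in \mathcal{DM}^1(\Omega)$ with precise majorant $h$, and put $m = |\mathbf{F}|$. Suppose $U \Subset \Omega$ is an open set of finite perimeter such that $\mathcal{H}^{n-1}(\partial U) = \mathcal{H}^{n-1}(\partial^{*} U)$ and $\partial U$ satisfies the uniform lower density condition, with constant $\gamma_0$. Then if $U \in \mathcal{P}_h$, we have $U \in \mathcal{O}_{m}$, and there is a limiting measure $m_U^{n-1}$ (that is, a measure with $\frac1{\varepsilon_k} m\,\mathcal{L}^n\llcorner(U\cap B_{\varepsilon_k}(\partial U))\to m_U^{n-1}$ weakly$^*$ as measures for some sequence $\varepsilon_k\downarrow0$) such that $$m_U^{n-1} \leq c\, h\,\mathcal{H}^{n-1} \llcorner \partial U \quad\text{as measures in } \Omega,$$ where $c = c(n,\gamma_0)>0$ depends only on $n$ and $\gamma_0$ (the mollifier used to define precise majorants being fixed).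
   Context: Notation: $\mathcal{L}^n$, $\mathcal{H}^{n-1}$ are Lebesgue and $(n-1)$-dimensional Hausdorff measure; $\mu\llcorner A$ is restriction of a measure; $B_r(x)$ is the ball of radius $r$ centred at $x$, $B_r=B_r(0)$; $B_\varepsilon(A) = A+B_\varepsilon$. $\partial U$ is the topological boundary and $\partial^*U$ the reduced boundary. For Borel $E$, $E^1$ is the set of points of Lebesgue density $1$ of $E$. $\mathcal{DM}^1(\Omega)$ is the space of $\mathbf{F}\in L^1(\Omega;\mathbb{R}^n)$ whose distributional divergence is a finite signed Radon measure on $\Omega$. Admissible classes. For a non-negative integrable $h$ on $\Omega$, $\mathcal{P}_h$ is the class of sets $E\subset\Omega$ of finite perimeter that are normalized ($E=E^1$) and satisfy $\int_{\partial^*E}h\,\mathrm{d}\mathcal{H}^{n-1}<\infty$. For non-negative $m\in L^1(\Omega)$, $$\mathcal{O}_m=\Big\{U\subset\Omega: U\text{ open},\ \liminf_{\varepsilon\downarrow0}\frac1\varepsilon\int_{U\cap B_\varepsilon(\partial U)}m\,\mathrm{d}x<\infty\Big\}.$$ Precise majorant. Fix once and for all a standard radial mollifier $\rho\in C_c^\infty(B_1)$ on $\mathbb{R}^n$ (non-negative, radial, $\int\rho=1$, $\rho(0)>0$) and put $\rho_\delta(x)=\delta^{-n}\rho(x/\delta)$. For a non-negative scalar function $F\in L^1(\Omega)$, extended by zero to $\mathbb{R}^n$, choose a sequence $\delta_k\downarrow0$ such that $F_k:=F*\rho_{\delta_k}$ satisfies $\|F_{k+1}-F_k\|_{L^1(\Omega)}\le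 2^{-k}$ for all $k\in\mathbb{N}$. Set $F^*(x)=\lim_{k\to\infty}F_k(x)$ if the limit exists and $F^*(x)=0$ otherwise, and define $$h(x):=|F_1(x)|+\sum_{k=1}^\infty|F_{k+1}(x)-F_k(x)|+|F^*(x)|,$$ with $h(x)=\infty$ if the series diverges. Any such $h$ is called a precise majorant of $F$. For a vector field $\mathbf{F}=(F_1,\dots,F_n)\in L^1(\Omega;\mathbb{R}^n)$ (subscripts now denoting components) write $F_i=F_i^+-F_i^-$ with positive and negative parts, let $h_i^\pm$ be precise majorants of $F_i^\pm$ chosen along a common sequence $\delta_k\downarrow0$, and call $h:=\sum_{i=1}^n(h_i^++h_i^-)$ a precise majorant of $\mathbf{F}$. Uniform lower density condition. Let $S\subset\mathbb{R}^n$ be a Borel set with locally finite $\mathcal{H}^{n-1}$-measure, i.e. $\mathcal{H}^{n-1}(S\cap K)<\infty$ for every compact $K\subset\mathbb{R}^n$. $S$ satisfies the uniform lower density condition if there exist $\gamma_0>0$ and $R_0>0$ such that $\mathcal{H}^{n-1}(S\cap B_r(x_0))\ge\gamma_0r^{n-1}$ for all $x_0\in S$ and $r\in(0,R_0)$. *)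

(* Defs.v *)
(* MathComp-Analysis, over an arbitrary [R : realType].
   R^n is ['rV[R]_n].  Its library norm is the sup norm, which induces the
   Euclidean topology but not the Euclidean balls, hence [enorm] and [eball]. *)
From HB Require Import structures.
From mathcomp Require Import all_boot all_order all_algebra.
From mathcomp Require Import all_classical all_reals all_analysis.
From mathcomp Require Import measurable_realfun.

Set Implicit Arguments.
Unset Strict Implicit.
Unset Printing Implicit Defensive.

Import Order.TTheory GRing.Theory Num.Theory.
Import numFieldNormedType.Exports.

Local Open Scope classical_set_scope.
Local Open Scope ring_scope.

Notation borelRn R n := (g_sigma_algebraType (@open 'rV[R]_n)).

(* The library has no n-dimensional Lebesgue measure: it is built here as the
   n-fold product of [lebesgue_measure], transported to the Borel sets of
   ['rV[R]_n] along the homeomorphism R * R^n -> R^(n+1). *)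
Section lebesgue_Rn.
Context {R : realType}.

Definition cons_rV n (p : measurableTypeR R * borelRn R n) : borelRn R n.+1 :=
  row_mx (p.1%:M : 'rV_1) (p.2 : 'rV_n).

Lemma cons_rV0 n (x : R) (y : borelRn R n) : (cons_rV (x, y) : 'rV_n.+1) 0 0 = x.
Proof.
transitivity (cons_rV (x, y) 0 (lshift n (0 : 'I_1))).
  by congr (_ 0 _); exact/val_inj.
by rewrite [LHS]row_mxEl mxE eqxx mulr1n.
Qed.

Lemma cons_rVS n (x : R) (y : borelRn R n) (j : 'I_n) :
  (cons_rV (x, y) : 'rV_n.+1) 0 (lift 0 j) = (y : 'rV_n) 0 j.
Proof.
transitivity (cons_rV (x, y) 0 (rshift 1 j)).
  by congr (_ 0 _); exact/val_inj.
by rewrite [LHS]row_mxEr.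
Qed.

Lemma open_measurable_Rn n (A : set 'rV[R]_n) :
  open A -> measurable (A : set (borelRn R n)).
Proof. by move=> oA; exact: sub_sigma_algebra. Qed.

Lemma measurable_cons_rV n : measurable_fun setT (@cons_rV n).
Proof.
refine (@measurability _ _ _ _ setT (@cons_rV n) (@open 'rV[R]_n.+1) erefl _).
move=> _ [V oV <-]; rewrite setTI.
pose r (k : nat) : R := k.+1%:R^-1.
have r0 k : 0 < r k by rewrite invr_gt0.
pose t (q : 'rV[rat]_n.+1) : 'rV[R]_n := \row_j ratr (q 0 (lift 0 j)).
pose B (i : 'rV[rat]_n.+1 * nat) : set (measurableTypeR R * borelRn R n) :=
  ball (ratr (i.1 0 0) : R) (r i.2) `*` ball (t i.1) (r i.2).
pose F i := if `[< B i `<=` @cons_rV n @^-1` V >] then B i else set0.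
rewrite (_ : _ @^-1` _ = \bigcup_i F i); last first.
  apply/seteqP; split=> [[x y] /= Vxy|p [i _]]; last first.
    by rewrite /F; case: asboolP => // + ?; apply.
  have /nbhs_ballP[e /= e0 eV] : nbhs (cons_rV (x, y) : 'rV_n.+1) V.
    exact: open_nbhs_nbhs.
  have e20 : 0 < e / 2 by rewrite divr_gt0.
  have [k _ /(_ k (leqnn k)) /= ke] := near_infty_natSinv_lt (PosNum e20).
  have /choice[q qE] (j : 'I_n.+1) : exists q : rat,
      ball (cons_rV (x, y) 0 j : R) (r k) (ratr q).
    have [|q] := @rat_in_itvoo R (cons_rV (x, y) 0 j - r k)
      (cons_rV (x, y) 0 j + r k).
      by rewrite ltrD2l gtrN.
    by move=> qI; exists q; rewrite ball_itv.
  have Bxy : B (\row_j q j, k) (x, y).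
    split => /=.
      by rewrite mxE; apply: ball_sym; have := qE 0; rewrite cons_rV0.
    split=> // i j; rewrite !mxE ord1; apply: ball_sym.
    by have := qE (lift 0 j); rewrite cons_rVS.
  exists (\row_j q j, k) => //; rewrite /F asboolT// => -[x' y'] Bxy'.
  apply: eV; split=> // i j; rewrite ord1 {i}.
  apply: (@le_ball _ _ _ (r k + r k)).
    by rewrite ltW// [ltRHS]splitr ltrD.
  move: Bxy Bxy' => [/= Bx [_ By]] [/= Bx' [_ By']].
  case: (unliftP 0 j) => [i ->|->].
    rewrite !cons_rVS; apply: (ball_triangle (ball_sym (By 0 i))).
    exact: By'.
  by rewrite !cons_rV0; exact: (ball_triangle (ball_sym Bx) Bx').
apply: countable_bigcupT_measurable => [|i]; first exact: countableP.
rewrite /F; case: ifP => // _.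
apply: measurableX; first exact: open_measurable (ball_open _ _).
apply: open_measurable_Rn; apply: ball_open.
Qed.

Lemma continuous_measurable_Rn n (f : 'rV[R]_n -> R) :
  continuous f -> measurable_fun setT (f : borelRn R n -> R).
Proof.
move=> /continuousP cf; apply: (measurability _ (RGenOpens.measurableE R)).
move=> _ [_ [a [b ->] <-]]; rewrite setTI; apply: open_measurable_Rn.
exact/cf/interval_open.
Qed.

Section step.
Variables (n : nat) (mu : {sigma_finite_measure set (borelRn R n) -> \bar R}).

Definition lebesgue_Rn_step : set (borelRn R n.+1) -> \bar R :=
  pushforward ((@lebesgue_measure R) \x mu)%E (@cons_rV n).

Let step0 : lebesgue_Rn_step set0 = 0%E.
Proof. by rewrite /lebesgue_Rn_step /pushforward preimage_set0 measure0. Qed.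

Let step_ge0 A : (0 <= lebesgue_Rn_step A)%E.
Proof. by rewrite /lebesgue_Rn_step /pushforward measure_ge0. Qed.

Let mpre A : measurable A -> measurable (@cons_rV n @^-1` A).
Proof. by move=> mA; rewrite -[X in measurable X]setTI; exact: measurable_cons_rV. Qed.

Let step_sigma_additive : semi_sigma_additive lebesgue_Rn_step.
Proof.
move=> F mF tF mUF; rewrite /lebesgue_Rn_step /pushforward preimage_bigcup.
apply: measure_semi_sigma_additive.
- by move=> k; exact: mpre.
- apply/trivIsetP => /= i j _ _ ij; rewrite -preimage_setI.
  by move/trivIsetP : tF => /(_ _ _ _ _ ij) ->//; rewrite preimage_set0.
- by rewrite -preimage_bigcup; exact: mpre.
Qed.

HB.instance Definition _ := isMeasure.Build _ _ _ lebesgue_Rn_step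
  step0 step_ge0 step_sigma_additive.

Let step_sigma_finite : sigma_finite setT lebesgue_Rn_step.
Proof.
have /sigma_finiteP[F [TF ndF Foo]] := sigma_finiteT (@lebesgue_measure R).
have /sigma_finiteP[G [TG ndG Goo]] := sigma_finiteT mu.
pose u (v : borelRn R n.+1) : measurableTypeR R * borelRn R n :=
  (v 0 0, \row_j v 0 (lift 0 j) : 'rV_n).
have uK : cancel (@cons_rV n) u.
  move=> [x y]; rewrite /u cons_rV0; congr pair.
  by apply/rowP => j; rewrite mxE cons_rVS.
have Ku : cancel u (@cons_rV n).
  move=> v; apply/rowP => j; case: (unliftP 0 j) => [i ->|->].
    by rewrite cons_rVS mxE.
  by rewrite cons_rV0.
have mu_ : measurable_fun setT u.
  apply/measurable_fun_pairP; split => /=.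
    have := @continuous_measurable_Rn n.+1 (fun v => v 0 0) _; apply.
    exact: coord_continuous.
  refine (@measurability _ _ (borelRn R n.+1) (borelRn R n) setT
    (fun v => \row_j (v : 'rV_n.+1) 0 (lift 0 j) : 'rV_n)
    (@open 'rV[R]_n) erefl _).
  move=> _ [V oV <-]; rewrite setTI; apply: open_measurable_Rn.
  have /continuousP : continuous
    (fun v : 'rV[R]_n.+1 => \row_j v 0 (lift 0 j) : 'rV[R]_n).
    move=> v A /nbhs_ballP[e /= e0 eA]; apply/nbhs_ballP; exists e => //= w.
    by move=> [_ vw]; apply: eA; split=> // i j; rewrite !mxE.
  by move=> /(_ V oV).
exists (fun k => u @^-1` (F k `*` G k)).
  rewrite -preimage_bigcup -(preimage_setT u); congr (_ @^-1` _).
  rewrite -setXTT TF TG predeqE => -[x y]; split.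
    move=> [/= [i _ Fx] [k _ Gy]]; exists (maxn i k) => //; split.
    - by move: x Fx; exact/subsetPset/ndF/leq_maxl.
    - by move: y Gy; exact/subsetPset/ndG/leq_maxr.
  by move=> [i _ []/= ? ?]; split; exists i.
move=> k; have [mF Fkoo] := Foo k; have [mG Gkoo] := Goo k; split.
  by rewrite -[X in measurable X]setTI; apply: mu_ => //; exact: measurableX.
rewrite /lebesgue_Rn_step /pushforward -comp_preimage.
rewrite (_ : u \o _ = id) ?preimage_id; last by apply/funext => p; exact: uK.
by rewrite product_measure1E// lte_mul_pinfty// ge0_fin_numE.
Qed.

HB.instance Definition _ := Measure_isSigmaFinite.Build _ _ _ lebesgue_Rn_step
  step_sigma_finite.

End step.

Fixpoint lebesgue_Rn n : {sigma_finite_measure set (borelRn R n) -> \bar R} :=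
  match n with
  | 0 => \d_(0 : borelRn R 0)
  | k.+1 => lebesgue_Rn_step (lebesgue_Rn k)
  end.
End lebesgue_Rn.

Section euclidean.
Context {R : realType} {n : nat}.

Definition enorm (x : 'rV[R]_n) : R := Num.sqrt (\sum_i x 0 i ^+ 2).

Definition eball (x : 'rV[R]_n) (r : R) : set 'rV[R]_n :=
  [set y | enorm (y - x) < r].

End euclidean.

Section geometry.
Context {R : realType} {n : nat}.
Implicit Types (x y : 'rV[R]_n) (A E : set 'rV[R]_n).

Definition neighborhood A (eps : R) : set 'rV[R]_n :=
  \bigcup_(a in A) eball a eps.

Definition boundary A : set 'rV[R]_n := closure A `\` A°.

Definition compactly_contained A E : Prop :=
  compact (closure A) /\ closure A `<=` E.

Definition density_one E : set 'rV[R]_n :=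
  [set x | fine (lebesgue_Rn n (E `&` eball x r)) /
           fine (lebesgue_Rn n (eball x r)) @[r --> 0^'+] --> (1 : R)].

Definition ediam A : \bar R :=
  ereal_sup [set d | exists x y, [/\ A x, A y & d = (enorm (x - y))%:E]].

Section hausdorff.
Variable d : nat.

Definition unit_ball_volume : R :=
  fine (lebesgue_Rn d (eball (0 : 'rV[R]_d) 1)).

(* The case distinction gives the empty set weight 0 also when d = 0. *)
Definition hausdorff_weight A : \bar R :=
  if `[< A = set0 >] then 0%E
  else (unit_ball_volume * (fine (ediam A) / 2) ^+ d)%:E.

Definition hausdorff_pre (delta : R) A : \bar R :=
  ereal_inf [set (\sum_(0 <= k <oo) hausdorff_weight (C k))%E | C in
    [set C : nat -> set 'rV[R]_n | A `<=` \bigcup_k C k /\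
      forall k, (ediam (C k) <= delta%:E)%E]].

(* An outer measure on all subsets of R^n, a measure on the Borel sets. *)
Definition hausdorff (A : set (borelRn R n)) : \bar R :=
  ereal_sup [set hausdorff_pre delta A | delta in [set delta | 0 < delta]].

End hausdorff.

Definition uniform_lower_density (gamma0 : R) A : Prop :=
  [/\ measurable (A : set (borelRn R n)),
      forall K : set 'rV[R]_n, compact K ->
        (hausdorff n.-1 (A `&` K) < +oo)%E,
      0 < gamma0 &
      exists2 R0 : R, 0 < R0 & forall x0 r, A x0 -> 0 < r < R0 ->
        ((gamma0 * r ^+ n.-1)%:E <= hausdorff n.-1 (A `&` eball x0 r))%E].

End geometry.

Section test_functions.
Context {R : realType} {n : nat}.
Implicit Types (V : set 'rV[R]_n) (phi : 'rV[R]_n -> R).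

Definition partial (i : 'I_n) phi : 'rV[R]_n -> R :=
  fun x => 'D_(delta_mx 0 i) phi x.

Definition iter_partial (s : seq 'I_n) phi : 'rV[R]_n -> R :=
  foldr partial phi s.

Definition smooth phi : Prop := forall s : seq 'I_n,
  continuous (iter_partial s phi) /\
  forall i x, derivable (iter_partial s phi) x (delta_mx 0 i).

Definition compact_support_in V phi : Prop :=
  exists K : set 'rV[R]_n,
    [/\ compact K, K `<=` V & forall x, ~ K x -> phi x = 0].

Definition Cc V phi : Prop := continuous phi /\ compact_support_in V phi.

Definition Ccoo V phi : Prop := smooth phi /\ compact_support_in V phi.

End test_functions.

(* Integration against a finite signed measure, through its Jordan
   decomposition. *)
Definition charge_integral d (T : measurableType d) (R : realType)
    (nu : {charge set T -> \bar R}) (D : set T) (f : T -> R) : R :=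
  let: exist P exN := cid (Hahn_decomposition nu) in
  let: exist N nuPN := cid exN in
  \int[jordan_pos nuPN]_(x in D) f x - \int[jordan_neg nuPN]_(x in D) f x.

Section fields_and_perimeter.
Context {R : realType} {n : nat}.
Implicit Types (Omega E A : set 'rV[R]_n) (F : 'rV[R]_n -> 'rV[R]_n).

(* Only the values of F on Omega matter. *)
Definition L1_field Omega F : Prop :=
  forall i, (lebesgue_Rn n).-integrable Omega (fun x => (F x 0 i)%:E).

Definition DM1 Omega F : Prop :=
  L1_field Omega F /\
  exists nu : {charge set (borelRn R n) -> \bar R},
    forall phi, Ccoo Omega phi ->
      \int[lebesgue_Rn n]_(x in Omega) (\sum_i F x 0 i * partial i phi x) =
      - charge_integral nu Omega phi.

Definition vector_charge := 'I_n -> {charge set (borelRn R n) -> \bar R}.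

(* D is the distributional gradient on R^n of the indicator function of E. *)
Definition is_indicator_gradient E (D : vector_charge) : Prop :=
  forall (phi : 'rV[R]_n -> R) (i : 'I_n), Ccoo setT phi ->
    \int[lebesgue_Rn n]_(x in E) partial i phi x =
    - charge_integral (D i) setT phi.

Definition finite_perimeter E : Prop :=
  measurable (E : set (borelRn R n)) /\ exists D, is_indicator_gradient E D.

Definition vector_variation (D : vector_charge) (A : set (borelRn R n)) :
    \bar R :=
  ereal_sup [set (\sum_(0 <= k <oo)
      (enorm (\row_i fine (D i (B k))))%:E)%E | B in
    [set B : nat -> set (borelRn R n) | [/\ forall k, measurable (B k),
      trivIset setT B & \bigcup_k B k = A]]].

Definition reduced_boundary E : set 'rV[R]_n :=
  [set x | exists D, [/\ is_indicator_gradient E D,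
     forall r, 0 < r -> (0 < vector_variation D (eball x r))%E &
     exists2 nu : 'rV[R]_n, enorm nu = 1 &
       forall i, fine (D i (eball x r)) / fine (vector_variation D (eball x r))
         @[r --> 0^'+] --> nu 0 i]].

Definition perimeter_class Omega (h : 'rV[R]_n -> \bar R) E : Prop :=
  [/\ E `<=` Omega, finite_perimeter E, E = density_one E &
      (\int[hausdorff n.-1]_(x in reduced_boundary E `&` Omega) h x < +oo)%E].

Definition open_class Omega (m : 'rV[R]_n -> R) (U : set 'rV[R]_n) : Prop :=
  [/\ open U, U `<=` Omega &
      (limf_einf (fun eps : R => (eps^-1)%:E *
          \int[lebesgue_Rn n]_(x in U `&` neighborhood (boundary U) eps)
            (m x)%:E) 0^'+ < +oo)%E].

(* u decreases (weakly) to 0 through positive values. *)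
Definition decreases_to_0 (u : nat -> R) : Prop :=
  [/\ forall k, 0 < u k, forall k, u k.+1 <= u k & u @ \oo --> (0 : R)].

(* Weak* convergence is tested against C_c(Omega); mU matters only on Omega. *)
Definition limiting_measure Omega (m : 'rV[R]_n -> R) (U : set 'rV[R]_n)
    (mU : {measure set (borelRn R n) -> \bar R}) : Prop :=
  exists2 eps : nat -> R, decreases_to_0 eps &
    forall phi, Cc Omega phi ->
      (eps k)^-1 *
        \int[lebesgue_Rn n]_(x in U `&` neighborhood (boundary U) (eps k))
          (phi x * m x)
      @[k --> \oo] --> \int[mU]_(x in Omega) phi x.

End fields_and_perimeter.

Section precise_majorants.
Context {R : realType} {n : nat}.
Implicit Types (rho f : 'rV[R]_n -> R) (Omega : set 'rV[R]_n)
  (delta : nat -> R).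

Definition standard_mollifier rho : Prop :=
  [/\ Ccoo (eball 0 1) rho, forall x, 0 <= rho x,
      forall x y, enorm x = enorm y -> rho x = rho y,
      \int[lebesgue_Rn n]_(x in setT) rho x = 1 & 0 < rho 0].

(* The convolution at x of rho_delta with f extended by zero off Omega *)
Definition mollify rho Omega f (delta : R) : 'rV[R]_n -> R := fun x =>
  \int[lebesgue_Rn n]_(y in setT)
    ((f \_ Omega) y * ((delta ^+ n)^-1 * rho (delta^-1 *: (x - y)))).

(* Sequences are numbered from 1: delta 0 is not used. *)
Definition fast_mollification rho Omega f delta : Prop :=
  forall k, (0 < k)%N ->
    (\int[lebesgue_Rn n]_(x in Omega)
        `|mollify rho Omega f (delta k.+1) x
          - mollify rho Omega f (delta k) x|%:E <= (2 ^- k)%:E)%E.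

Definition precise_value rho Omega f delta : 'rV[R]_n -> R := fun x =>
  let u k := mollify rho Omega f (delta k) x in
  if `[< cvgn u >] then limn u else 0.

Definition scalar_majorant rho Omega f delta : 'rV[R]_n -> \bar R := fun x =>
  (`|mollify rho Omega f (delta 1) x|%:E
   + \sum_(1 <= k <oo) `|mollify rho Omega f (delta k.+1) x
                         - mollify rho Omega f (delta k) x|%:E
   + `|precise_value rho Omega f delta x|%:E)%E.

Definition precise_majorant rho Omega (F : 'rV[R]_n -> 'rV[R]_n)
    (h : 'rV[R]_n -> \bar R) : Prop :=
  let Fpos i := (fun x => F x 0 i)^\+ in
  let Fneg i := (fun x => F x 0 i)^\- in
  exists delta, [/\ decreases_to_0 delta,
    forall i, fast_mollification rho Omega (Fpos i) delta /\
              fast_mollification rho Omega (Fneg i) delta &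
    forall x, Omega x -> h x =
      (\sum_i (scalar_majorant rho Omega (Fpos i) delta x +
               scalar_majorant rho Omega (Fneg i) delta x))%E].

End precise_majorants.

(* Main.v *)
Require Import Defs.
From HB Require Import structures.
From mathcomp Require Import all_boot all_order all_algebra.
From mathcomp Require Import all_classical all_reals all_analysis.
From mathcomp Require Import measurable_realfun.
From mathcomp Require Import ring lra.

(** Let S be the boundary of U and let sigma be the restriction of the
(n-1)-dimensional Hausdorff measure to S. For a small radius e, take the density
p = m / e on the inner layer, the set of points of U at distance less than e
from S, and move the mass p(y) of each point y of the layer to S, distributing
it over the ball of radius 2e around y proportionally to sigma. The lower
density condition makes this possible: that ball contains an e-ball centered on
S, so its sigma-measure is at least gamma0 e^(n-1) ([layer_ball_mass]). By
Tonelli the transported measure has a density g with respect to sigma, with the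
same total mass as p ([integral_spread]), and g(x) is at most
(gamma0 e^n)^-1 times the integral of m over the ball of radius 2e around x
([spread_le]). Each mass moves by less than 2e, so p and g sigma have nearly the
same integral against a continuous function ([spread_coupling]). This transport
takes the place of a covering of S by balls.

The mollifier is at least rho(0)/2 on some ball of radius s. For e = s delta_k / 2
the integral of m over the 2e-ball around x is therefore at most a constant times
delta_k^n times the sum of the mollified functions F_i^+ and F_i^- at scale
delta_k and at the point x ([enorm_field_mollify]). Telescoping along the
sequence delta_k bounds that sum by the majorant h(x)
([mollified_field_le_majorant]). The powers of delta_k cancel, and g_k <= c h on
S for all k, with c depending on n, gamma0 and rho.

Hence G = sup_k g_k is at most c h on S. Since the Hausdorff measures of S and of
the reduced boundary agree and are finite, the integrability of h on the reduced
boundary makes G sigma a finite measure ([integral_boundary_lty]). It bounds the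
averages of m over the layers, which puts U in the class O_m. It also dominates
all the measures g_k sigma. Along an ultrafilter these converge on every Borel
set, to a set function that is countably additive because it stays below
G sigma ([ultralimit_measure]); testing on countably many small cells extracts a
subsequence that converges weakly ([weak_subsequence]). Its limit is at most
G sigma, hence at most c h sigma, and it is also the weak limit of the layers
([layers_weak_limit]).

Three measure-theoretic facts support this. Hausdorff measure is a measure on the
Borel sets, by the criterion of Caratheodory ([open_caratheodory]). The reduced
boundary is a Borel set: the gradient of the indicator function is determined by
its integrals against smooth functions ([charge_eq]), and the variation and the components of
the gradient on balls are left-continuous in the radius and measurable in the
center, so countably many conditions describe the reduced boundary
([reduced_boundary_countable]). And the reduced boundary is part of the
topological boundary, because the gradient vanishes where the indicator function
is locally constant ([reduced_boundary_sub]). *)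

Set Implicit Arguments.
Unset Strict Implicit.
Unset Printing Implicit Defensive.

Import Order.TTheory GRing.Theory Num.Theory.
Import numFieldNormedType.Exports.

Local Open Scope classical_set_scope.
Local Open Scope ring_scope.

(** * The Euclidean norm and the Borel sets of R^n *)

Section euclidean_norm.
Context {R : realType} {n : nat}.
Implicit Types (x y z : 'rV[R]_n) (r : R).

Lemma enorm_ge0 x : 0 <= enorm x.
Proof. exact: sqrtr_ge0. Qed.

Lemma sqr_enorm x : enorm x ^+ 2 = \sum_i x 0 i ^+ 2.
Proof. by rewrite sqr_sqrtr//; apply: sumr_ge0 => i _; exact: sqr_ge0. Qed.

Lemma enorm0 : enorm (0 : 'rV[R]_n) = 0.
Proof. by rewrite /enorm big1 ?sqrtr0// => i _; rewrite mxE expr0n. Qed.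

Lemma enormZ r x : enorm (r *: x) = `|r| * enorm x.
Proof.
rewrite /enorm -sqrtr_sqr -sqrtrM ?sqr_ge0// mulr_sumr.
by congr Num.sqrt; apply: eq_bigr => i _; rewrite mxE exprMn.
Qed.

Lemma enormN x : enorm (- x) = enorm x.
Proof. by rewrite -scaleN1r enormZ normrN1 mul1r. Qed.

Lemma enormBC x y : enorm (x - y) = enorm (y - x).
Proof. by rewrite -enormN opprB. Qed.

Lemma le_coord_enorm x i : `|x 0 i| <= enorm x.
Proof.
rewrite -sqrtr_sqr ler_wsqrtr// (bigD1 i)//= lerDl.
by apply: sumr_ge0 => j _; exact: sqr_ge0.
Qed.

Lemma enorm_eq0 x : enorm x = 0 -> x = 0.
Proof.
move=> x0; apply/rowP => i; rewrite mxE; apply/normr0_eq0/le_anti.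
by rewrite normr_ge0 -x0 le_coord_enorm.
Qed.

Lemma cauchy_schwarz x y : \sum_i x 0 i * y 0 i <= enorm x * enorm y.
Proof.
have [x0|x0] := eqVneq (enorm x) 0.
  rewrite x0 mul0r big1// => i _; have /enorm_eq0 -> := x0.
  by rewrite mxE mul0r.
have [y0|y0] := eqVneq (enorm y) 0.
  rewrite y0 mulr0 big1// => i _; have /enorm_eq0 -> := y0.
  by rewrite mxE mulr0.
have xy0 : 0 < enorm x * enorm y by rewrite mulr_gt0// lt_def ?x0 ?y0 enorm_ge0.
have : 0 <= \sum_i (enorm y * x 0 i - enorm x * y 0 i) ^+ 2.
  by apply: sumr_ge0 => i _; exact: sqr_ge0.
rewrite (eq_bigr (fun i => enorm y ^+ 2 * x 0 i ^+ 2 +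
    (enorm x ^+ 2 * y 0 i ^+ 2 -
     (2 * enorm x * enorm y) * (x 0 i * y 0 i)))); last by move=> i _; ring.
rewrite 2!big_split/= sumrN -!mulr_sumr -!sqr_enorm => H.
rewrite -(ler_pM2l xy0); move: (enorm x) (enorm y) (\sum_i _) H => a b s; clear; nra.
Qed.

Lemma ler_enormD x y : enorm (x + y) <= enorm x + enorm y.
Proof.
rewrite -ler_sqr ?nnegrE ?addr_ge0 ?enorm_ge0// sqrrD !sqr_enorm.
rewrite (eq_bigr (fun i => x 0 i ^+ 2 + (x 0 i * y 0 i *+ 2 + y 0 i ^+ 2))).
  rewrite 2!big_split/= sumrMnl -[leRHS]addrA lerD2l lerD2r ler_wMn2r//.
  exact: cauchy_schwarz.
by move=> i _; rewrite mxE; ring.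
Qed.

Lemma ler_enorm_dist z x y : enorm (x - y) <= enorm (x - z) + enorm (z - y).
Proof. by apply: le_trans (ler_enormD _ _); rewrite addrA subrK. Qed.

Lemma enorm_le_sum x : enorm x <= \sum_i `|x 0 i|.
Proof.
have s0 : 0 <= \sum_i `|x 0 i| by apply: sumr_ge0.
rewrite -ler_sqr ?nnegrE ?enorm_ge0// sqr_enorm.
rewrite [leRHS]expr2 mulr_suml ler_sum// => i _.
rewrite -real_normK ?num_real// expr2 ler_wpM2l// (bigD1 i)//= lerDl.
exact: sumr_ge0.
Qed.

Lemma normr_le_enorm x : `|x| <= enorm x.
Proof.
rewrite /Num.norm/= mx_normrE; apply: bigmax_le; first exact: enorm_ge0.
by move=> [i j] _ /=; rewrite ord1; exact: le_coord_enorm.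
Qed.

Lemma coord_le_normr x i : `|x 0 i| <= `|x|.
Proof.
rewrite {2}/Num.norm/= mx_normrE.
by apply: (le_bigmax _ (fun i : 'I_1 * 'I_n => `|x i.1 i.2|) (0, i)).
Qed.

Lemma enorm_le_normr x : enorm x <= n%:R * `|x|.
Proof.
apply: (le_trans (enorm_le_sum x)).
have -> : n%:R * `|x| = \sum_(i < n) `|x| by rewrite sumr_const card_ord mulr_natl.
by apply: ler_sum => i _; exact: coord_le_normr.
Qed.

Lemma eball_center x r : 0 < r -> eball x r x.
Proof. by rewrite /eball/= subrr enorm0. Qed.

Lemma eball_sym x y r : eball x r y -> eball y r x.
Proof. by rewrite /eball/= enormBC. Qed.

Lemma eball_triangle x y r r' : r' + enorm (y - x) <= r ->
  eball x r' `<=` eball y r.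
Proof.
move=> rr z; rewrite /eball/= => zx; apply: lt_le_trans rr.
by rewrite (le_lt_trans (ler_enorm_dist x _ _))// [enorm (y - x)]enormBC ltrD2r.
Qed.

Lemma le_eball x r r' : r <= r' -> eball x r `<=` eball x r'.
Proof. by move=> rr'; apply: eball_triangle; rewrite subrr enorm0 addr0. Qed.

Lemma eball_sub_ball x r : eball x r `<=` ball x r.
Proof.
move=> y; rewrite /eball/= => yx; rewrite -ball_normE /ball_/=.
by rewrite distrC (le_lt_trans (normr_le_enorm _)).
Qed.

Lemma ball_sub_eball x r : 0 < r -> ball x (r / n.+1%:R) `<=` eball x r.
Proof.
move=> r0 y; rewrite -ball_normE /ball_/= /eball/= distrC => yx.
rewrite (le_lt_trans (enorm_le_normr _))//.
move: yx; rewrite ltr_pdivlMr// mulrC; apply: le_lt_trans.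
by rewrite ler_wpM2r// ler_nat.
Qed.

Lemma nbhs_eball x r : 0 < r -> nbhs x (eball x r).
Proof.
by move=> r0; apply/nbhs_ballP; exists (r / n.+1%:R) => /=;
  [rewrite divr_gt0|exact: ball_sub_eball].
Qed.

Lemma nbhs_eballP x (A : set 'rV[R]_n) :
  nbhs x A <-> exists2 r, 0 < r & eball x r `<=` A.
Proof.
split=> [/nbhs_ballP[r /= r0 rA]|[r r0 rA]].
  by exists r => //; apply: subset_trans rA; exact: eball_sub_ball.
by apply: filterS rA _; exact: nbhs_eball.
Qed.

Lemma open_eball x r : open (eball x r).
Proof.
rewrite openE => y yxr; apply/nbhs_eballP.
exists (r - enorm (y - x)); first by rewrite subr_gt0.
by apply: eball_triangle; rewrite enormBC subrK.
Qed.

Lemma enorm_continuous : continuous (@enorm R n).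
Proof.
move=> x A /nbhs_ballP[e /= e0 eA]; apply/nbhs_eballP; exists e => // y.
rewrite /eball/= => xy; apply: eA; rewrite -ball_normE /ball_/= ltr_norml; apply/andP; split.
  rewrite ltrNl opprB ltrBlDl (le_lt_trans _ (_ : enorm x + enorm (y - x) < _))//.
    by rewrite (le_trans _ (ler_enormD _ _))// addrC subrK.
  by rewrite ltrD2l.
rewrite ltrBlDl (le_lt_trans _ (_ : enorm y + enorm (x - y) < _))//.
  by rewrite (le_trans _ (ler_enormD _ _))// addrC subrK.
by rewrite ltrD2l enormBC.
Qed.

Lemma open_neighborhood (A : set 'rV[R]_n) e : open (neighborhood A e).
Proof. by apply: bigcup_open => x _; exact: open_eball. Qed.

Lemma closed_boundary (A : set 'rV[R]_n) : closed (boundary A).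
Proof.
rewrite /boundary setDE; apply: closedI; first exact: closed_closure.
by apply: open_closedC; exact: open_interior.
Qed.

Lemma measurable_closed (A : set 'rV[R]_n) :
  closed A -> measurable (A : set (borelRn R n)).
Proof.
move=> cA; rewrite -[A]setCK; apply: measurableC; apply: open_measurable_Rn.
exact: closed_openC.
Qed.

Lemma measurable_eball x r : measurable (eball x r : set (borelRn R n)).
Proof. by apply: open_measurable_Rn; exact: open_eball. Qed.

Lemma measurable_coord i :
  measurable_fun setT (fun x : borelRn R n => (x : 'rV[R]_n) 0 i).
Proof.
apply: (@continuous_measurable_Rn R n (fun v : 'rV_n => v 0 i)).
exact: coord_continuous.
Qed.

(** An open set is a countable union of sup-norm balls with rational centers and
radii 1/(k+1), and the preimage of such a ball is given by finitely many
conditions on the coordinates. *)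
Lemma measurable_rV d (T : measurableType d) (f : T -> borelRn R n) :
  (forall i, measurable_fun setT (fun t => (f t : 'rV[R]_n) 0 i)) ->
  measurable_fun setT f.
Proof.
move=> mf.
refine (@measurability _ _ _ _ setT f (@open 'rV[R]_n) erefl _).
move=> _ [V oV <-]; rewrite setTI.
pose r (k : nat) : R := k.+1%:R^-1.
have r0 k : 0 < r k by rewrite invr_gt0.
pose t (q : 'rV[rat]_n) : 'rV[R]_n := \row_j ratr (q 0 j).
pose B (i : 'rV[rat]_n * nat) : set 'rV[R]_n := ball (t i.1) (r i.2).
pose G i := if `[< B i `<=` V >] then f @^-1` B i else set0.
rewrite (_ : _ @^-1` _ = \bigcup_i G i); last first.
  apply/seteqP; split=> [x /= Vx|x [i _]]; last first.
    by rewrite /G; case: asboolP => // + ?; apply.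
  have /nbhs_ballP[e /= e0 eV] : nbhs (f x : 'rV_n) V by exact: open_nbhs_nbhs.
  have e20 : 0 < e / 2 by rewrite divr_gt0.
  have [k _ /(_ k (leqnn k)) /= ke] := near_infty_natSinv_lt (PosNum e20).
  have /choice[q qE] (j : 'I_n) : exists q : rat,
      ball ((f x : 'rV_n) 0 j : R) (r k) (ratr q).
    have [|q] := @rat_in_itvoo R ((f x : 'rV_n) 0 j - r k)
      ((f x : 'rV_n) 0 j + r k).
      by rewrite ltrD2l gtrN.
    by move=> qI; exists q; rewrite ball_itv.
  have Bx : B (\row_j q j, k) (f x).
    by split=> // i j; rewrite !mxE ord1; apply: ball_sym; exact: qE.
  exists (\row_j q j, k) => //; rewrite /G asboolT// => y Bxy.
  apply: eV; apply: (@le_ball _ _ _ (r k + r k)).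
    by rewrite ltW// [ltRHS]splitr ltrD.
  exact: ball_triangle (ball_sym Bx) Bxy.
apply: countable_bigcupT_measurable => [|i]; first exact: countableP.
rewrite /G; case: ifP => // _.
rewrite (_ : _ @^-1` _ = \bigcap_j
    ((fun t => (f t : 'rV[R]_n) 0 j) @^-1` ball (t i.1 0 j) (r i.2))); last first.
  apply/seteqP; split=> [x [_ Bx] j _|x Bx]; first exact: Bx.
  by split => // a b; rewrite ord1; exact: (Bx b).
apply: fin_bigcap_measurable => // j _.
rewrite -[X in measurable X]setTI; apply: mf => //.
exact: measurable_ball.
Qed.

Lemma measurable_enorm : measurable_fun setT (@enorm R n : borelRn R n -> R).
Proof. by apply: continuous_measurable_Rn; exact: enorm_continuous. Qed.

End euclidean_norm.

(** * Hausdorff measure is a Borel measure *)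

Section hausdorff_outer_measure.
Context {R : realType} {n : nat}.
Variable d : nat.
Local Open Scope ereal_scope.
Implicit Types A B C : set 'rV[R]_n.

Let H : set (borelRn R n) -> \bar R := hausdorff d.

Lemma hausdorff_weight_ge0 A : 0 <= hausdorff_weight d A.
Proof.
rewrite /hausdorff_weight; case: asboolP => //= /eqP/set0P[x Ax].
rewrite lee_fin mulr_ge0//; first by rewrite fine_ge0.
rewrite exprn_ge0// divr_ge0// fine_ge0//.
apply: ereal_sup_ubound; exists x, x; split => //.
by rewrite subrr enorm0.
Qed.

Lemma hausdorff_weight0 : hausdorff_weight d (set0 : set 'rV[R]_n) = 0.
Proof. by rewrite /hausdorff_weight asboolT. Qed.

(** An infinite weight on the sets of diameter above delta turns a cover by small
sets into a cover by arbitrary sets, so that [hausdorff_pre] becomes the outer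
measure generated by a set function. *)
Definition truncated_weight (delta : R) (A : set 'rV[R]_n) : \bar R :=
  if ediam A <= delta%:E then hausdorff_weight d A else +oo.

Lemma truncated_weight_ge0 delta A : 0 <= truncated_weight delta A.
Proof. by rewrite /truncated_weight; case: ifP => // _; exact: hausdorff_weight_ge0. Qed.

Lemma ediam0 : ediam (set0 : set 'rV[R]_n) = -oo.
Proof.
by apply/ereal_sup_ninfty => _ [x [y [//]]].
Qed.

Lemma truncated_weight0 delta : truncated_weight delta set0 = 0.
Proof. by rewrite /truncated_weight ediam0 leNye hausdorff_weight0. Qed.

Lemma hausdorff_preE delta A : hausdorff_pre d delta A =
  @mu_ext _ (g_sigma_algebraType [set: set 'rV[R]_n]) R (truncated_weight delta) A.
Proof.
apply/eqP; rewrite eq_le; apply/andP; split.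
  apply: le_ereal_inf_tmp => _ [C [_ AC] <-].
  have [dC|/existsNP[k /negP dC]] :=
      pselect (forall k, ediam (C k : set 'rV[R]_n) <= delta%:E); last first.
    rewrite (@eseries_pinfty _ _ _ k) ?leey// => [i _|].
      by rewrite gt_eqF// (lt_le_trans _ (truncated_weight_ge0 _ _)).
    by rewrite /truncated_weight (negbTE dC).
  apply: ereal_inf_lbound; exists C => //.
  by apply: eq_eseriesr => k _; rewrite /truncated_weight dC.
apply: le_ereal_inf_tmp => _ [C [AC dC] <-]; apply: ereal_inf_lbound.
(* every set belongs to the sigma-algebra generated by all sets *)
exists C; first by split => // i; exact: sub_sigma_algebra.
by apply: eq_eseriesr => k _; rewrite /truncated_weight dC.
Qed.

Lemma hausdorff_pre_ge0 delta A : 0 <= hausdorff_pre d delta A.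
Proof. by rewrite hausdorff_preE mu_ext_ge0// => X; exact: truncated_weight_ge0. Qed.

Lemma hausdorff_pre_le (delta delta' : R) A : (delta <= delta')%R ->
  hausdorff_pre d delta' A <= hausdorff_pre d delta A.
Proof.
move=> dd; apply: ereal_inf_le_tmp => _ [C [AC dC] <-]; exists C => //.
by split => // k; apply: (le_trans (dC k)); rewrite lee_fin.
Qed.

Lemma hausdorff_pre_le_hausdorff (delta : R) A : (0 < delta)%R ->
  hausdorff_pre d delta A <= H A.
Proof. by move=> d0; apply: ereal_sup_ubound; exists delta. Qed.

Let hausdorff0 : H set0 = 0.
Proof.
apply/eqP; rewrite eq_le; apply/andP; split.
  apply: ge_ereal_sup => _ [e _ <-]; rewrite hausdorff_preE mu_ext0//.
    exact: truncated_weight0.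
  by move=> X; exact: truncated_weight_ge0.
apply: le_ereal_sup_tmp; exists (hausdorff_pre d 1 (set0 : set 'rV[R]_n)).
  by exists 1%R => //=; rewrite ltr01.
exact: hausdorff_pre_ge0.
Qed.

Let hausdorff_ge0 A : 0 <= H A.
Proof.
apply: le_trans (hausdorff_pre_ge0 1 A) _.
by apply: hausdorff_pre_le_hausdorff; rewrite ltr01.
Qed.

Let le_hausdorff : {homo H : A B / A `<=` B >-> A <= B}.
Proof.
move=> A B AB; apply: ge_ereal_sup => _ [e e0 <-].
apply: le_trans (hausdorff_pre_le_hausdorff _ e0).
by rewrite !hausdorff_preE; exact: le_mu_ext.
Qed.

Let hausdorff_sigma_subadditive : sigma_subadditive H.
Proof.
move=> F; apply: ge_ereal_sup => _ [e e0 <-]; rewrite hausdorff_preE.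
refine (le_trans (@mu_ext_sigma_subadditive _
  (g_sigma_algebraType [set: set 'rV[R]_n]) R (truncated_weight e)
  (truncated_weight_ge0 e) F) _).
apply: lee_nneseries => [i _ _|i _].
  by rewrite -hausdorff_preE hausdorff_pre_ge0.
by rewrite -hausdorff_preE; exact: hausdorff_pre_le_hausdorff.
Qed.

HB.instance Definition _ := isOuterMeasure.Build R (borelRn R n) (hausdorff d)
  hausdorff0 hausdorff_ge0 le_hausdorff hausdorff_sigma_subadditive.

(** A set of diameter below the separation of A and B meets only one of them,
so that a fine cover of the union splits into a cover of A and one of B. *)
Lemma hausdorff_separated A B (e : R) : (0 < e)%R ->
  (forall x y, A x -> B y -> (e <= enorm (x - y))%R) ->
  H A + H B <= H (A `|` B).
Proof.
move=> e0 sep.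
suff key (delta : R) : (0 < delta < e)%R ->
    hausdorff_pre d delta A + hausdorff_pre d delta B <=
    hausdorff_pre d delta (A `|` B).
  have [HU|HU] := eqVneq (H (A `|` B)) +oo; first by rewrite HU leey.
  have fU : H (A `|` B) \is a fin_num.
    by rewrite ge0_fin_numE// ltey.
  have fB : H B \is a fin_num.
    rewrite ge0_fin_numE// (le_lt_trans (le_hausdorff (@subsetUr _ A B)))//.
    by rewrite ltey.
  rewrite -leeBrDr//; apply: ge_ereal_sup => _ [d1 /= d10 <-].
  rewrite leeBrDr// addeC.
  have f1 : hausdorff_pre d d1 A \is a fin_num.
    rewrite ge0_fin_numE ?hausdorff_pre_ge0//.
    apply: le_lt_trans (hausdorff_pre_le_hausdorff _ d10) _.
    apply: (le_lt_trans (le_hausdorff (@subsetUl _ A B))); by rewrite ltey.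
  rewrite -leeBrDr//; apply: ge_ereal_sup => _ [d2 /= d20 <-].
  rewrite leeBrDr// addeC.
  pose d3 : R := (Num.min (Num.min d1 d2) (e / 2))%R.
  have d30 : (0 < d3)%R by rewrite !lt_min d10 d20 divr_gt0.
  have d3e : (d3 < e)%R.
    by rewrite gt_min; apply/orP; right; rewrite gtr_pMr// invf_lt1// ltr1n.
  apply: le_trans (hausdorff_pre_le_hausdorff _ d30).
  have /key : (0 < d3 < e)%R by rewrite d30.
  apply: le_trans; apply: leeD; apply: hausdorff_pre_le.
    by rewrite !ge_min lexx.
  by rewrite !ge_min lexx orbT.
move=> /andP[delta0 delta_e].
apply: le_ereal_inf_tmp => _ [C [ABC dC] <-].
pose CA k := if `[< C k `&` A !=set0 >] then C k else set0.
pose CB k := if `[< C k `&` B !=set0 >] then C k else set0.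
apply: (@le_trans _ _ (\sum_(0 <= k <oo) hausdorff_weight d (CA k) +
                       \sum_(0 <= k <oo) hausdorff_weight d (CB k))).
  apply: leeD; apply: ereal_inf_lbound.
    exists CA => //; split=> [x Ax|k].
      have [k _ Ckx] := ABC x (or_introl Ax); exists k => //.
      by rewrite /CA asboolT//; exists x.
    by rewrite /CA; case: asboolP => // _; rewrite ediam0 leNye.
  exists CB => //; split=> [x Bx|k].
    have [k _ Ckx] := ABC x (or_intror Bx); exists k => //.
    by rewrite /CB asboolT//; exists x.
  by rewrite /CB; case: asboolP => // _; rewrite ediam0 leNye.
rewrite -nneseriesD; [|by move=> *; exact: hausdorff_weight_ge0..].
apply: lee_nneseries => k _; first by move=> _; rewrite adde_ge0 ?hausdorff_weight_ge0.
rewrite /CA /CB; case: asboolP => [[x [Cx Ax]]|_]; last first.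
  rewrite hausdorff_weight0 add0e.
  by case: asboolP => // _; rewrite hausdorff_weight0 hausdorff_weight_ge0.
case: asboolP => [[y [Cy By]]|_]; last by rewrite hausdorff_weight0 adde0.
exfalso; have : (enorm (x - y))%:E <= delta%:E.
  apply: le_trans (dC k); apply: ereal_sup_ubound; exists x, y; split => //.
rewrite lee_fin => /(le_trans (sep _ _ Ax By)).
by rewrite leNgt delta_e.
Qed.

(** Caratheodory's criterion.  With O_k the points at distance at least
1/(k+1) from the complement of O, the sets X & O_k and X \ O are separated;
the annuli X & (O_(k+1) \ O_k) two steps apart are separated too, which makes
their measures summable and the measure of X & O the limit of those of
X & O_k. *)
Lemma open_caratheodory (O : set 'rV[R]_n) : open O ->
  caratheodory_measurable H O.
Proof.
move=> oO; apply: (le_caratheodory_measurable (mu := hausdorff d)) => X.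
have [HX|HX] := eqVneq (H X) +oo; first by rewrite [leRHS]HX leey.
have XIlty Y : H (X `&` Y) < +oo.
  by rewrite (le_lt_trans (le_hausdorff (@subIsetl _ X Y)))// ltey.
pose Ok (k : nat) : set 'rV[R]_n := [set x | eball x k.+1%:R^-1 `<=` O].
have sepO k x y : Ok k x -> ~ O y -> (k.+1%:R^-1 <= enorm (x - y) :> R)%R.
  move=> Okx Oy; rewrite leNgt; apply/negP => xy; apply/Oy/Okx.
  by rewrite /eball/= enormBC.
have ndO i j : (i <= j)%N -> Ok i `<=` Ok j.
  move=> ij x Oix y yx; apply: Oix; apply: le_eball yx.
  by rewrite lef_pV2 ?posrE// ler_nat.
have sepOk k x y : Ok k x -> ~ Ok k.+1 y ->
    (k.+1%:R^-1 - k.+2%:R^-1 <= enorm (x - y) :> R)%R.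
  move=> Okx /existsNP[z /not_implyP[zy Oz]].
  rewrite lerBlDr (le_trans (sepO _ _ _ Okx Oz))//.
  by rewrite (le_trans (ler_enorm_dist y _ _))// lerD2l enormBC ltW.
have gap k : (0 < k.+1%:R^-1 - k.+2%:R^-1 :> R)%R.
  by rewrite subr_gt0 ltf_pV2 ?posrE// ltr_nat.
have OkO k : Ok k `<=` O by move=> x; apply; exact: eball_center.
have OE : O = \bigcup_k Ok k.
  apply/seteqP; split=> [x Ox|x [k _]]; last exact: OkO.
  have /nbhs_eballP[r r0 rO] : nbhs x O by exact: open_nbhs_nbhs.
  have [k _ /(_ k (leqnn k)) /= kr] := near_infty_natSinv_lt (PosNum r0).
  by exists k => //; apply: subset_trans rO; apply: le_eball; exact: ltW.
pose e k := H (X `&` Ok k).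
pose Rk k := H (X `&` (Ok k.+1 `\` Ok k)).
have step k : e k + Rk k.+1 <= e k.+2.
  apply: (@le_trans _ _ (H ((X `&` Ok k) `|` (X `&` (Ok k.+2 `\` Ok k.+1))))).
    apply: (hausdorff_separated (gap k)) => x y [_ Okx] [_ [_ Oky]].
    exact: sepOk.
  apply: le_hausdorff => x [[Xx Okx]|[Xx []//]]; split => //.
  by apply: ndO Okx; rewrite (leq_trans (leqnSn _)).
have eX k : e k <= H X by apply: le_hausdorff; exact: subIsetl.
have sumR N : \sum_(1 <= i < N.+1) Rk i <= e N + e N.+1.
  elim: N => [|N IH]; first by rewrite big_geq// adde_ge0 ?hausdorff_ge0.
  rewrite big_nat_recr//= (le_trans (leeD IH (lexx _)))//.
  rewrite (addeC (e N)) -addeA; apply: leeD2l; exact: step.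
have sumRlty : \sum_(0 <= i <oo) Rk i < +oo.
  rewrite nneseries_recl//; last by move=> *; exact: hausdorff_ge0.
  rewrite lte_add_pinfty ?XIlty//.
  apply: (@le_lt_trans _ _ (H X + H X)); last first.
    by rewrite lte_add_pinfty// ltey.
  apply: lime_le.
    by apply: is_cvg_nneseries => *; exact: hausdorff_ge0.
  apply: nearW => M; have [->|M0] := posnP M.
    by rewrite big_geq// adde_ge0 ?hausdorff_ge0.
  by rewrite -(prednK M0); apply: (le_trans (sumR _)); exact: leeD.
have tail0 : (\sum_(k <= i <oo) Rk i) @[k --> \oo] --> 0.
  by apply: nneseries_tail_cvg => // k _; exact: hausdorff_ge0.
have XO k : H (X `&` O) + H (X `&` ~` O) <= H X + \sum_(k <= i <oo) Rk i.
  have split : H (X `&` O) <= e k + \sum_(k <= i <oo) Rk i.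
    have sub : X `&` O `<=` (X `&` Ok k) `|`
        \bigcup_i (X `&` (Ok (i + k).+1 `\` Ok (i + k)%N)).
      move=> x [Xx]; rewrite OE => -[j _ Ojx].
      have [Okx|nOkx] := pselect (Ok k x); [by left|right].
      have exj : exists j, `[< Ok (j + k)%N x >].
        exists j; apply/asboolP; apply: ndO Ojx; exact: leq_addr.
      case: (ex_minnP exj) => -[/asboolP //|i /asboolP Oi mini].
      exists i => //; split=> //; split => // /asboolP /mini.
      by rewrite ltnn.
    apply: (le_trans (le_hausdorff sub)).
    apply: (le_trans (outer_measureU2 (hausdorff d) _ _)).
    apply: leeD => //.
    apply: (le_trans (hausdorff_sigma_subadditive _)).
    by rewrite -(@nneseries_addn _ Rk)// => i; exact: hausdorff_ge0.
  have sep : e k + H (X `&` ~` O) <= H X.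
    apply: (@le_trans _ _ (H ((X `&` Ok k) `|` (X `&` ~` O)))).
      have k0 : (0 < k.+1%:R^-1 :> R)%R by rewrite invr_gt0.
      apply: (hausdorff_separated k0) => x y [_ Okx] [_ Oy].
      exact: sepO.
    by apply: le_hausdorff => x [|] [].
  rewrite (le_trans (leeD split (lexx _)))// addeAC leeD2r//.
have cvgX : (H X + \sum_(k <= i <oo) Rk i) @[k --> \oo] --> H X + 0.
  by apply: cvgeD => //; [rewrite ge0_adde_def// inE|exact: cvg_cst].
rewrite -[leRHS]adde0 -(cvg_lim _ cvgX)//; apply: lime_ge.
  by apply/cvg_ex; eexists; exact: cvgX.
exact: nearW.
Qed.

Lemma borel_caratheodory (A : set (borelRn R n)) :
  measurable A -> caratheodory_measurable H A.
Proof.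
apply: smallest_sub => [|O]; last exact: open_caratheodory.
split=> [|B mB|F mF].
- exact: (caratheodory_measurable_set0 (hausdorff d)).
- by rewrite setTD; exact: (caratheodory_measurable_setC (mu := hausdorff d)).
- exact: (caratheodory_measurable_bigcup (mu := hausdorff d)).
Qed.

Let hausdorff_sigma_additive : semi_sigma_additive H.
Proof.
move=> F mF tF mUF.
by apply: (@caratheodory_measure_sigma_additive R (borelRn R n) (hausdorff d) F)
  => // [k|]; exact: borel_caratheodory.
Qed.

HB.instance Definition _ := isMeasure.Build _ _ _
  (hausdorff d : set (borelRn R n) -> \bar R)
  hausdorff0 hausdorff_ge0 hausdorff_sigma_additive.

End hausdorff_outer_measure.

(** * Translation invariance of Lebesgue measure *)

Section lebesgue_invariance.
Context {R : realType}.
Local Open Scope ereal_scope.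

Lemma lebesgue_measure_translate (a : R) (A : set (measurableTypeR R)) :
  measurable A -> lebesgue_measure [set x | A (x + a)%R] = lebesgue_measure A.
Proof.
pose t : measurableTypeR R -> measurableTypeR R := (fun x => x + a)%R.
have mphi : measurable_fun setT t by apply: measurable_funD.
move=> mA; apply/esym.
have := @lebesgue_measure_unique R (pushforward lebesgue_measure t); apply => //.
move=> _ [[b c] _ <-]; rewrite [RHS](_ : _ = lebesgue_measure (`](b - a)%R, (c - a)%R]%classic : set R)).
  rewrite !lebesgue_measure_itv/= !lte_fin ltrD2r; case: ifP => // _.
  by congr (_%:E); ring.
congr (lebesgue_measure _).
by apply/seteqP; split => x; rewrite /t /= !in_itv/= ltrBlDr lerBrDr.
Qed.

Lemma measurable_translate n (a : 'rV[R]_n) :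
  measurable_fun setT (fun x : borelRn R n => (x + a)%R : borelRn R n).
Proof.
apply: measurable_rV => i.
rewrite (_ : (fun _ => _) = (fun x : borelRn R n => (x : 'rV_n) 0 i + a 0 i)%R).
  by apply: measurable_funD => //; exact: measurable_coord.
by apply/funext => x; rewrite mxE.
Qed.

(** Induction on the dimension: translation acts on each factor of a product, and
a product measure is determined by its values on rectangles. *)
Lemma lebesgue_Rn_translate n (a : 'rV[R]_n) (A : set (borelRn R n)) :
  measurable A -> lebesgue_Rn n [set x | A (x + a)%R] = lebesgue_Rn n A.
Proof.
elim: n a A => [|n IH] a A mA.
  rewrite (_ : [set x | A (x + a)%R] = A)//.
  have tE (x y : 'rV[R]_0) : x = y by apply/rowP => -[].
  by apply/seteqP; split => x /=; rewrite (tE (x + a)%R x).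
pose a' : 'rV[R]_n := (\row_j a 0 (lift 0 j))%R.
pose t (p : measurableTypeR R * borelRn R n) : measurableTypeR R * borelRn R n :=
  ((p.1 + a 0 0)%R, (p.2 + a')%R).
have mphi : measurable_fun setT t.
  apply/measurable_fun_pairP; split => /=.
    by apply: measurable_funD.
  by apply: (measurableT_comp (measurable_translate a')).
rewrite /= /lebesgue_Rn_step /pushforward.
have mB : measurable (@cons_rV R n @^-1` A).
  by rewrite -[X in measurable X]setTI; exact: measurable_cons_rV.
pose m' : {measure set (measurableTypeR R * borelRn R n) -> \bar R} :=
  pushforward (lebesgue_measure \x lebesgue_Rn n) t.
rewrite [RHS](@product_measure_unique _ _ _ _ _ lebesgue_measure (lebesgue_Rn n) (m' mphi))//.
- rewrite /m' /= /pushforward /=; congr (_ _); apply/seteqP.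
  have E (p : measurableTypeR R * borelRn R n) :
      (cons_rV p + a)%R = cons_rV ((p.1 + a 0 0)%R, (p.2 + a')%R).
    case: p => x y; apply/rowP => j; rewrite mxE.
    case: (unliftP 0%R j) => [i ->|->]; last by rewrite !cons_rV0.
    by rewrite !cons_rVS !mxE.
  by split=> p /=; rewrite E.
- move=> B C mB' mC; rewrite /m' /= /pushforward /=.
  rewrite (_ : _ @^-1` _ = [set x | B (x + a 0 0)%R] `*` [set y | C (y + a')%R])//.
  rewrite product_measure1E.
  + by congr (_ * _); [exact: lebesgue_measure_translate|exact: IH].
  + by rewrite -[X in measurable X]setTI; apply: (measurable_funD (f := id) (g := cst _)).
  + by rewrite -[X in measurable X]setTI; exact: measurable_translate.
Qed.

Lemma lebesgue_Rn_ball n (x : 'rV[R]_n) (r : R) : (0 < r)%R ->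
  0 < lebesgue_Rn n (ball x r) < +oo.
Proof.
move=> r0; elim: n x => [|n IH] x.
  rewrite /= diracE mem_set ?lte01 ?ltry//.
  by split => // i [].
rewrite /= /lebesgue_Rn_step /pushforward.
pose x' : 'rV[R]_n := (\row_j x 0 (lift 0 j))%R.
rewrite (_ : _ @^-1` _ = (ball (x 0 0)%R r : set R) `*` (ball x' r : set 'rV[R]_n)).
  rewrite product_measure1E; last 2 first.
  - exact: measurable_ball.
  - apply: open_measurable_Rn; exact: ball_open.
  have /andP[p0 poo] := IH x'.
  set l := (X in X * _).
  have -> : l = (r *+ 2)%:E by apply: lebesgue_measure_ball; exact: ltW.
  by rewrite mule_gt0 ?lte_fin ?mulrn_wgt0//= lte_mul_pinfty// lee_fin mulrn_wge0// ltW.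
apply/seteqP; split=> -[y z] /=.
  move=> [_ H]; split => //=.
    by have := H 0%R 0%R; rewrite cons_rV0.
  by split=> // i j; rewrite !mxE ord1; have := H 0%R (lift 0%R j); rewrite cons_rVS.
move=> [/= Hy [_ Hz]]; split=> // i j; rewrite ord1.
case: (unliftP 0%R j) => [k ->|->]; last by rewrite cons_rV0.
by rewrite cons_rVS; have := Hz 0%R k; rewrite mxE.
Qed.

Lemma lebesgue_Rn_eball_lty n (x : 'rV[R]_n) (r : R) :
  lebesgue_Rn n (eball x r) < +oo.
Proof.
have [r0|r0] := ltP 0%R r; last first.
  rewrite (_ : eball x r = set0) ?measure0//.
  apply/seteqP; split => // y; rewrite /eball/= => /(le_lt_trans (enorm_ge0 _)).
  by rewrite ltNge r0.
have /andP[_] := lebesgue_Rn_ball x r0; apply: le_lt_trans.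
apply: le_measure; rewrite ?inE; first exact: measurable_eball.
- by apply: open_measurable_Rn; exact: ball_open.
- exact: eball_sub_ball.
Qed.

Lemma lebesgue_Rn_eball_gt0 n (x : 'rV[R]_n) (r : R) : (0 < r)%R ->
  0 < lebesgue_Rn n (eball x r).
Proof.
move=> r0; have r'0 : (0 < r / n.+1%:R)%R by rewrite divr_gt0.
have /andP[+ _] := lebesgue_Rn_ball x r'0; move/lt_le_trans; apply.
apply: le_measure; rewrite ?inE; last exact: ball_sub_eball.
- by apply: open_measurable_Rn; exact: ball_open.
- exact: measurable_eball.
Qed.

Lemma ge0_integral_translate n (a : 'rV[R]_n) (f : borelRn R n -> \bar R) :
  measurable_fun setT f -> (forall x, 0 <= f x) ->
  \int[lebesgue_Rn n]_x f (x + a)%R = \int[lebesgue_Rn n]_x f x.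
Proof.
move=> mf f0.
have mt := measurable_translate a.
pose L' : {measure set (borelRn R n) -> \bar R} :=
  pushforward (lebesgue_Rn n) (fun x : borelRn R n => (x + a)%R : borelRn R n).
rewrite [RHS](@eq_measure_integral _ _ _ setT (L' mt)).
  by rewrite (ge0_integral_pushforward mt).
by move=> A mA _; rewrite -[LHS](lebesgue_Rn_translate a).
Qed.

End lebesgue_invariance.

(** * Test functions *)

Section test_functions.
Context {R : realType} {n : nat}.
Implicit Types (phi : 'rV[R]_n -> R) (V : set 'rV[R]_n).

Lemma cvg_scale_dnbhs0 (c : R) : c != 0 -> (c * h) @[h --> 0^'] --> (0 : R)^'.
Proof.
move=> c0 A [e /= e0 eA].
exists (e / `|c|); first by rewrite /= divr_gt0// normr_gt0.
move=> h /=; rewrite sub0r normrN ltr_pdivlMr ?normr_gt0// => he h0.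
apply: eA; last by rewrite mulf_neq0.
by rewrite /ball_/= sub0r normrN normrM mulrC.
Qed.

Lemma derivable_affine phi (c : R) (x y v : 'rV[R]_n) : c != 0 ->
  derivable phi (c *: (y - x)) v ->
  derivable (fun z => phi (c *: (z - x))) y v /\
  'D_v (fun z => phi (c *: (z - x))) y = c * 'D_v phi (c *: (y - x)).
Proof.
move=> c0 dphi.
pose q (h : R) := h^-1 *: ((phi \o shift (c *: (y - x))) (h *: v) -
  phi (c *: (y - x))).
suff H : (h^-1 *: (((fun z => phi (c *: (z - x))) \o shift y) (h *: v) -
    phi (c *: (y - x))) @[h --> 0^']) --> c * 'D_v phi (c *: (y - x)).
  by split; [apply/cvg_ex; eexists; exact: H|apply/cvg_lim].
rewrite (_ : (fun h => _) = (fun h => c * q (c * h))); last first.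
  have scaleE (h w : R) : c * ((c * h)^-1 *: w) = h^-1 *: w.
    by rewrite /GRing.scale/= invfM !mulrA divff// mul1r.
  apply/funext => h; rewrite /q scaleE/=; congr (_ *: (phi _ - _)).
  by rewrite -scalerA -scalerDr addrA.
apply: cvgMr; apply: (@cvg_comp _ _ _ (fun h => c * h) q _ _ _ _ dphi).
exact: cvg_scale_dnbhs0.
Qed.

(** Each derivative of z |-> phi (c *: (z - x)) brings out one factor c. *)
Lemma iter_partial_affine phi (c : R) (x : 'rV[R]_n) s : c != 0 -> smooth phi ->
  iter_partial s (fun z => phi (c *: (z - x))) =
  (fun z => c ^+ size s * iter_partial s phi (c *: (z - x))).
Proof.
move=> c0 sphi; elim: s => [|i s IH].
  by apply/funext => z /=; rewrite expr0 mul1r.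
rewrite /= IH; apply/funext => y; rewrite /partial.
have [_ /(_ i (c *: (y - x))) dphi] := sphi s.
have [d1 d2] := derivable_affine c0 dphi.
rewrite (deriveZ (c ^+ size s) d1) d2 /GRing.scale/=.
by rewrite exprSr mulrA.
Qed.

Lemma affine_continuous (c : R) (b : 'rV[R]_n) : c != 0 ->
  continuous (fun z : 'rV[R]_n => c *: z + b).
Proof.
move=> c0 z A /nbhs_eballP[e e0 eA]; apply/nbhs_eballP.
exists (e / `|c|); first by rewrite divr_gt0// normr_gt0.
move=> w; rewrite /eball/= ltr_pdivlMr ?normr_gt0// mulrC -enormZ => zw.
by apply: eA; rewrite /eball/= opprD addrACA subrr addr0 -scalerBr.
Qed.

Lemma smooth_affine phi (c : R) (x : 'rV[R]_n) : c != 0 -> smooth phi ->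
  smooth (fun z => phi (c *: (z - x))).
Proof.
move=> c0 sphi s; rewrite iter_partial_affine//; have [cphi dphi] := sphi s.
split=> [z|i y].
  rewrite (_ : (fun y => _) = (fun y => c ^+ size s *
      iter_partial s phi (c *: y - c *: x))); last first.
    by apply/funext => y; rewrite scalerBr.
  move=> A HA; have aff := @affine_continuous c (- (c *: x)) c0 z.
  exact: aff _ (cphi _ _ (mulrl_continuous HA)).
have [d1 _] := derivable_affine c0 (dphi i (c *: (y - x))).
exact: (derivableZ d1).
Qed.

Lemma Cc_bounded V phi : Cc V phi -> exists M : R, forall x, `|phi x| <= M.
Proof.
move=> [cphi [K [cK KV phi0]]].
have /compact_bounded[M [_ HM]] : compact (phi @` K).
  by apply: continuous_compact => //; exact: continuous_subspaceT.
exists (Num.max 0 (M + 1)) => x; have [Kx|/phi0->] := pselect (K x).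
  by rewrite le_max; apply/orP; right; apply: HM => //; rewrite ltrDl.
by rewrite normr0 le_max lexx.
Qed.

Lemma Ccoo_Cc V phi : Ccoo V phi -> Cc V phi.
Proof. by move=> [/(_ [::])[+ _] ?]; split. Qed.

Lemma Ccoo_affine V phi (c : R) (x : 'rV[R]_n) : 0 < c ->
  Ccoo (eball 0 1) phi -> eball x c^-1 `<=` V ->
  Ccoo V (fun z => phi (c *: (z - x))).
Proof.
move=> c0 [sphi [K [cK KB phi0]]] xV; split; first by apply: smooth_affine => //; rewrite gt_eqF.
exists ((fun z => c^-1 *: z + x) @` K); split.
- apply: continuous_compact => //; apply: continuous_subspaceT.
  by apply: affine_continuous; rewrite invr_neq0// gt_eqF.
- move=> _ [z Kz <-]; apply: xV; rewrite /eball/= addrK enormZ gtr0_norm ?invr_gt0//.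
  by rewrite gtr_pMr ?invr_gt0//; have := KB _ Kz; rewrite /eball/= subr0.
- move=> z Kz; apply: phi0 => Kz'; apply: Kz; exists (c *: (z - x)) => //.
  by rewrite scalerA mulVf ?gt_eqF// scale1r subrK.
Qed.

Lemma measurable_Cc V phi : Cc V phi ->
  measurable_fun setT (phi : borelRn R n -> R).
Proof. by move=> [? _]; exact: continuous_measurable_Rn. Qed.

Lemma integrable_Cc V phi (mu : {measure set (borelRn R n) -> \bar R}) :
  (mu setT < +oo)%E -> Cc V phi -> mu.-integrable setT (EFin \o phi).
Proof.
move=> muoo Cphi; apply: measurable_bounded_integrable => //.
  exact: measurable_Cc Cphi.
have [M HM] := Cc_bounded Cphi.
by exists M; split; [exact: num_real|move=> y My x _ /=; rewrite (le_trans (HM x))// ltW].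
Qed.

End test_functions.

Section uniform_continuity.
Context {R : realType} {n : nat}.

Lemma Cc_unif_continuous V (phi : 'rV[R]_n -> R) (eta : R) : Cc V phi -> 0 < eta ->
  exists2 d : R, 0 < d & forall x y, enorm (y - x) < d -> `|phi y - phi x| <= eta.
Proof.
move=> [cphi [K [cK _ phi0]]] eta0.
have eta20 : 0 < eta / 2 by rewrite divr_gt0.
have local x : exists2 r : R, 0 < r &
    forall z, eball x r z -> `|phi x - phi z| < eta / 2.
  have /nbhs_eballP[r r0 Hr] := cphi x _ (nbhsx_ballx (phi x) _ eta20).
  by exists r => // z /Hr; rewrite /= -ball_normE.
have [d d0 Hd] : exists2 d : R, 0 < d & forall x, K x ->
    forall y, enorm (y - x) < d -> `|phi y - phi x| <= eta.
  have /compact_near_coveringP/(_ R (0^'+)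
    (fun d x => forall y, enorm (y - x) < d -> `|phi y - phi x| <= eta)) := cK.
  case=> [x Kx|d /= d0 Hd].
    have [r r0 Hr] := local x; have r20 : 0 < r / 2 by rewrite divr_gt0.
    exists (eball x (r / 2), [set d | d < r / 2]).
      by split; [exact: nbhs_eball|exact: nbhs_right_lt].
    move=> [x' d] /= [xx' dr] y yx'.
    have xr : eball x r x' by apply: le_eball xx'; rewrite ler_pdivrMr// ler_peMr ?ler1n// ltW.
    have yr : eball x r y.
      rewrite /eball/= (le_lt_trans (ler_enorm_dist x' _ _))// [ltRHS]splitr.
      by rewrite ltrD// (lt_trans yx').
    rewrite (le_trans (ler_distD (phi x) _ _))// [leRHS]splitr lerD//.
      by rewrite distrC; apply: ltW; exact: Hr.
    by apply: ltW; exact: Hr.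
  exists (d / 2); first by rewrite divr_gt0.
  move=> x Kx; apply: (Hd (d / 2)) => //=; last by rewrite divr_gt0.
  by rewrite sub0r normrN gtr0_norm ?divr_gt0// ltr_pdivrMr// ltr_pMr// ltr1n.
exists d => // x y yx; have [Kx|Kx] := pselect (K x); first exact: Hd.
have [Ky|Ky] := pselect (K y); first by rewrite distrC; apply: Hd => //; rewrite enormBC.
by rewrite !phi0// subrr normr0 ltW.
Qed.

End uniform_continuity.

(** * Charges are determined by smooth test functions *)

Section mollifier.
Context {R : realType} {n : nat}.
Variables (rho : 'rV[R]_n -> R) (rhoP : standard_mollifier rho).
Local Notation L := (lebesgue_Rn n).

Lemma mollifier_ge0 x : 0 <= rho x. Proof. by case: rhoP. Qed.

Lemma mollifier_continuous : continuous rho.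
Proof. by case: rhoP => /Ccoo_Cc[]. Qed.

Lemma mollifier_out x : 1 <= enorm x -> rho x = 0.
Proof.
case: rhoP => -[_ [K [cK KB H]]] _ _ _ _ x1; apply: H => /KB.
by rewrite /eball/= subr0 ltNge x1.
Qed.

Lemma mollifier_lower : exists2 s : R, 0 < s &
  forall x, enorm x < s -> rho 0 / 2 <= rho x.
Proof.
have rho0 : 0 < rho 0 by case: rhoP.
have rho20 : 0 < rho 0 / 2 by rewrite divr_gt0.
have := @mollifier_continuous 0 _ (nbhsx_ballx (rho 0) _ rho20).
move=> /nbhs_eballP[s s0 sB]; exists s => // x xs.
have := sB x; rewrite /eball/= subr0 => /(_ xs).
rewrite -ball_normE /ball_/= => /ltW.
rewrite ler_norml => /andP[_]; lra.
Qed.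

(** A smooth substitute for the indicator function of the t-ball around x. *)
Definition bump (t : R) (x y : 'rV[R]_n) : R := rho (t^-1 *: (y - x)).

Lemma bump_ge0 t x y : 0 <= bump t x y. Proof. exact: mollifier_ge0. Qed.

Lemma bumpC t x y : bump t x y = bump t y x.
Proof.
case: rhoP => _ _ sym _ _; apply: sym.
by rewrite -[x - y]opprB scalerN enormN.
Qed.

Lemma bump_out t x y : 0 < t -> ~ eball x t y -> bump t x y = 0.
Proof.
move=> t0; rewrite /eball/= => /negP; rewrite -leNgt => txy.
apply: mollifier_out.
by rewrite enormZ gtr0_norm ?invr_gt0// mulrC ler_pdivlMr// mul1r.
Qed.

Lemma Ccoo_bump V t x : 0 < t -> eball x t `<=` V -> Ccoo V (bump t x).
Proof.
move=> t0 xV; apply: Ccoo_affine; rewrite ?invr_gt0 ?invrK//.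
by case: rhoP.
Qed.

Lemma measurable_bump2 t : measurable_fun setT
  (fun p : borelRn R n * borelRn R n => bump t (p.1 : 'rV_n) (p.2 : 'rV_n)).
Proof.
have mrho : measurable_fun setT (rho : borelRn R n -> R).
  by apply: continuous_measurable_Rn; exact: mollifier_continuous.
apply: (measurableT_comp mrho (g := fun p : borelRn R n * borelRn R n =>
  (t^-1 *: ((p.2 : 'rV_n) - p.1) : borelRn R n))).
apply: measurable_rV => i.
rewrite (_ : (fun _ => _) = (fun p : borelRn R n * borelRn R n =>
    t^-1 * ((p.2 : 'rV_n) 0 i - (p.1 : 'rV_n) 0 i))); last first.
  by apply/funext => p; rewrite !mxE.
apply: measurable_funM => //; apply: measurable_funB.
- by apply: (measurableT_comp (measurable_coord i)).
- by apply: (measurableT_comp (measurable_coord i)).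
Qed.

Lemma measurable_bump t x : measurable_fun setT (bump t x : borelRn R n -> R).
Proof.
have mx : measurable_fun setT
    (fun y : borelRn R n => ((x : borelRn R n), y)) by exact: measurable_pair1.
exact: (measurableT_comp (measurable_bump2 t) mx).
Qed.

(** By translation invariance the mass Z is the same for all y. *)
Lemma bump_mass t : 0 < t -> exists2 Z : R, 0 < Z &
  forall y, (\int[L]_x (bump t x y)%:E = Z%:E)%E.
Proof.
move=> t0.
have mb : measurable_fun setT (fun x : borelRn R n => (bump t 0 x)%:E : \bar R).
  by apply/measurable_EFinP; exact: measurable_bump.
have b0 x : (0 <= (bump t 0 x)%:E)%E by rewrite lee_fin bump_ge0.
have E y : (\int[L]_x (bump t x y)%:E = \int[L]_x (bump t 0 x)%:E)%E.
  rewrite -(ge0_integral_translate (- y) mb b0).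
  by apply: eq_integral => x _; rewrite bumpC /bump subr0.
have [s s0 sl] := mollifier_lower.
have rho0 : 0 < rho 0 by case: rhoP.
have pos : (0 < \int[L]_x (bump t 0 x)%:E)%E.
  apply: (@lt_le_trans _ _ (\int[L]_(x in eball 0 (s * t)) (rho 0 / 2)%:E)%E).
    rewrite integral_cst; last exact: measurable_eball.
    by rewrite mule_gt0// ?lte_fin ?divr_gt0// lebesgue_Rn_eball_gt0// mulr_gt0.
  apply: (@le_trans _ _ (\int[L]_(x in eball 0 (s * t)) (bump t 0 x)%:E)%E).
    apply: ge0_le_integral; first exact: measurable_eball.
    - by move=> x _; rewrite lee_fin divr_ge0// ltW.
    - exact: measurable_cst.
    - exact: measurable_funTS.
    - move=> x; rewrite /eball/= subr0 lee_fin => xs; apply: sl.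
      by rewrite subr0 enormZ gtr0_norm ?invr_gt0// mulrC ltr_pdivrMr.
  by apply: ge0_subset_integral => //; exact: measurable_eball.
have fin : (\int[L]_x (bump t 0 x)%:E < +oo)%E.
  have [M HM] := Cc_bounded (Ccoo_Cc (Ccoo_bump (V := setT) (x := 0) t0 (@subsetT _ _))).
  rewrite (_ : (\int[L]_x _ = \int[L]_(x in eball 0 t) (bump t 0 x)%:E)%E); last first.
    rewrite [RHS]integral_mkcond; apply: eq_integral => x _.
    rewrite patchE; case: ifPn => // /negP; rewrite inE => xt.
    by rewrite bump_out.
  apply: (@le_lt_trans _ _ (\int[L]_(x in eball 0 t) (Num.max 0 M)%:E)%E).
    apply: ge0_le_integral; first exact: measurable_eball.
    - by move=> x _; exact: b0.
    - exact: measurable_funTS.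
    - exact: measurable_cst.
    - move=> x _; rewrite lee_fin le_max; apply/orP; right.
      exact: le_trans (ler_norm _) (HM x).
  rewrite integral_cst; last exact: measurable_eball.
  by rewrite lte_mul_pinfty ?lebesgue_Rn_eball_lty// lee_fin le_max lexx.
exists (fine (\int[L]_x (bump t 0 x)%:E)%E).
  by rewrite fine_gt0// pos.
by move=> y; rewrite E fineK// ge0_fin_numE// ltW.
Qed.

(** Integrating [bump t x] over the centers x whose t-ball lies in O gives a
function supported in O, at most Z, and equal to Z at the points whose
2t-ball lies in O. By Tonelli a and b give it the same integral; then t
tends to 0. *)
Lemma open_measure_le (a b : {finite_measure set (borelRn R n) -> \bar R}) V O :
  (forall phi, Ccoo V phi -> (forall x, 0 <= phi x) ->
     (\int[a]_x (phi x)%:E = \int[b]_x (phi x)%:E)%E) ->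
  open O -> O `<=` V -> (a O <= b O)%E.
Proof.
move=> ab oO OV.
pose Ot (t : R) : set (borelRn R n) := [set x | eball (x : 'rV_n) t `<=` O].
have mOt t : measurable (Ot t).
  rewrite -[Ot t]setCK; apply: measurableC; apply: open_measurable_Rn.
  rewrite (_ : ~` Ot t = \bigcup_(z in ~` O) eball z t).
    by apply: bigcup_open => z _; exact: open_eball.
  apply/seteqP; split=> [x /existsNP[z /not_implyP[xz Oz]]|x [z Oz xz] xO].
    by exists z => //; exact: eball_sym.
  exact/Oz/xO/eball_sym.
have mO : measurable (O : set (borelRn R n)) by exact: open_measurable_Rn.
have key (t : R) : 0 < t -> (a (Ot (t + t)%R) <= b O)%E.
  move=> t0; have [Z Z0 HZ] := bump_mass t0.
  pose f (y : borelRn R n) : \bar R := (\int[L]_(x in Ot t) (bump t x y)%:E)%E.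
  pose G (p : borelRn R n * borelRn R n) : \bar R :=
    ((bump t p.1 p.2)%:E * (\1_(Ot t) p.1)%:E)%E.
  have mG : measurable_fun setT G.
    apply: emeasurable_funM; apply/measurable_EFinP; first exact: measurable_bump2.
    apply: measurableT_comp => //; exact: measurable_indic.
  have G0 p : (0 <= G p)%E by rewrite mule_ge0// lee_fin bump_ge0.
  have fE y : f y = (\int[L]_x G (x, y))%E.
    rewrite /f integral_mkcond; apply: eq_integral => x _.
    rewrite patchE /G/= indicE; case: ifPn => xO; first by rewrite mule1.
    by rewrite mule0.
  have mf : measurable_fun setT f.
    rewrite (_ : f = fubini_G L G); last by apply/funext => y; rewrite fE.
    exact: measurable_fun_fubini_tonelli_G.
  have f0 y : (0 <= f y)%E by apply: integral_ge0 => x _; rewrite lee_fin bump_ge0.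
  have intf (c : {finite_measure set (borelRn R n) -> \bar R}) :
      (\int[c]_y f y = \int[L]_(x in Ot t) \int[c]_y (bump t x y)%:E)%E.
    rewrite (eq_integral _ _ (fun y _ => fE y)) -(fubini_tonelli G)//.
    rewrite [RHS]integral_mkcond; apply: eq_integral => x _.
    rewrite patchE /G/= indicE; case: ifPn => xO.
      by apply: eq_integral => y _; rewrite mule1.
    by rewrite integral0_eq// => y _; rewrite mule0.
  have abf : (\int[a]_y f y = \int[b]_y f y)%E.
    rewrite !intf; apply: eq_integral => x; rewrite inE => xO.
    apply: ab; last by move=> y; exact: bump_ge0.
    by apply: Ccoo_bump => //; exact: subset_trans OV.
  have mbump y : measurable_fun setT (fun x : borelRn R n => (bump t x y)%:E : \bar R).
    apply/measurable_EFinP; under eq_fun do rewrite bumpC.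
    exact: measurable_bump.
  have fZ y : (f y <= Z%:E)%E.
    rewrite -(HZ y); apply: ge0_subset_integral => //.
    by move=> x _; rewrite lee_fin bump_ge0.
  have fout y : ~ O y -> f y = 0%E.
    move=> Oy; apply: integral0_eq => x xO; rewrite bump_out// => xy.
    exact/Oy/xO.
  have fin y : Ot (t + t)%R y -> f y = Z%:E.
    move=> yO; rewrite -(HZ y) /f integral_mkcond; apply: eq_integral => x _.
    rewrite patchE; case: ifPn => // /negP; rewrite inE => xO.
    rewrite bump_out// => xy; apply: xO => z zx; apply: yO; move: z zx.
    by apply: eball_triangle; rewrite lerD2l ltW// enormBC.
  suff : (Z%:E * a (Ot (t + t)%R) <= Z%:E * b O)%E by rewrite lee_pmul2l.
  apply: (@le_trans _ _ (\int[a]_y f y)%E).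
    rewrite -integral_cst//.
    apply: (@le_trans _ _ (\int[a]_(y in Ot (t + t)%R) f y)%E).
      rewrite le_eqVlt; apply/orP; left; apply/eqP.
      by apply: eq_integral => y; rewrite inE => /fin ->.
    by apply: ge0_subset_integral.
  rewrite abf -integral_cst// [leRHS]integral_mkcond.
  apply: ge0_le_integral => //.
  - by apply/(measurable_restrictT _ _).1 => //; exact: measurable_cst.
  - move=> y _; rewrite patchE; case: ifPn => [_|/negP]; first exact: fZ.
    by rewrite inE => /fout ->.
pose t (k : nat) : R := k.+1%:R^-1.
have t0 k : 0 < t k by rewrite invr_gt0.
have OE : O = \bigcup_k Ot (t k + t k)%R.
  apply/seteqP; split=> [x Ox|x [k _]]; last first.
    by apply; apply: eball_center; rewrite addr_gt0.
  have /nbhs_eballP[r r0 rO] : nbhs x O by exact: open_nbhs_nbhs.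
  have r20 : 0 < r / 2 by rewrite divr_gt0.
  have [k _ /(_ k (leqnn k)) /= kr] := near_infty_natSinv_lt (PosNum r20).
  exists k => //; apply: subset_trans rO; apply: le_eball.
  by rewrite [leRHS]splitr ltW// ltrD.
have cvg : a (Ot (t k + t k)%R) @[k --> \oo] --> a O.
  rewrite [in a O]OE; apply: nondecreasing_cvg_mu.
  - by move=> k; exact: mOt.
  - by apply: bigcupT_measurable => k; exact: mOt.
  - move=> i j ij; apply/subsetPset => x xO y yx; apply: xO; apply: le_eball yx.
    by rewrite lerD// lef_pV2 ?posrE// ler_nat.
rewrite -(cvg_lim _ cvg)//; apply: lime_le; first by apply/cvg_ex; eexists; exact: cvg.
by apply: nearW => k; exact: key.
Qed.

(** The open sets are stable under intersection and generate the Borel sets. *)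
Lemma borel_measure_eq (a b : {finite_measure set (borelRn R n) -> \bar R}) V :
  open V ->
  (forall phi, Ccoo V phi -> (forall x, 0 <= phi x) ->
     (\int[a]_x (phi x)%:E = \int[b]_x (phi x)%:E)%E) ->
  forall B : set (borelRn R n), measurable B -> B `<=` V -> a B = b B.
Proof.
move=> oV ab B mB BV.
have mV : measurable (V : set (borelRn R n)) by exact: open_measurable_Rn.
have abO O : open O -> O `<=` V -> a O = b O.
  move=> oO OV; apply/eqP; rewrite eq_le (open_measure_le ab)//=.
  by apply: (open_measure_le (V := V)) => // phi c p; rewrite ab.
suff : mrestr a mV B = mrestr b mV B by rewrite /mrestr; have /setIidl -> := BV.
apply: (@measure_unique _ _ (borelRn R n) (@open 'rV[R]_n) (fun=> setT)
  _ _ _ _ (mrestr a mV) (mrestr b mV)) => //.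
- by move=> A C oA oC; exact: openI.
- by move=> _; exact: openT.
- by rewrite bigcup_const//; exists 0%N.
- by move=> A oA; rewrite /mrestr; apply: abO; [exact: openI|exact: subIsetr].
- by move=> k; rewrite ltey_eq fin_num_measure// setTI.
Qed.

End mollifier.

Section measure_add_finite.
Context d (T : measurableType d) (R : realType).
Variables m1 m2 : {finite_measure set T -> \bar R}.

Let measure_add_fin : fin_num_fun (measure_add m1 m2).
Proof.
by move=> A mA; rewrite measure_addE fin_numD !fin_num_measure.
Qed.

HB.instance Definition _ := Measure.on (measure_add m1 m2).
HB.instance Definition _ := @Measure_isFinite.Build _ _ _
  (measure_add m1 m2) measure_add_fin.

End measure_add_finite.

(** Presents the integral against nu through two measures, hiding the Hahn sets
chosen in its definition. *)
Lemma charge_integral_decomp d (T : measurableType d) (R : realType)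
    (nu : {charge set T -> \bar R}) :
  exists p q : {finite_measure set T -> \bar R},
    (forall A, measurable A -> nu A = p A - q A)%E /\
    forall D f, charge_integral nu D f =
      \int[p]_(x in D) f x - \int[q]_(x in D) f x.
Proof.
rewrite /charge_integral; case: cid => P exN; case: cid => N nuPN.
exists (jordan_pos nuPN), (jordan_neg nuPN); split=> // A mA.
by rewrite (jordan_decomp nuPN mA) /cadd/= cscaleN1.
Qed.

Lemma fin_num_sub_eq (R : realType) (a b c e : \bar R) :
  a \is a fin_num -> b \is a fin_num -> c \is a fin_num -> e \is a fin_num ->
  (a + e = c + b -> a - b = c - e)%E.
Proof.
move: a b c e => [a||] [b||] [c||] [e||]//= _ _ _ _ [h].
by rewrite -!EFinB; congr EFin; lra.
Qed.

Section charges_on_Rn.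
Context {R : realType} {n : nat}.
Variables (rho : 'rV[R]_n -> R) (rhoP : standard_mollifier rho).
Implicit Types nu : {charge set (borelRn R n) -> \bar R}.

Lemma ge0_fine_Cc V (phi : 'rV[R]_n -> R)
    (p : {finite_measure set (borelRn R n) -> \bar R}) :
  Cc V phi -> (\int[p]_x (phi x)%:E \is a fin_num)%E.
Proof.
move=> Cphi; apply: integrable_fin_num => //.
by apply: integrable_Cc Cphi; rewrite ltey_eq fin_num_measure.
Qed.

(** With nu = p - q and nu' = p' - q', moving the negative parts across the
equation reduces it to the equality of the finite measures p + q' and
p' + q. *)
Lemma charge_eq nu nu' V : open V ->
  (forall phi, Ccoo V phi ->
     charge_integral nu setT phi = charge_integral nu' setT phi) ->
  forall B : set (borelRn R n), measurable B -> B `<=` V -> nu B = nu' B.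
Proof.
move=> oV E B mB BV.
have [p [q [nuE nuI]]] := charge_integral_decomp nu.
have [p' [q' [nu'E nu'I]]] := charge_integral_decomp nu'.
have pf (m : {finite_measure set (borelRn R n) -> \bar R}) : m B \is a fin_num.
  exact: fin_num_measure.
rewrite nuE// nu'E//; apply: fin_num_sub_eq; try exact: pf.
transitivity (measure_add p q' B); first by rewrite measure_addE.
transitivity (measure_add p' q B); last by rewrite measure_addE.
apply: (@borel_measure_eq R n rho rhoP (measure_add p q') (measure_add p' q) V)
  => // phi Cphi phi0.
have mphi : measurable_fun setT (fun x : borelRn R n => (phi x)%:E : \bar R).
  by apply/measurable_EFinP; exact: measurable_Cc (Ccoo_Cc Cphi).
have addE (m1 m2 : {finite_measure set (borelRn R n) -> \bar R}) :
    (\int[measure_add m1 m2]_x (phi x)%:E =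
     \int[m1]_x (phi x)%:E + \int[m2]_x (phi x)%:E)%E.
  by rewrite ge0_integral_measure_add// => x _; rewrite lee_fin.
rewrite [LHS]addE [RHS]addE.
have := E _ Cphi; rewrite nuI nu'I /Rintegral.
have fi (m : {finite_measure set (borelRn R n) -> \bar R}) :
    (\int[m]_x (phi x)%:E \is a fin_num)%E.
  exact: ge0_fine_Cc (Ccoo_Cc Cphi).
move: (fi p) (fi q) (fi p') (fi q').
move: (\int[p]_x _)%E (\int[q]_x _)%E (\int[p']_x _)%E (\int[q']_x _)%E.
move=> [a||] [b||] [c||] [e||]//= _ _ _ _ h.
by rewrite -!EFinD; congr EFin; lra.
Qed.

Lemma charge_eq0 nu V : open V ->
  (forall phi, Ccoo V phi -> charge_integral nu setT phi = 0) ->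
  forall B : set (borelRn R n), measurable B -> B `<=` V -> nu B = 0%E.
Proof.
move=> oV E B mB BV.
have [p [q [nuE nuI]]] := charge_integral_decomp nu.
rewrite nuE//; apply/eqP; rewrite sube_eq ?fin_num_measure//.
  rewrite add0e; apply/eqP; apply: (borel_measure_eq rhoP oV) => // phi Cphi _.
  have := E _ Cphi; rewrite nuI /Rintegral.
  move: (ge0_fine_Cc p (Ccoo_Cc Cphi)) (ge0_fine_Cc q (Ccoo_Cc Cphi)).
  move: (\int[p]_x _)%E (\int[q]_x _)%E => [a||] [b||]//= _ _ h.
  by congr EFin; lra.
Qed.

End charges_on_Rn.

(** * The variation of a vector charge *)

Lemma le_fine_subD (R : realType) (a b : \bar R) :
  a \is a fin_num -> b \is a fin_num -> (0 <= a)%E -> (0 <= b)%E ->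
  (`|fine (a - b)|%:E <= a + b)%E.
Proof.
move: a b => [a||] [b||]//= _ _; rewrite !lee_fin => a0 b0.
by rewrite (le_trans (ler_normB _ _))// !ger0_norm.
Qed.

Section vector_variation_theory.
Context {R : realType} {n : nat}.
Variable D : @vector_charge R n.
Implicit Types A B : set (borelRn R n).
Local Open Scope ereal_scope.

Let eD A : \bar R := (enorm (\row_i fine (D i A) : 'rV[R]_n))%:E.

(** The measure mu is the sum of the positive and negative parts of the components
of D. Domination by mu makes the variation finite, and continuous from the left
in the radius on balls. *)
Lemma vector_charge_dominated : exists mu : {finite_measure set (borelRn R n) -> \bar R},
  forall A, measurable A -> eD A <= mu A.
Proof.
pose M (i : 'I_n) := charge_integral_decomp (D i).
have /choice[p /choice[q pq]] := M.
pose zero : {finite_measure set (borelRn R n) -> \bar R} := mzero.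
pose m (k : nat) : {finite_measure set (borelRn R n) -> \bar R} :=
  if insub k is Some i then measure_add (p i) (q i) else zero.
pose mu : {measure set (borelRn R n) -> \bar R} := msum m n.
have muE A : mu A = \sum_(i < n) (p i A + q i A).
  rewrite /mu /= /msum; apply: eq_bigr => i _; rewrite /m valK.
  exact: measure_addE.
have mu_fin : fin_num_fun mu.
  move=> A mA; rewrite muE; apply/sum_fin_numP => i _ _.
  by rewrite fin_numD !fin_num_measure.
pose mu' : {finite_measure set (borelRn R n) -> \bar R} :=
  HB.pack (Measure.sort mu) (Measure_isFinite.Build _ _ _ (Measure.sort mu) mu_fin).
exists mu' => A mA; rewrite [leRHS]muE /eD.
apply: (@le_trans _ _ (\sum_i `|fine (D i A)|%:E)).
  rewrite sumEFin lee_fin (le_trans (enorm_le_sum _))// ler_sum// => i _.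
  by rewrite mxE.
apply: lee_sum => i _; have [-> // _] := pq i.
by apply: le_fine_subD; rewrite ?fin_num_measure.
Qed.

Variable mu : {finite_measure set (borelRn R n) -> \bar R}.
Hypothesis Dmu : forall A, measurable A -> eD A <= mu A.

Let eD_ge0 A : 0 <= eD A. Proof. by rewrite lee_fin enorm_ge0. Qed.

Lemma vector_variation_ge0 A : measurable A -> 0 <= vector_variation D A.
Proof.
move=> mA; apply: le_ereal_sup_tmp.
exists (\sum_(0 <= k <oo) eD (if k == 0%N then A else set0)).
  exists (fun k => if k == 0%N then A else set0) => //; split.
  - by case=> //=.
  - by apply/trivIsetP => -[|i] [|j] //= _ _ _; rewrite ?setI0 ?set0I.
  - by apply/seteqP; split=> [x [[|k] _]//|x Ax]; exists 0%N.
by apply: nneseries_ge0 => *; exact: eD_ge0.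
Qed.

Lemma vector_variation_dominated A : measurable A -> vector_variation D A <= mu A.
Proof.
move=> mA; apply: ge_ereal_sup => _ [P [mP tP PA] <-].
apply: (@le_trans _ _ (\sum_(0 <= k <oo) mu (P k))).
  by apply: lee_nneseries => [k _ _|k _]; [exact: eD_ge0|exact: Dmu].
have := @measure_semi_bigcup _ _ _ mu _ mP tP.
rewrite PA => /(_ mA) ->; exact: lexx.
Qed.

Lemma vector_variation_fin_num A : measurable A ->
  vector_variation D A \is a fin_num.
Proof.
move=> mA; rewrite ge0_fin_numE ?vector_variation_ge0//.
by rewrite (le_lt_trans (vector_variation_dominated mA))// ltey_eq fin_num_measure.
Qed.

Lemma le_vector_variation A B : measurable A -> measurable B -> A `<=` B ->
  vector_variation D A <= vector_variation D B.
Proof.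
move=> mA mB AB; apply: ge_ereal_sup => _ [P [mP tP PA] <-].
pose Q k := if k is k'.+1 then P k' else B `\` A.
apply: le_ereal_sup_tmp; exists (\sum_(0 <= k <oo) eD (Q k)).
  exists Q => //; split.
  - by case=> //=; exact: measurableD.
  - have PA' i : P i `<=` A by rewrite -PA; exact: bigcup_sup.
    apply/trivIsetP => -[|i] [|j] //= _ _ ij.
    + by apply/seteqP; split => // x [[_ Ax] /PA'].
    + by apply/seteqP; split => // x [/PA' Ax [_]].
    + by move/trivIsetP : tP => /(_ i j Logic.I Logic.I); exact.
  - apply/seteqP; split=> [x [[_ []//|k _ Pkx]]|x Bx].
      by apply: AB; rewrite -PA; exists k.
    have [Ax|nAx] := pselect (A x); last by exists 0%N.
    by move: Ax; rewrite -PA => -[k _ Pkx]; exists k.+1.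
have Q0 k : true -> 0 <= eD (Q k) by move=> _; exact: eD_ge0.
rewrite [leRHS](nneseries_recl Q0)//.
rewrite -(@nneseries_addn R (fun k => eD (Q k)) 1%N (fun k => eD_ge0 (Q k))).
rewrite [X in _ <= _ + X](_ : _ = \sum_(0 <= k <oo) eD (P k)); last first.
  by apply: eq_eseriesr => k _; rewrite addn1.
by rewrite leeDr// eD_ge0.
Qed.

(** A partition of A is cut along B: the pieces in B contribute at most the
variation of B, the others at most their mu-measure. This bounds the loss of
variation when a ball is slightly shrunk. *)
Lemma vector_variation_setD A B : measurable A -> measurable B -> B `<=` A ->
  vector_variation D A <= vector_variation D B + mu (A `\` B).
Proof.
move=> mA mB BA; apply: ge_ereal_sup => _ [P [mP tP PA] <-].
have mI k : measurable (P k `&` B) by exact: measurableI.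
have mDk k : measurable (P k `\` B) by exact: measurableD.
apply: (@le_trans _ _ (\sum_(0 <= k <oo) (eD (P k `&` B) + mu (P k `\` B)))).
  apply: lee_nneseries => [k _ _|k _]; first exact: eD_ge0.
  apply: (@le_trans _ _ (eD (P k `&` B) + eD (P k `\` B))); last first.
    by rewrite leeD2l// Dmu.
  rewrite /eD lee_fin; apply: le_trans (ler_enormD _ _).
  rewrite le_eqVlt; apply/orP; left; apply/eqP; congr enorm.
  apply/rowP => i; rewrite !mxE -fineD; last 2 first.
    exact: fin_num_measure.
    exact: fin_num_measure.
  by congr fine; rewrite addeC; apply: chargeDI.
rewrite nneseriesD; [|by move=> *; exact: eD_ge0|by move=> *].
apply: leeD.
  apply: ereal_sup_ubound; exists (fun k => P k `&` B) => //; split => //.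
  - exact: trivIset_setIr.
  - by rewrite -setI_bigcupl PA; exact: setIidr.
have tD : trivIset setT (fun k => P k `\` B).
  by apply/trivIsetP => i j _ _ ij; rewrite !setDE setIACA;
    move/trivIsetP : tP => /(_ i j Logic.I Logic.I ij) ->; rewrite set0I.
have := @measure_semi_bigcup _ _ _ mu _ mDk tD.
rewrite -setD_bigcupl PA => /(_ _) ->; last exact: measurableD.
exact: lexx.
Qed.

End vector_variation_theory.

(** * Measurability of ball functions and of limits at radius 0 *)

Section measurable_quantifiers.
Context d (T : measurableType d).

Lemma measurable_forall (I : countType) (P : I -> T -> Prop) :
  (forall i, measurable [set x | P i x]) -> measurable [set x | forall i, P i x].
Proof.
move=> mP; rewrite (_ : [set x | _] = ~` \bigcup_i ~` [set x | P i x]).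
  apply: measurableC; apply: countable_bigcupT_measurable => [|i].
    exact: countableP.
  exact: measurableC.
apply/seteqP; split=> [x Px [i _]|x nPx i]; first by apply; exact: Px.
by apply: contrapT => nPi; apply: nPx; exists i.
Qed.

Lemma measurable_exists (I : countType) (P : I -> T -> Prop) :
  (forall i, measurable [set x | P i x]) -> measurable [set x | exists i, P i x].
Proof.
move=> mP; rewrite (_ : [set x | _] = \bigcup_i [set x | P i x]).
  by apply: countable_bigcupT_measurable => [|i //]; exact: countableP.
by apply/seteqP; split=> [x [i Px]|x [i _ Px]]; exists i.
Qed.

Lemma measurable_if (b : bool) (P : T -> Prop) :
  measurable [set x | P x] -> measurable [set x | b -> P x].
Proof.
case: b => mP; last by rewrite (_ : [set x | _] = setT)//; apply/seteqP; split.
rewrite (_ : [set x | _] = [set x | P x])//.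
by apply/seteqP; split=> x /= Px; [exact: Px|move=> _; exact: Px].
Qed.

Lemma measurable_le_cst (R : realType) (f : T -> R) (c : R) :
  measurable_fun setT f -> measurable [set x | f x <= c].
Proof.
move=> mf; have := mf measurableT _ (measurable_itv `]-oo, c]).
by rewrite setTI; congr measurable; apply/seteqP; split=> x /=; rewrite in_itv.
Qed.

Lemma measurable_gt_cst (R : realType) (f : T -> R) (c : R) :
  measurable_fun setT f -> measurable [set x | c < f x].
Proof.
move=> mf; have := mf measurableT _ (measurable_itv `]c, +oo[).
by rewrite setTI; congr measurable; apply/seteqP; split=> x /=; rewrite in_itv/= andbT.
Qed.

End measurable_quantifiers.

Lemma measurable_invr (R : realType) : measurable_fun setT (GRing.inv : R -> R).
Proof.
rewrite (_ : setT = [set~ 0] `|` [set 0]); last first.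
  by apply/esym; rewrite setUC; exact: setUv.
apply/measurable_funU.
- by apply: measurableC; exact: measurable_set1.
- exact: measurable_set1.
split; last exact: measurable_fun_set1.
apply: open_continuous_measurable_fun.
  by apply: closed_openC; exact: (@closed_eq R).
by move=> x; rewrite inE => /eqP x0; exact: inv_continuous.
Qed.

Section ball_functions.
Context {R : realType} {n : nat}.
Variables (W : set (borelRn R n) -> \bar R)
  (mu : {finite_measure set (borelRn R n) -> \bar R}).
Hypothesis W_fin : forall A, open (A : set 'rV[R]_n) -> W A \is a fin_num.
Hypothesis le_W : forall A B, open (A : set 'rV[R]_n) -> open (B : set 'rV[R]_n) ->
  A `<=` B -> (W A <= W B)%E.
Hypothesis W_setD : forall A B, open (A : set 'rV[R]_n) -> open (B : set 'rV[R]_n) ->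
  B `<=` A -> (W A <= W B + mu (A `\` B))%E.

Let w (x : borelRn R n) (r : R) : R := fine (W (eball (x : 'rV_n) r)).

Let W_w x r : W (eball x r) = (w x r)%:E.
Proof. by rewrite fineK// W_fin//; exact: open_eball. Qed.

Lemma ball_function_le x y r r' : eball (x : 'rV[R]_n) r `<=` eball y r' ->
  w x r <= w y r'.
Proof. by move=> B; rewrite -lee_fin -!W_w le_W//; exact: open_eball. Qed.

(** The shells between the open balls of radii r - 1/(k+1) and r decrease to the
empty set, hence their mu-measure tends to 0. *)
Lemma ball_function_left x r e : 0 < e ->
  exists2 d, 0 < d & forall r', r - d < r' -> r' <= r -> `|w x r' - w x r| <= e.
Proof.
move=> e0; pose B k : set (borelRn R n) := eball (x : 'rV_n) (r - k.+1%:R^-1).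
pose F k : set (borelRn R n) := eball (x : 'rV_n) r `\` B k.
have k0 k : 0 < k.+1%:R^-1 :> R by rewrite invr_gt0.
have BE k : B k `<=` eball (x : 'rV_n) r.
  by apply: le_eball; rewrite lerBlDr lerDl ltW.
have mF k : measurable (F k) by apply: measurableD; exact: measurable_eball.
have F0 : \bigcap_k F k = set0.
  apply/seteqP; split => // y Fy.
  have [xy _] := Fy 0%N Logic.I; move: xy; rewrite /eball/= -subr_gt0 => xy.
  have [k _ /(_ k (leqnn k)) /= kr] := near_infty_natSinv_lt (PosNum xy).
  have [_] := Fy k Logic.I; apply; rewrite /B /eball/= ltrBrDr -ltrBrDl.
  exact: kr.
have cvgF : mu (F k) @[k --> \oo] --> 0%E.
  rewrite -(measure0 mu) -F0; apply: nonincreasing_cvg_mu => //.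
  - by rewrite ltey_eq fin_num_measure.
  - by rewrite F0.
  - move=> i j ij; apply/subsetPset; apply: setDS; apply: le_eball.
    by rewrite lerB// lef_pV2 ?posrE// ler_nat.
have [k Fk] : exists k, (mu (F k) < e%:E)%E.
  move: cvgF => /fine_cvgP[fF /cvgrPdist_lt /(_ _ e0) H].
  near \oo => k; exists k; rewrite -(fineK (fin_num_measure mu _ (mF k))) lte_fin.
  apply: le_lt_trans (ler_norm _) _.
  by rewrite -normrN -[- _]add0r; near: k; exact: H.
exists k.+1%:R^-1 => // r' rr' r'r.
have BB : B k `<=` eball (x : 'rV_n) r' by apply: le_eball; exact: ltW.
have le1 : w x r' <= w x r by apply: ball_function_le; exact: le_eball.
rewrite distrC ger0_norm ?subr_ge0// lerBlDr addrC -lee_fin EFinD -!W_w.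
apply: (@le_trans _ _ (W (B k) + mu (F k))%E).
  by apply: W_setD => //; exact: open_eball.
by apply: leeD; [apply: le_W => //; exact: open_eball|exact: ltW].
Unshelve. all: by end_near. Qed.

(** The function is lower semicontinuous: for y close to x, the r-ball around y
contains a slightly smaller ball around x. *)
Lemma measurable_ball_function r : measurable_fun setT (w ^~ r).
Proof.
apply: (measurability _ (RGenOInfty.measurableE R)).
move=> _ [_ [c ->] <-]; rewrite setTI; apply: open_measurable_Rn.
rewrite openE => x /=; rewrite in_itv/= andbT -subr_gt0 => cx.
have e0 : 0 < (w x r - c) / 2 by rewrite divr_gt0.
have [d d0 Hd] := ball_function_left x r e0.
have d20 : 0 < d / 2 by rewrite divr_gt0.
apply/nbhs_eballP; exists (d / 2) => // y xy /=; rewrite in_itv/= andbT.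
have : w x (r - d / 2) <= w y r.
  apply: ball_function_le; apply: eball_triangle.
  by have := xy; rewrite /eball/=; move: (enorm _) => u; lra.
apply: lt_le_trans.
have := Hd (r - d / 2); rewrite ltrD2l ltrN2 lerBlDr lerDl (ltW d20).
rewrite gtr_pMr// invf_lt1// ltr1n => /(_ isT isT).
rewrite ler_norml => /andP[+ _]; move: cx.
by move: (w x r) (w x _) => a b; lra.
Qed.

End ball_functions.

Section right_limit_at_zero.
Context {R : realType}.

(** By left continuity, a right limit at 0 can be tested on rational radii. *)
Lemma cvg_right0_ratP (g : R -> R) :
  (forall r, 0 < r -> g r' @[r' --> r^'-] --> g r) ->
  (exists l : R, g r @[r --> 0^'+] --> l) <->
  (forall k : nat, exists N : nat, forall q : rat * rat,
    (0 < q.1 < N.+1%:R^-1) && (0 < q.2 < N.+1%:R^-1) ->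
    `|g (ratr q.1) - g (ratr q.2)| <= k.+1%:R^-1).
Proof.
move=> gl.
have ratN (q : rat) N : (0 < q < N.+1%:R^-1) = (0 < (ratr q : R) < N.+1%:R^-1).
  have -> : N.+1%:R^-1 = ratr N.+1%:R^-1 :> R by rewrite fmorphV/= ratr_nat.
  by rewrite ltr0q ltr_rat.
split=> [[l gl0] k|H].
  have k0 : 0 < k.+1%:R^-1 / 2 :> R by rewrite divr_gt0.
  have /cvgrPdist_lt /(_ _ k0) := gl0.
  move=> -[e /= e0 He].
  have [N _ /(_ N (leqnn N)) /= Ne] := near_infty_natSinv_lt (PosNum e0).
  exists N => -[q1 q2]/=; rewrite !ratN => /andP[/andP[q10 q1N] /andP[q20 q2N]].
  have Hq (q : rat) : 0 < ratr q :> R -> ratr q < N.+1%:R^-1 :> R ->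
      `|l - g (ratr q)| < k.+1%:R^-1 / 2.
    move=> q0 qN; apply: He => //=.
    by rewrite sub0r normrN gtr0_norm// (lt_trans qN).
  rewrite (le_trans (ler_distD l _ _))// [leRHS]splitr lerD//.
    by rewrite distrC ltW// Hq.
  by rewrite ltW// Hq.
apply/cvg_ex/cauchy_cvgP/cauchy_exP => e e0.
have e20 : 0 < e / 2 by rewrite divr_gt0.
have [k _ /(_ k (leqnn k)) /= ke] := near_infty_natSinv_lt (PosNum e20).
have [N HN] := H k.
pose q0 : rat := N.+2%:R^-1.
have q0P : 0 < q0 < N.+1%:R^-1 by rewrite invr_gt0 ltr0n/= ltf_pV2 ?posrE// ltr_nat.
exists (g (ratr q0)).
have N0 : 0 < N.+1%:R^-1 :> R by rewrite invr_gt0.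
near=> r.
have r0 : 0 < r by near: r; exact: nbhs_right_gt.
have rN : r < N.+1%:R^-1 by near: r; exact: nbhs_right_lt.
have /cvgrPdist_lt /(_ _ e20) := gl _ r0.
move=> -[d /= d0 Hd].
have [|q] := @rat_in_itvoo R (Num.max 0 (r - d)) r.
  by rewrite gt_max r0/= gtrBl.
rewrite in_itv/= gt_max => /andP[/andP[q0' rdq] qr].
have gq : `|g r - g (ratr q)| < e / 2.
  by apply: Hd => //=; rewrite ger0_norm ?subr_ge0 ?(ltW qr)// ltrBlDr addrC -ltrBlDr.
rewrite -ball_normE /ball_/= (le_lt_trans (ler_distD (g (ratr q)) _ _))//.
rewrite [ltRHS]splitr ler_ltD//; last by rewrite distrC.
have := HN (q0, q) _; rewrite /= q0P ratN q0' (lt_trans qr rN) => /(_ isT).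
by move=> /le_trans; apply; exact: ltW.
Unshelve. all: by end_near. Qed.

End right_limit_at_zero.

(** * The reduced boundary is a Borel set *)

Section reduced_boundary_measurable.
Context {R : realType} {n : nat}.
Variables (rho : 'rV[R]_n -> R) (rhoP : standard_mollifier rho).

Lemma indicator_gradient_unique E (D D' : @vector_charge R n) :
  is_indicator_gradient E D -> is_indicator_gradient E D' ->
  forall i (B : set (borelRn R n)), measurable B -> D i B = D' i B.
Proof.
move=> gD gD' i B mB; apply: (charge_eq rhoP (V := setT)) => //.
  exact: openT.
move=> phi Cphi; apply: oppr_inj.
by rewrite -(gD phi i Cphi) -(gD' phi i Cphi).
Qed.

Lemma vector_variation_eq (D D' : @vector_charge R n) :
  (forall i (B : set (borelRn R n)), measurable B -> D i B = D' i B) ->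
  vector_variation D = vector_variation D'.
Proof.
move=> DD'; apply/funext => A; congr ereal_sup; apply/seteqP.
have E (P : nat -> set (borelRn R n)) : (forall k, measurable (P k)) ->
    (\sum_(0 <= k <oo) (enorm (\row_i fine (D i (P k))))%:E =
     \sum_(0 <= k <oo) (enorm (\row_i fine (D' i (P k))))%:E)%E.
  move=> mP; apply: eq_eseriesr => k _; congr ((enorm _)%:E).
  by apply/rowP => i; rewrite !mxE DD'.
by split=> _ [P [mP tP PA] <-]; exists P => //; rewrite E.
Qed.

Section fixed_gradient.
Variables (E : set 'rV[R]_n) (D : @vector_charge R n).
Hypothesis gD : is_indicator_gradient E D.

Let v (x : borelRn R n) r : R := fine (vector_variation D (eball (x : 'rV_n) r)).
Let f i (x : borelRn R n) r : R := fine (D i (eball (x : 'rV_n) r)).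
Let g i x r : R := f i x r / v x r.

(** The distributional gradient is unique on Borel sets, so that the gradient
quantified in the definition may be fixed once for all points. *)
Lemma reduced_boundaryE : reduced_boundary E =
  [set x | (forall r : R, 0 < r -> 0 < v x r) /\
     exists2 nu : 'rV[R]_n, enorm nu = 1 &
       forall i, g i x r @[r --> 0^'+] --> nu 0 i].
Proof.
have [mu Dmu] := vector_charge_dominated D.
have vE x r : vector_variation D (eball x r) = (v x r)%:E.
  by rewrite fineK//; apply: vector_variation_fin_num Dmu _ _; exact: measurable_eball.
apply/seteqP; split=> x.
  move=> [D' [gD' pos lim]].
  have DD' := indicator_gradient_unique gD' gD.
  have vv := vector_variation_eq DD'.
  split=> [r r0|]; first by rewrite -lte_fin -vE -vv; exact: pos.
  have [nu nu1 nulim] := lim; exists nu => // i.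
  rewrite (_ : g i x = (fun r => fine (D' i (eball (x : 'rV_n) r)) /
      fine (vector_variation D' (eball (x : 'rV_n) r)))); first exact: nulim.
  apply/funext => r.
  by rewrite /g /f /v vv DD'//; exact: measurable_eball.
move=> [pos lim]; exists D; split => // r r0.
by rewrite vE lte_fin; exact: pos.
Qed.

Let cvg_left (a : R -> R) : (forall r e, 0 < e ->
    exists2 d, 0 < d & forall r', r - d < r' -> r' <= r -> `|a r' - a r| <= e) ->
  forall r, a r' @[r' --> r^'-] --> a r.
Proof.
move=> H r; apply/cvgrPdist_le => e e0; have [d d0 Hd] := H r e e0.
near=> r'; rewrite distrC; apply: Hd.
  by near: r'; apply: nbhs_left_gt; rewrite gtrBl.
by near: r'; exact: nbhs_left_le.
Unshelve. all: by end_near. Qed.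

Lemma variation_ball_regular :
  (forall x r, v x r' @[r' --> r^'-] --> v x r) /\
  (forall r, measurable_fun setT (v ^~ r)).
Proof.
have [mu Dmu] := vector_charge_dominated D.
have Wf (A : set (borelRn R n)) : open (A : set 'rV[R]_n) ->
    vector_variation D A \is a fin_num.
  by move=> oA; apply: vector_variation_fin_num Dmu _ _; exact: open_measurable_Rn.
have Wle (A B : set (borelRn R n)) : open (A : set 'rV[R]_n) ->
    open (B : set 'rV[R]_n) ->
    A `<=` B -> (vector_variation D A <= vector_variation D B)%E.
  by move=> oA oB; apply: le_vector_variation; exact: open_measurable_Rn.
have Wd (A B : set (borelRn R n)) : open (A : set 'rV[R]_n) ->
    open (B : set 'rV[R]_n) -> B `<=` A ->
    (vector_variation D A <= vector_variation D B + mu (A `\` B))%E.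
  by move=> oA oB; apply: vector_variation_setD => //; exact: open_measurable_Rn.
split=> [x r|r]; last exact: (measurable_ball_function Wf Wle Wd).
apply: (@cvg_left (v x)) => {}r e e0.
exact: (ball_function_left Wf Wle Wd).
Qed.

Lemma charge_ball_regular i :
  (forall x r, f i x r' @[r' --> r^'-] --> f i x r) /\
  (forall r, measurable_fun setT (f i ^~ r)).
Proof.
have [p [q [Dpq _]]] := charge_integral_decomp (D i).
have Wf (m : {finite_measure set (borelRn R n) -> \bar R}) (A : set (borelRn R n)) :
    open (A : set 'rV[R]_n) -> m A \is a fin_num.
  by move=> oA; apply: fin_num_measure; exact: open_measurable_Rn.
have Wle (m : {finite_measure set (borelRn R n) -> \bar R})
    (A B : set (borelRn R n)) : open (A : set 'rV[R]_n) ->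
    open (B : set 'rV[R]_n) -> A `<=` B -> (m A <= m B)%E.
  by move=> oA oB AB; apply: le_measure; rewrite ?inE//; exact: open_measurable_Rn.
have Wd (m : {finite_measure set (borelRn R n) -> \bar R})
    (A B : set (borelRn R n)) : open (A : set 'rV[R]_n) ->
    open (B : set 'rV[R]_n) -> B `<=` A -> (m A <= m B + m (A `\` B))%E.
  move=> oA oB BA; have mA := open_measurable_Rn oA; have mB := open_measurable_Rn oB.
  rewrite (measureDI m mA mB) (_ : A `&` B = B) 1?addeC//.
  exact: setIidr.
have fE x r : f i x r = fine (p (eball x r)) - fine (q (eball x r)).
  have mB := measurable_eball x r.
  by rewrite /f Dpq// fineB ?fin_num_measure.
split=> [x r|r].
  rewrite fE (_ : f i x = fun r => fine (p (eball x r)) - fine (q (eball x r))).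
    apply: cvgB.
      apply: (@cvg_left (fun r => fine (p (eball x r)))) => {}r e e0.
      exact: (ball_function_left (Wf p) (Wle p) (Wd p)).
    apply: (@cvg_left (fun r => fine (q (eball x r)))) => {}r e e0.
    exact: (ball_function_left (Wf q) (Wle q) (Wd q)).
  by apply/funext => r'.
rewrite (_ : f i ^~ r = fun x => fine (p (eball x r)) - fine (q (eball x r))).
  apply: measurable_funB.
    exact: (measurable_ball_function (Wf p) (Wle p) (Wd p)).
  exact: (measurable_ball_function (Wf q) (Wle q) (Wd q)).
by apply/funext => x.
Qed.

Let h (j : nat) (x : borelRn R n) : R := \sum_i g i x j.+1%:R^-1 ^+ 2.

(** By left continuity in the radius, the limits of the components exist as soon as
a Cauchy condition holds on rational radii, and the norm of the limit can be
read off along the radii 1/(j+1). Positivity on these radii suffices because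
the variation is monotone. *)
Lemma reduced_boundary_countable : reduced_boundary E =
  [set x | forall k : nat, 0 < v x k.+1%:R^-1] `&`
  [set x | forall (i : 'I_n) (k : nat), exists N : nat, forall q : rat * rat,
    (0 < q.1 < N.+1%:R^-1) && (0 < q.2 < N.+1%:R^-1) ->
    `|g i x (ratr q.1) - g i x (ratr q.2)| <= k.+1%:R^-1] `&`
  [set x | forall k : nat, exists N : nat, forall j : nat, (N <= j)%N ->
    `|h j x - 1| <= k.+1%:R^-1].
Proof.
have [mu Dmu] := vector_charge_dominated D.
have [vl _] := variation_ball_regular.
have fl i := (charge_ball_regular i).1.
have glc x : (forall r : R, 0 < r -> 0 < v x r) ->
    forall i r, 0 < r -> g i x r' @[r' --> r^'-] --> g i x r.
  move=> v0 i r r0; apply: cvgM; first exact: fl.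
  by apply: cvgV; [rewrite gt_eqF// v0|exact: vl].
have hl x (nu : 'rV[R]_n) : (forall i, g i x r @[r --> 0^'+] --> nu 0 i) ->
    h j x @[j --> \oo] --> enorm nu ^+ 2.
  move=> Hnu; rewrite sqr_enorm /h.
  have addc : continuous (fun p : R * R => p.1 + p.2).
    exact: (@add_continuous R).
  apply: (@cvg_big R 'I_n +%R 0 predT addc nat \oo (index_enum 'I_n)
    (fun i j => g i x j.+1%:R^-1 ^+ 2) (fun i => nu 0 i ^+ 2)) => i _.
  have Hi : g i x j.+1%:R^-1 @[j --> \oo] --> nu 0 i.
    have /cvg_at_rightP := Hnu i; apply; split; first by move=> k; rewrite invr_gt0.
    exact: cvg_harmonic.
  by rewrite expr2; under eq_fun do rewrite expr2; exact: cvgM.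
rewrite reduced_boundaryE; apply/seteqP; split=> x.
  move=> [v0 [nu nu1 Hnu]]; split; first split.
  - by move=> k; apply: v0; rewrite invr_gt0.
  - move=> i; apply/(cvg_right0_ratP (glc x v0 i)).
    by exists (nu 0 i); exact: Hnu.
  - move=> k; have := hl x nu Hnu; rewrite nu1 expr1n.
    have k0 : 0 < k.+1%:R^-1 :> R by rewrite invr_gt0.
    move=> /cvgrPdist_le /(_ _ k0) [N _ HN]; exists N => j Nj.
    by rewrite distrC; exact: HN.
move=> [[vk gc] hc].
have v0 r : 0 < r -> 0 < v x r.
  move=> r0; have [k _ /(_ k (leqnn k)) /= kr] := near_infty_natSinv_lt (PosNum r0).
  apply: lt_le_trans (vk k) _; apply: fine_le.
  - by apply: vector_variation_fin_num Dmu _ _; exact: measurable_eball.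
  - by apply: vector_variation_fin_num Dmu _ _; exact: measurable_eball.
  - apply: le_vector_variation; try exact: measurable_eball.
    by apply: le_eball; exact: ltW.
have /choice[l Hl] (i : 'I_n) : exists l : R, g i x r @[r --> 0^'+] --> l.
  by apply/(cvg_right0_ratP (glc x v0 i)); exact: gc.
split => //; exists (\row_i l i); last by move=> i; rewrite mxE; exact: Hl.
have := hl x (\row_i l i).
have Hl' i : g i x r @[r --> 0^'+] --> (\row_i l i) 0 i by rewrite mxE; exact: Hl.
move=> /(_ Hl') lim.
have lim1 : h j x @[j --> \oo] --> (1 : R).
  apply/cvgrPdist_le => e e0.
  have [k _ /(_ k (leqnn k)) /= ke] := near_infty_natSinv_lt (PosNum e0).
  have [N HN] := hc k; exists N => // j /= Nj.
  by rewrite distrC (le_trans (HN j Nj))// ltW.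
have /eqP : enorm (\row_i l i) ^+ 2 = 1.
  exact: (cvg_unique (@norm_hausdorff R R) lim lim1).
by rewrite -[X in _ == X](expr1n _ 2) eqrXn2 ?enorm_ge0 ?ler01// => /eqP.
Qed.

Lemma measurable_reduced_boundary_gradient :
  measurable (reduced_boundary E : set (borelRn R n)).
Proof.
have [_ mv] := variation_ball_regular.
have mf i := (charge_ball_regular i).2.
have mg i r : measurable_fun setT (g i ^~ r).
  apply: measurable_funM; first exact: mf.
  exact: measurableT_comp (@measurable_invr R) (mv r).
rewrite reduced_boundary_countable; apply: measurableI; first apply: measurableI.
- by apply: measurable_forall => k; exact: measurable_gt_cst.
- apply: measurable_forall => i; apply: measurable_forall => k.
  apply: measurable_exists => N; apply: measurable_forall => q.
  apply: measurable_if; apply: measurable_le_cst.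
  by apply: measurableT_comp => //; apply: measurable_funB; exact: mg.
- apply: measurable_forall => k; apply: measurable_exists => N.
  apply: measurable_forall => j; apply: measurable_if; apply: measurable_le_cst.
  apply: measurableT_comp => //; apply: measurable_funB => //.
  by apply: measurable_sum => i; exact: measurable_funX.
Qed.

End fixed_gradient.

Lemma measurable_reduced_boundary E : finite_perimeter E ->
  measurable (reduced_boundary E : set (borelRn R n)).
Proof. by move=> [_ [D gD]]; exact: measurable_reduced_boundary_gradient gD. Qed.

End reduced_boundary_measurable.

(** * The reduced boundary lies in the topological boundary *)

Section integral_of_partial.
Context {R : realType} {n : nat}.
Local Notation L := (lebesgue_Rn n).
Implicit Types (phi : 'rV[R]_n -> R).

Lemma integrable_indic_eball (M : R) (x : 'rV[R]_n) r :
  L.-integrable setT (fun y : borelRn R n => (M * \1_(eball x r) y)%:E).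
Proof.
have mB := measurable_eball x r.
under eq_fun do rewrite EFinM; apply: integrableZl => //.
apply/integrableP; split.
  by apply/measurable_EFinP; exact: measurable_indic.
rewrite (eq_integral (fun y : borelRn R n => (\1_(eball x r) y)%:E)); last first.
  by move=> y _; rewrite gee0_abs// lee_fin.
by rewrite integral_indic// setIT lebesgue_Rn_eball_lty.
Qed.

Lemma Cc_support_eball V phi : Cc V phi ->
  exists2 r : R, 0 < r & forall x, ~ eball 0 r x -> phi x = 0.
Proof.
move=> [_ [K [cK _ phi0]]]; have [M [_ HM]] := compact_bounded cK.
pose r := n%:R * `|M + 1| + 1.
exists r; first by rewrite ltr_pwDr// mulr_ge0.
move=> x xr; apply: phi0 => Kx; apply: xr; rewrite /eball/= subr0.
rewrite (le_lt_trans (enorm_le_normr _))// /r (@le_lt_trans _ _ (n%:R * `|M + 1|)) ?ltrDl//.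
by rewrite ler_wpM2l// (le_trans (HM (M + 1) _ x Kx)) ?ltrDl// ler_norm.
Qed.

Lemma integrable_Cc_lebesgue V phi : Cc V phi ->
  L.-integrable setT (EFin \o (phi : borelRn R n -> R)).
Proof.
move=> Cphi; have [r r0 phir] := Cc_support_eball Cphi.
have [M HM] := Cc_bounded Cphi.
apply: (le_integrable measurableT _ _ (integrable_indic_eball M 0 r)).
  by apply/measurable_EFinP; exact: measurable_Cc Cphi.
move=> x _ /=; rewrite lee_fin.
have [xr|xr] := pselect (eball 0 r x).
  by rewrite indicE mem_set// mulr1 (le_trans (HM x))// ler_norm.
by rewrite phir// normr0.
Qed.

Lemma Ccoo_partial V phi (i : 'I_n) : Ccoo V phi -> Ccoo V (partial i phi).
Proof.
move=> [sphi [K [cK KV phi0]]]; split.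
  move=> s; have := sphi (rcons s i).
  by rewrite /iter_partial foldr_rcons.
exists K; split => // x Kx.
have cK' : closed K.
  apply: compact_closed => //; exact: (@norm_hausdorff R).
rewrite /partial (near_eq_derive (g := cst 0)) ?derive_cst//.
have /nbhs_eballP[r r0 rK] : nbhs x (~` K).
  by apply: open_nbhs_nbhs; split => //; exact: closed_openC.
by apply/nbhs_eballP; exists r => // y yr; apply: phi0; exact: rK.
Qed.

Lemma integral_translate (a : 'rV[R]_n) (f : borelRn R n -> \bar R) :
  measurable_fun setT f ->
  (\int[L]_x f (x + a)%R = \int[L]_x f x)%E.
Proof.
move=> mf; rewrite [LHS]integralE [RHS]integralE; congr (_ - _)%E.
- rewrite -[RHS](ge0_integral_translate a)//; last exact: measurable_funepos.
  by apply: eq_integral => x _; rewrite !funeposE.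
- rewrite -[RHS](ge0_integral_translate a)//; last exact: measurable_funeneg.
  by apply: eq_integral => x _; rewrite !funenegE.
Qed.

Lemma derivable_line phi (x v : 'rV[R]_n) (s : R) : derivable phi (x + s *: v) v ->
  is_derive s 1 (fun s : R => phi (x + s *: v)) ('D_v phi (x + s *: v)).
Proof.
move=> d; have E : (fun h : R => h^-1 *: (((fun s : R => phi (x + s *: v)) \o shift s)
    (h *: 1) - phi (x + s *: v))) =
    (fun h => h^-1 *: ((phi \o shift (x + s *: v)) (h *: v) - phi (x + s *: v))).
  apply/funext => h /=; congr (_ *: (phi _ - _)).
  have -> : h *: (1 : R) = h by rewrite /GRing.scale/= mulr1.
  by rewrite scalerDl addrCA.
apply: DeriveDef.
  by rewrite /derivable E.
by rewrite /derive E.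
Qed.

Lemma diff_quotient_le phi V (i : 'I_n) (M t : R) x : Ccoo V phi -> 0 < t ->
  (forall y, `|partial i phi y| <= M) ->
  `|t^-1 * (phi (x + t *: delta_mx 0 i) - phi x)| <= M.
Proof.
move=> [sphi _] t0 HM; have [_ dphi] := sphi [::].
have D (s : R) := derivable_line (dphi i (x + s *: delta_mx 0 i)).
have [|c _] := MVT t0 (fun s _ => D s).
  by apply: derivable_within_continuous => s _; exact: (@ex_derive _ _ _ _ _ _ _ (D s)).
rewrite scale0r addr0 subr0 => ->.
by rewrite mulrCA mulVf ?gt_eqF// mulr1; exact: HM.
Qed.

(** By translation invariance the difference quotients have integral 0; they
converge boundedly, on a bounded set, to the partial derivative. *)
Lemma integral_partial phi (i : 'I_n) : Ccoo setT phi ->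
  \int[L]_x partial i phi x = 0.
Proof.
move=> Cphi; have Cpsi := Ccoo_partial i Cphi.
have [r r0 phir] := Cc_support_eball (Ccoo_Cc Cphi).
have [M HM] := Cc_bounded (Ccoo_Cc Cpsi).
pose e : 'rV[R]_n := delta_mx 0 i.
pose t k : R := k.+1%:R^-1.
have t0 k : 0 < t k by rewrite invr_gt0.
have t1 k : t k <= 1 by rewrite invf_le1// ler1n.
have e1 : enorm e <= 1.
  apply: (le_trans (enorm_le_sum _)).
  rewrite (bigD1 i)//= mxE !eqxx normr1 big1 ?addr0// => j ji.
  by rewrite mxE (negbTE ji) andbF normr0.
pose f k (x : borelRn R n) : R := (t k)^-1 * (phi (x + t k *: e) - phi x).
have mphi := measurable_Cc (Ccoo_Cc Cphi).
have mf k : measurable_fun setT (fun x : borelRn R n => (f k x)%:E).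
  apply/measurable_EFinP; apply: measurable_funM => //; apply: measurable_funB => //.
  exact: (measurableT_comp mphi (measurable_translate (t k *: e))).
have cvgf x : (f k x)%:E @[k --> \oo] --> (partial i phi x)%:E.
  apply: cvg_EFin; first by apply: nearW.
  have [_ dphi] := Cphi.1 [::].
  have /cvg_dnbhs_at_right/cvg_at_rightP /(_ t) := dphi i x.
  have -> : (fun k => (t k)^-1 *: ((phi \o shift x) (t k *: delta_mx 0 i) - phi x)) =
     (fun k => f k x).
    by apply/funext => k; rewrite /f/= [_ *: _ + x]addrC.
  by apply; split => //; exact: cvg_harmonic.
have bound k x : `|f k x| <= M * \1_(eball 0 (r + 1)) x.
  have [xr|xr] := pselect (eball 0 (r + 1) x).
    by rewrite indicE mem_set// mulr1; exact: diff_quotient_le Cphi (t0 k) HM.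
  have x1 : ~ eball 0 r x.
    by move=> xr'; apply: xr; apply: le_eball xr'; rewrite lerDl.
  have x2 : ~ eball 0 r (x + t k *: e).
    rewrite /eball/= subr0 => xr'; apply: xr; rewrite /eball/= subr0.
    rewrite (_ : x = (x + t k *: e) - t k *: e); last by rewrite addrK.
    rewrite (le_lt_trans (ler_enormD _ _))// ltr_leD//.
    rewrite enormN enormZ gtr0_norm//; apply: mulr_ile1 => //; first exact: ltW.
    exact: enorm_ge0.
  by rewrite /f !phir// subrr mulr0 normr0 indicE memNset// mulr0.
have intf k : (\int[L]_x (f k x)%:E = 0)%E.
  have iphi := integrable_Cc_lebesgue (Ccoo_Cc Cphi).
  have mphi' : measurable_fun setT (fun x : borelRn R n => (phi x)%:E).
    exact/measurable_EFinP.
  have iphit : L.-integrable setT (fun x : borelRn R n => (phi (x + t k *: e))%:E).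
    apply/integrableP; split.
      apply/measurable_EFinP.
      exact: (measurableT_comp mphi (measurable_translate (t k *: e))).
    have := (integrableP _ _ _ iphi).2.
    rewrite -[X in (X < _)%E -> _](ge0_integral_translate (t k *: e))//.
    exact: measurableT_comp.
  rewrite (eq_integral (fun x : borelRn R n => (t k)^-1%:E * ((phi (x + t k *: e))%:E - (phi x)%:E))%E)//.
  rewrite integralZl//; last exact: integrableB.
  rewrite integralB//= (integral_translate _ mphi') subee ?mule0//.
  exact: integrable_fin_num.
rewrite /Rintegral.
have H : (\int[L]_x (f k x)%:E)%E @[k --> \oo] --> (\int[L]_x (partial i phi x)%:E)%E.
  apply: (@dominated_cvg _ _ _ L setT measurableT (fun k x => (f k x)%:E)
    (fun x : borelRn R n => (partial i phi x)%:E)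
    (fun x : borelRn R n => (M * \1_(eball 0 (r + 1)) x)%:E)) => //.
    exact: integrable_indic_eball.
  by move=> k x _; rewrite /= lee_fin; exact: bound.
have H0 : (\int[L]_x (f k x)%:E)%E @[k --> \oo] --> (0 : \bar R)%E.
  by under eq_fun do rewrite intf; exact: cvg_cst.
by rewrite -(cvg_lim _ H)// (cvg_lim _ H0).
Qed.

End integral_of_partial.

Section reduced_boundary_in_boundary.
Context {R : realType} {n : nat}.
Variables (rho : 'rV[R]_n -> R) (rhoP : standard_mollifier rho).

Lemma Ccoo_out V (phi : 'rV[R]_n -> R) x : Ccoo V phi -> ~ V x -> phi x = 0.
Proof. by move=> [_ [K [_ KV phi0]]] Vx; apply: phi0 => /KV. Qed.

(** The indicator function of E is constant on V, and a partial derivative of a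
function with compact support in V has integral 0. *)
Lemma gradient_locally_constant E (D : @vector_charge R n) V :
  is_indicator_gradient E D -> open V -> (V `<=` E \/ V `&` E = set0) ->
  vector_variation D V = 0%E.
Proof.
move=> gD oV VE.
have int0 phi i : Ccoo V phi -> \int[lebesgue_Rn n]_(x in E) partial i phi x = 0.
  move=> Cphi; have Cpsi := Ccoo_partial i Cphi.
  case: VE => VE.
    rewrite Rintegral_mkcond (_ : _ \_ E = partial i phi).
      apply: integral_partial; case: Cphi => sphi [K [cK _ phi0]].
      by split => //; exists K.
    apply/funext => x; rewrite patchE; case: ifPn => // /negP.
    by rewrite inE => Ex; rewrite (Ccoo_out Cpsi)// => /VE.
  rewrite /Rintegral integral0_eq// => x Ex.
  rewrite (Ccoo_out Cpsi)// => Vx.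
  by have : (V `&` E) x by []; rewrite VE.
have D0 i (B : set (borelRn R n)) : measurable B -> B `<=` V -> D i B = 0%E.
  apply: (charge_eq0 rhoP oV) => phi Cphi; apply: oppr_inj.
  rewrite oppr0 -gD ?int0//.
  by case: Cphi => sphi [K [cK _ phi0]]; split => //; exists K.
have [mu Dmu] := vector_charge_dominated D.
apply/eqP; rewrite eq_le; apply/andP; split; last first.
  by apply: vector_variation_ge0; exact: open_measurable_Rn.
apply: ge_ereal_sup => _ [P [mP tP PV] <-].
rewrite eseries0// => k _ _.
rewrite (_ : \row_i _ = 0) ?enorm0//.
apply/rowP => i; rewrite !mxE D0// -PV; exact: bigcup_sup.
Qed.

(** A point off the boundary has a neighborhood where E is full or empty, on which
the variation vanishes, whereas it is positive near a point of the reduced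
boundary. *)
Lemma reduced_boundary_sub (E : set 'rV[R]_n) : reduced_boundary E `<=` boundary E.
Proof.
move=> x [D [gD pos _]].
suff noV V : open V -> V x -> ~ (V `<=` E \/ V `&` E = set0).
  split.
    move=> V; rewrite nbhsE => -[W [oW Wx] WV].
    apply: contrapT => /set0P/negP; rewrite negbK => /eqP EV.
    apply: (noV _ oW Wx); right; apply/seteqP; split => // y [Wy Ey].
    by rewrite -EV; split => //; exact: WV.
  rewrite /interior nbhsE => -[W [oW Wx] WE].
  by apply: (noV _ oW Wx); left.
move=> oV Vx H.
have /nbhs_eballP[r r0 rV] : nbhs x V by exact: open_nbhs_nbhs.
have := pos r r0; rewrite (gradient_locally_constant gD (@open_eball _ _ x r)) ?ltxx//.
case: H => H; [left|right]; first exact: subset_trans H.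
by apply/seteqP; split => // y [/rV Vy Ey]; rewrite -H.
Qed.

End reduced_boundary_in_boundary.

(** * Setwise limits of dominated measures *)

Section ultrafilter_limit.
Context {R : realType} (G : set_system nat).
Hypothesis UG : UltraFilter G.

Lemma ultra_cvg_segment (a : nat -> R) (M : R) :
  (forall k, 0 <= a k <= M) -> exists l : R, a k @[k --> G] --> l.
Proof.
move=> aM; have PG : ProperFilter G by exact: ultra_proper.
have : (a k @[k --> G]) `[0, M]%classic.
  by rewrite /= ; apply: filterE => k; rewrite /= in_itv/=.
move=> /(@segment_compact R 0 M _ _)[l [_ cl]]; exists l => C Cl.
have [//|nC] := in_ultra_setVsetC (a @^-1` C) UG.
by have [x [nCx Cx]] := cl (~` C) C nC Cl.
Qed.

End ultrafilter_limit.

Section dominated_weak_limit.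
Context d {T : measurableType d} {R : realType}.
Variable tau : {finite_measure set T -> \bar R}.
Variable lam : nat -> {measure set T -> \bar R}.
Hypothesis lam_le : forall k A, measurable A -> (lam k A <= tau A)%E.

Let lam_fin k A : measurable A -> lam k A \is a fin_num.
Proof.
move=> mA; rewrite ge0_fin_numE// (le_lt_trans (lam_le k mA))//.
by rewrite ltey_eq fin_num_measure.
Qed.

Let a k A : R := fine (lam k A).

Let a_bound k A : measurable A -> 0 <= a k A <= fine (tau A).
Proof.
move=> mA; rewrite fine_ge0//= fine_le ?lam_le ?fin_num_measure//.
exact: lam_fin.
Qed.

Variable G : set_system nat.
Hypothesis UG : UltraFilter G.

Let PG : ProperFilter G. Proof. exact: ultra_proper. Qed.

Let l (A : set T) : R := if `[< measurable A >] then lim (a k A @[k --> G]) else 0.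

Let cvg_l A : measurable A -> a k A @[k --> G] --> l A.
Proof.
move=> mA; rewrite /l asboolT//.
have [x ax] := ultra_cvg_segment UG (fun k => a_bound k mA).
by apply: cvgP ax.
Qed.

Let ultralimit (A : set T) : \bar R := (l A)%:E.

Let l_ge0 A : 0 <= l A.
Proof.
rewrite /l; case: asboolP => // mA; apply: limr_ge; first by apply: cvgP; exact: cvg_l.
by apply: nearW => k; have /andP[] := a_bound k mA.
Qed.

Let l_le A : measurable A -> l A <= fine (tau A).
Proof.
move=> mA; apply: (cvgr_to_le (cvg_l mA)); apply: nearW => k.
by have /andP[] := a_bound k mA.
Qed.

Let lU A B : measurable A -> measurable B -> [disjoint A & B] ->
  l (A `|` B) = l A + l B.
Proof.
move=> mA mB AB; have mAB := measurableU _ _ mA mB.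
apply: (cvg_unique (@norm_hausdorff R R) (cvg_l mAB)).
rewrite (_ : a ^~ (A `|` B) = (fun k => a k A + a k B)).
  by apply: cvgD; exact: cvg_l.
apply/funext => k; rewrite /a measureU// ?fineD ?lam_fin//.
exact/eqP.
Qed.

Let l0 : l set0 = 0.
Proof.
have m0 := @measurable0 _ T.
by apply/eqP; rewrite eq_le l_ge0 andbT (le_trans (l_le m0))// measure0.
Qed.

Let ultralimit0 : ultralimit set0 = 0%E.
Proof. by rewrite /ultralimit l0. Qed.

Let ultralimit_ge0 A : (0 <= ultralimit A)%E.
Proof. by rewrite lee_fin. Qed.

Let ultralimit_sigma_additive : semi_sigma_additive ultralimit.
Proof.
move=> F mF tF mUF.
have mS N : measurable (\big[setU/set0]_(i < N) F i) by exact: bigsetU_measurable.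
pose D N := \bigcup_i F i `\` \big[setU/set0]_(i < N) F i.
have mD N : measurable (D N) by exact: measurableD.
have lS N : \sum_(0 <= i < N) ultralimit (F i) = (l (\big[setU/set0]_(i < N) F i))%:E.
  rewrite big_mkord sumEFin; congr EFin.
  elim: N => [|N IH]; first by rewrite !big_ord0.
  rewrite !big_ord_recr/= IH lU//; first exact: mS.
  rewrite disj_set2E; apply/eqP; rewrite big_distrl/= big1// => i _.
  by move/trivIsetP : tF => /(_ i N Logic.I Logic.I); apply; rewrite neq_ltn ltn_ord.
have split N : l (\bigcup_i F i) = l (\big[setU/set0]_(i < N) F i) + l (D N).
  rewrite -lU//; last by rewrite disj_set2E setDIK.
  rewrite setDUK// -bigcup_mkord; apply: bigcup_sub => i _; exact: bigcup_sup.
have D0 : fine (tau (D N)) @[N --> \oo] --> (0 : R).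
  have capD : \bigcap_N D N = set0.
    apply/seteqP; split => // x Dx; have [[i _ Fix] _] := Dx 0%N Logic.I.
    have [_] := Dx i.+1 Logic.I; apply.
    by rewrite big_ord_recr/=; right.
  have : tau (D N) @[N --> \oo] --> tau (\bigcap_N D N).
    apply: nonincreasing_cvg_mu => //.
    - by rewrite ltey_eq fin_num_measure.
    - exact: bigcapT_measurable.
    - move=> i j ij; apply/subsetPset; apply: setDS.
      rewrite -!bigcup_mkord; apply: bigcup_subset => k /=.
      by move=> /leq_trans; apply.
  by rewrite capD measure0; exact: fine_cvg.
under eq_fun do rewrite lS.
apply: cvg_EFin; first exact: nearW.
rewrite /comp/=.
have -> : (fun N => l (\big[setU/set0]_(i < N) F i)) =
    (fun N => l (\bigcup_i F i) - l (D N)).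
  by apply/funext => N; rewrite (split N) addrK.
rewrite -[X in _ --> X]subr0; apply: cvgB; first exact: cvg_cst.
apply: squeeze_cvgr (cvg_cst 0) D0; apply: nearW => N.
by rewrite l_ge0 l_le.
Qed.

(** The limit along an ultrafilter exists on every measurable set at once; it
is finitely additive, and countably additive because it stays below the finite
measure tau. *)
Lemma ultralimit_measure : exists mU : {finite_measure set T -> \bar R},
  (forall A, measurable A -> (mU A <= tau A)%E) /\
  (forall A, measurable A -> fine (lam k A) @[k --> G] --> fine (mU A)).
Proof.
pose mU : {measure set T -> \bar R} := HB.pack ultralimit
  (isMeasure.Build _ _ _ ultralimit ultralimit0 ultralimit_ge0
    ultralimit_sigma_additive).
have mU_fin : fin_num_fun mU by [].
pose mU' : {finite_measure set T -> \bar R} :=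
  HB.pack (Measure.sort mU) (Measure_isFinite.Build _ _ _ (Measure.sort mU) mU_fin).
exists mU'; split=> A mA; last exact: cvg_l.
by rewrite -[leRHS]fineK ?fin_num_measure// lee_fin l_le.
Qed.

End dominated_weak_limit.

(** * Weak convergence of dominated measures *)

Section fine_partition.
Context {R : realType} {n : nat}.

Definition rational_point (i : nat) : 'rV[R]_n :=
  if @unpickle 'rV[rat]_n i is Some v then map_mx ratr v else 0.

Lemma rational_point_dense (x : 'rV[R]_n) (r : R) : 0 < r ->
  exists i, eball (rational_point i) r x.
Proof.
move=> r0; have r'0 : 0 < r / n.+1%:R by rewrite divr_gt0.
have /choice[q qE] (j : 'I_n) : exists q : rat, ball (x 0 j) (r / n.+1%:R) (ratr q).
  have [|q] := @rat_in_itvoo R (x 0 j - r / n.+1%:R) (x 0 j + r / n.+1%:R).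
    by rewrite ltrD2l gtrN.
  by move=> qI; exists q; rewrite ball_itv.
exists (pickle (\row_j q j)); apply: eball_sym; apply: ball_sub_eball => //.
rewrite /rational_point pickleK; split=> // i j.
by rewrite ord1 !mxE; exact: qE.
Qed.

(** The cells of all scales are countably many, so that a single sequence of
measures can be made to converge on each of them. *)
Definition cell (m i : nat) : set (borelRn R n) :=
  seqDU (fun i => eball (rational_point i) m.+1%:R^-1) i.

Lemma measurable_cell m i : measurable (cell m i).
Proof.
apply: measurableD; first exact: measurable_eball.
by apply: bigsetU_measurable => j _; exact: measurable_eball.
Qed.

Lemma cell_eball m i x : cell m i x -> eball (rational_point i) m.+1%:R^-1 x.
Proof. by case. Qed.

Lemma trivIset_cell m : trivIset setT (cell m).
Proof. exact: trivIset_seqDU. Qed.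

Lemma bigcup_cell m : \bigcup_i cell m i = setT.
Proof.
rewrite -seqDU_bigcup_eq; apply/seteqP; split => // x _.
have [i xi] := @rational_point_dense x m.+1%:R^-1 (ltac:(by rewrite invr_gt0)).
by exists i.
Qed.

Definition cell_tail m I : set (borelRn R n) := ~` \bigcup_(i < I) cell m i.

Lemma measurable_cell_tail m I : measurable (cell_tail m I).
Proof.
by apply: measurableC; apply: bigcup_measurable => i _; exact: measurable_cell.
Qed.

Lemma cell_tail_cvg0 m (tau : {finite_measure set (borelRn R n) -> \bar R}) :
  fine (tau (cell_tail m I)) @[I --> \oo] --> (0 : R).
Proof.
have cap : \bigcap_I cell_tail m I = set0.
  apply/seteqP; split => // x xt.
  have [i _ xi] : (\bigcup_i cell m i) x by rewrite bigcup_cell.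
  by apply: (xt i.+1 Logic.I); exists i => /=.
have : tau (cell_tail m I) @[I --> \oo] --> tau (\bigcap_I cell_tail m I).
  apply: nonincreasing_cvg_mu => //.
  - by rewrite ltey_eq fin_num_measure//; exact: measurable_cell_tail.
  - by move=> I; exact: measurable_cell_tail.
  - by rewrite cap.
  - move=> i j ij; apply/subsetPset; apply: subsetC; apply: bigcup_subset => k /=.
    by move=> /leq_trans; apply.
by rewrite cap measure0; exact: fine_cvg.
Qed.

Variable tau : {finite_measure set (borelRn R n) -> \bar R}.

(** The value of a continuous function at the centers of the cells gives a
Riemann sum; its error is uniform over the measures dominated by tau. *)
Lemma riemann_sum_error V (phi : 'rV[R]_n -> R) (eta M : R) m I
    (mu : {measure set (borelRn R n) -> \bar R}) :
  Cc V phi -> (forall x, `|phi x| <= M) -> 0 <= eta ->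
  (forall x y, enorm (y - x) < m.+1%:R^-1 -> `|phi y - phi x| <= eta) ->
  (forall A, measurable A -> (mu A <= tau A)%E) ->
  `|\int[mu]_x phi x -
     \sum_(i < I) phi (rational_point i) * fine (mu (cell m i))| <=
  eta * fine (tau setT) + M * fine (tau (cell_tail m I)).
Proof.
move=> Cphi HM eta0 Hphi mutau.
have mufin A : measurable A -> mu A \is a fin_num.
  move=> mA; rewrite ge0_fin_numE// (le_lt_trans (mutau A mA))//.
  by rewrite ltey_eq fin_num_measure.
have muoo : (mu setT < +oo)%E by rewrite ltey_eq mufin.
have iphi := integrable_Cc muoo Cphi.
have M0 : 0 <= M by apply: le_trans (HM 0).
have mt := measurable_cell_tail m I.
have iind A (c : R) : measurable A ->
    mu.-integrable setT (fun x : borelRn R n => (c * \1_A x)%:E).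
  move=> mA; under eq_fun do rewrite EFinM; apply: integrableZl => //.
  apply/integrableP; split; first by apply/measurable_EFinP; exact: measurable_indic.
  rewrite (eq_integral (fun y : borelRn R n => (\1_A y)%:E)); last first.
    by move=> y _; rewrite gee0_abs// lee_fin.
  by rewrite integral_indic// setIT ltey_eq mufin.
pose psi (x : borelRn R n) : R := \sum_(i < I) phi (rational_point i) * \1_(cell m i) x.
have ipsi : mu.-integrable setT (EFin \o psi).
  rewrite (_ : EFin \o psi = (fun x => \sum_(i < I)
      (phi (rational_point i) * \1_(cell m i) x)%:E)%E); last first.
    by apply/funext => x; rewrite /= /psi sumEFin.
  by apply: integrable_sum => // i _; apply: iind; exact: measurable_cell.
have intind A (c : R) : measurable A -> \int[mu]_x (c * \1_A x) = c * fine (mu A).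
  move=> mA; rewrite /Rintegral; under eq_integral do rewrite EFinM.
  rewrite integralZl//; last by have := iind A 1 mA; under eq_fun do rewrite mul1r.
  by rewrite integral_indic// setIT fineM// mufin.
have psiE : \int[mu]_x psi x = \sum_(i < I) phi (rational_point i) * fine (mu (cell m i)).
  rewrite /Rintegral (eq_integral (fun x => \sum_(i < I)
      (phi (rational_point i) * \1_(cell m i) x)%:E)%E); last first.
    by move=> x _; rewrite /psi sumEFin.
  rewrite integral_sum//; last by move=> i; apply: iind; exact: measurable_cell.
  rewrite -sum_fine; last first.
    by move=> i _; apply: integrable_fin_num => //; apply: iind; exact: measurable_cell.
  apply: eq_bigr => i _; rewrite -intind//; exact: measurable_cell.
have psi_cell x (i : 'I_I) : cell m i x -> psi x = phi (rational_point i).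
  move=> xi; rewrite /psi (bigD1 i)//= indicE mem_set// mulr1 big1 ?addr0// => j ji.
  rewrite indicE memNset ?mulr0// => xj.
  have /val_inj ij : (j : nat) = i.
    by apply: (@trivIset_cell m j i) => //; exists x.
  by move: ji; rewrite ij eqxx.
have psi_tail x : cell_tail m I x -> psi x = 0.
  move=> xt; rewrite /psi big1// => i _; rewrite indicE memNset ?mulr0// => xi.
  by apply: xt; exists (i : nat) => /=.
have err x : `|phi x - psi x| <= eta + M * \1_(cell_tail m I) x.
  have [xt|xt] := pselect (cell_tail m I x).
    by rewrite psi_tail// subr0 indicE mem_set// mulr1 (le_trans (HM x))// lerDr.
  rewrite indicE memNset// mulr0 addr0.
  have [i /= iI xi] : (\bigcup_(i < I) cell m i) x by exact: contrapT.
  rewrite (psi_cell _ (Ordinal iI))//=; apply: Hphi.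
  exact: cell_eball xi.
rewrite -psiE -RintegralB//.
apply: (le_trans (le_normr_Rintegral _ _)) => //.
  by have := integrableB measurableT iphi ipsi.
have ieta := iind setT eta (@measurableT _ _).
have itail := iind _ M mt.
apply: (@le_trans _ _ (\int[mu]_x (eta * \1_[set: borelRn R n] x + M * \1_(cell_tail m I) x))).
  apply: le_Rintegral => //.
  - have := integrable_abse (integrableB measurableT iphi ipsi).
    by [].
  - by have := integrableD measurableT ieta itail.
  - by move=> x _; rewrite (le_trans (err x))// indicT mulr1.
rewrite RintegralD// !intind// lerD//.
  by rewrite ler_wpM2l// fine_le ?mutau ?mufin ?fin_num_measure.
by rewrite ler_wpM2l// fine_le ?mutau ?mufin ?fin_num_measure.
Qed.

End fine_partition.

Section weak_subsequence.
Context {R : realType} {n : nat}.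
Variable tau : {finite_measure set (borelRn R n) -> \bar R}.
Variable lam : nat -> {measure set (borelRn R n) -> \bar R}.
Hypothesis lam_le : forall k A, measurable A -> (lam k A <= tau A)%E.

Definition indexed_cell (j : nat) : set (borelRn R n) :=
  if @unpickle (nat * nat)%type j is Some p then cell p.1 p.2 else set0.

Lemma measurable_indexed_cell j : measurable (indexed_cell j).
Proof. by rewrite /indexed_cell; case: unpickle => // p; exact: measurable_cell. Qed.

(** Each finite set of constraints that hold in the limit along the ultrafilter is
satisfied by arbitrarily late indices. *)
Lemma ultralimit_subsequence (G : set_system nat) (UG : UltraFilter G)
    (mU : {finite_measure set (borelRn R n) -> \bar R}) :
  nbhs \oo `<=` G ->
  (forall A, measurable A -> fine (lam k A) @[k --> G] --> fine (mU A)) ->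
  exists s : nat -> nat, [/\ forall k, (s k <= s k.+1)%N, forall k, (k <= s k)%N &
    forall m i, fine (lam (s k) (cell m i)) @[k --> \oo] -->
      fine (mU (cell m i))].
Proof.
move=> ooG mUcvg; have PG : ProperFilter G by exact: ultra_proper.
pose a k j := fine (lam k (indexed_cell j)).
pose l j := fine (mU (indexed_cell j)).
have cvgj j : a k j @[k --> G] --> l j.
  by apply: mUcvg; exact: measurable_indexed_cell.
pose good N k := (N <= k)%N /\ forall j, (j <= N)%N -> `|l j - a k j| < N.+1%:R^-1.
have Ggood N : G (good N).
  apply: filterI; first by apply: ooG; exists N.
  have Hj j : G [set k | `|l j - a k j| < N.+1%:R^-1].
    have N0 : 0 < N.+1%:R^-1 :> R by rewrite invr_gt0.
    by have /cvgrPdist_lt /(_ _ N0) := cvgj j.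
  have H p : G [set k | forall j, (j < p)%N -> `|l j - a k j| < N.+1%:R^-1].
    elim: p => [|p IH]; first by apply: filterE.
    apply: filterS (filterI IH (Hj p)) => k [H1 H2] j.
    by rewrite ltnS leq_eqVlt => /orP[/eqP->//|]; exact: H1.
  exact: H N.+1.
have /choice[f fgood] N : exists k, good N k by exact: filter_ex (Ggood N).
pose s := fix s k := if k is k'.+1 then f (maxn k (s k')) else f 0%N.
have sgood k : exists2 N, (k <= N)%N & good N (s k).
  by case: k => [|k]; [exists 0%N|exists (maxn k.+1 (s k)); first exact: leq_maxl].
exists s; split=> [k|k|m i].
- have [le _] := fgood (maxn k.+1 (s k)).
  by apply: leq_trans le; exact: leq_maxr.
- by have [N kN [Ns _]] := sgood k; exact: leq_trans Ns.
have cE : cell m i = indexed_cell (pickle (m, i)) by rewrite /indexed_cell pickleK.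
rewrite cE; apply/cvgrPdist_lt => e e0.
have [k0 _ /(_ k0 (leqnn k0)) /= ke] := near_infty_natSinv_lt (PosNum e0).
exists (maxn k0 (pickle (m, i))) => // k /=; rewrite geq_max => /andP[k0k jk].
have [N kN [_ HN]] := sgood k.
apply: lt_trans (HN _ (leq_trans jk kN)) _; apply: le_lt_trans ke.
by rewrite lef_pV2 ?posrE// ler_nat ltnS (leq_trans k0k).
Qed.

(** Convergence on the cells is convergence of Riemann sums, and these approximate
the integrals uniformly along the sequence. *)
Lemma weak_subsequence :
  exists (mU : {finite_measure set (borelRn R n) -> \bar R}) (s : nat -> nat),
  [/\ forall A, measurable A -> (mU A <= tau A)%E,
      forall k, (s k <= s k.+1)%N, forall k, (k <= s k)%N &
      forall V (phi : 'rV[R]_n -> R), Cc V phi ->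
        \int[lam (s k)]_x phi x @[k --> \oo] --> \int[mU]_x phi x].
Proof.
have [G [UG ooG]] := @ultraFilterLemma _ (nbhs \oo) _.
have [mU [mU_le mUcvg]] := ultralimit_measure lam_le UG.
have [s [s_nd s_ge scell]] := ultralimit_subsequence UG ooG mUcvg.
exists mU, s; split => // V phi Cphi.
have [M HM] := Cc_bounded Cphi.
apply/cvgrPdist_le => e e0.
have M0 : 0 <= M by apply: le_trans (HM 0).
set t := fine (tau setT).
have t0 : 0 <= t by exact: fine_ge0.
pose eta := e / 8 / (t + 1).
have eta0 : 0 < eta by rewrite !divr_gt0// ltr_wpDl.
have etat : eta * t <= e / 8.
  by rewrite /eta mulrAC ler_pdivrMr ?ltr_wpDl// ler_wpM2l ?divr_ge0 ?(ltW e0)// lerDl.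
have [d d0 Hd] := Cc_unif_continuous Cphi eta0.
have [m _ /(_ m (leqnn m)) /= md] := near_infty_natSinv_lt (PosNum d0).
have e8 : 0 < e / 8 / (M + 1) by rewrite !divr_gt0// ltr_wpDl.
have [I HI] : exists I, M * fine (tau (cell_tail m I)) <= e / 8.
  have /cvgrPdist_lt /(_ _ e8) [I _ HI] := cell_tail_cvg0 m tau.
  exists I; have := HI I (leqnn I); rewrite /= sub0r normrN => H.
  apply: (@le_trans _ _ (M * (e / 8 / (M + 1)))).
    by rewrite ler_wpM2l// (le_trans (ler_norm _))// ltW.
  by rewrite mulrCA ler_piMr ?divr_ge0 ?(ltW e0)// ler_pdivrMr ?ltr_wpDl// mul1r lerDl.
pose S (mu : set (borelRn R n) -> \bar R) :=
  \sum_(i < I) phi (rational_point i) * fine (mu (cell m i)).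
have errS (mu : {measure set (borelRn R n) -> \bar R}) :
    (forall A, measurable A -> (mu A <= tau A)%E) ->
    `|\int[mu]_x phi x - S mu| <= e / 4.
  move=> mule; have := @riemann_sum_error R n tau V phi eta M m I mu Cphi HM (ltW eta0) _ mule.
  have Hm : forall x y, enorm (y - x) < m.+1%:R^-1 -> `|phi y - phi x| <= eta.
    by move=> x y xy; apply: Hd; exact: lt_trans md.
  move=> /(_ Hm) /le_trans; apply.
  have -> : e / 4 = e / 8 + e / 8 by field.
  exact: lerD.
have cvgS : S (lam (s k)) @[k --> \oo] --> S mU.
  have addc : continuous (fun p : R * R => p.1 + p.2) by exact: (@add_continuous R).
  apply: (@cvg_big R 'I_I +%R 0 predT addc nat \oo (index_enum 'I_I)
    (fun i k => phi (rational_point i) * fine (lam (s k) (cell m i)))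
    (fun i => phi (rational_point i) * fine (mU (cell m i)))) => i _.
  by apply: cvgMr; exact: scell.
have e2 : 0 < e / 2 by rewrite divr_gt0.
have /cvgrPdist_le /(_ _ e2) := cvgS.
apply: filterS => k Sk.
have := errS (lam (s k)) (fun A => @lam_le (s k) A).
have := errS mU mU_le.
move: Sk; rewrite !ler_norml => /andP[? ?] /andP[? ?] /andP[? ?].
by apply/andP; split; lra.
Qed.

End weak_subsequence.

(** * Mollifications, averages over balls and precise majorants *)

Section mollification_bounds.
Context {R : realType} {n : nat}.
Variables (rho : 'rV[R]_n -> R) (rhoP : standard_mollifier rho).
Local Notation L := (lebesgue_Rn n).
Variable Omega : set (borelRn R n).
Hypothesis mOmega : measurable Omega.

Lemma mollify_ge0 f delta x : (forall y, 0 <= f y) -> 0 <= delta ->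
  0 <= mollify rho Omega f delta x.
Proof.
move=> f0 d0; apply: Rintegral_ge0 => y _; rewrite mulr_ge0//.
  by rewrite patchE; case: ifP.
by rewrite mulr_ge0 ?invr_ge0 ?exprn_ge0// mollifier_ge0.
Qed.

(** The mollifier is at least rho(0)/2 on the ball of radius s, so a
mollification controls the averages over balls. *)
Lemma mollify_lower_bound (s : R) f delta x :
  (forall z, enorm z < s -> rho 0 / 2 <= rho z) ->
  L.-integrable Omega (EFin \o f) -> (forall y, 0 <= f y) -> 0 < delta ->
  (\int[L]_(y in Omega `&` eball x (s * delta)) (f y)%:E <=
   (2 * delta ^+ n / rho 0 * mollify rho Omega f delta x)%:E)%E.
Proof.
move=> rhos fi f0 d0; have rho0 : 0 < rho 0 by case: rhoP.
have [M HM] := Cc_bounded (Ccoo_Cc (Ccoo_bump rhoP (V := setT) (x := x) d0 (@subsetT _ _))).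
pose I (y : borelRn R n) : R :=
  (f \_ Omega) y * ((delta ^+ n)^-1 * rho (delta^-1 *: (x - y))).
have dn0 : 0 < delta ^+ n by exact: exprn_gt0.
have fO0 y : 0 <= (f \_ Omega) y by rewrite patchE; case: ifP.
have fOi : L.-integrable setT (EFin \o (f \_ Omega)).
  by move: fi => /integrable_mkcond; rewrite restrict_EFin; apply.
have mI : measurable_fun setT I.
  apply: measurable_funM.
    by apply/measurable_EFinP; exact: measurable_int fOi.
  apply: measurable_funM => //.
  rewrite (_ : (fun _ => _) = bump rho delta x); first exact: measurable_bump.
  by apply/funext => y; rewrite [RHS](bumpC rhoP).
have I0 y : 0 <= I y.
  by rewrite mulr_ge0// mulr_ge0 ?invr_ge0 ?(ltW dn0)// mollifier_ge0.
have Ii : L.-integrable setT (EFin \o I).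
  apply: (le_integrable measurableT _ _ (integrableZl measurableT ((delta ^+ n)^-1 * M) fOi)).
    exact/measurable_EFinP.
  move=> y _ /=; rewrite lee_fin !ger0_norm//; last first.
    rewrite mulr_ge0// mulr_ge0 ?invr_ge0 ?(ltW dn0)//.
    exact: le_trans (normr_ge0 _) (HM 0).
  rewrite /I [leRHS]mulrC ler_wpM2l// ler_wpM2l ?invr_ge0 ?(ltW dn0)//.
  have := HM y; rewrite (bumpC rhoP) /bump; apply: le_trans; exact: ler_norm.
have mB := measurable_eball x (s * delta).
have mOB := measurableI _ _ mOmega mB.
rewrite EFinM /mollify /Rintegral fineK; last exact: integrable_fin_num.
have c0 : 0 <= 2 * delta ^+ n / rho 0 by rewrite divr_ge0 ?mulr_ge0// ltW.
rewrite -ge0_integralZl//; last 2 first.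
  exact: measurable_int Ii.
  by move=> y _; rewrite lee_fin; exact: I0.
apply: (@le_trans _ _ (\int[L]_(y in Omega `&` eball x (s * delta)%R)
    ((2 * delta ^+ n / rho 0)%:E * (I y)%:E))%E).
  apply: ge0_le_integral => //.
  - by move=> y _; rewrite lee_fin.
  - exact: measurable_funS mOmega (@subIsetl _ _ _) (measurable_int _ fi).
  - apply: measurable_funeM; apply: measurable_funTS; exact/measurable_EFinP.
  - move=> y [Oy xy]; rewrite -EFinM lee_fin /I patchE mem_set//.
    have : rho 0 / 2 <= rho (delta^-1 *: (x - y)).
      apply: rhos; rewrite enormZ gtr0_norm ?invr_gt0// mulrC ltr_pdivrMr//.
      by rewrite enormBC.
    set r := rho (_ *: _) => rr.
    have E (D r0 a : R) : D != 0 -> r0 != 0 ->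
        2 * D / r0 * (a * (D^-1 * r)) = a * (2 / r0 * r).
      by move=> D0 r00; field; rewrite ?D0 ?r00.
    rewrite E ?gt_eqF//.
    rewrite ler_peMr//; rewrite mulrAC ler_pdivlMr// mul1r mulrC -ler_pdivrMr//.
apply: ge0_subset_integral => //.
- apply: measurable_funeM; exact/measurable_EFinP.
- by move=> y _; rewrite mule_ge0// lee_fin.
Qed.

(** The mollification of index k is that of index 1 plus the increments of index
j with 1 <= j < k, whose absolute values are summed in the majorant. *)
Lemma mollify_le_majorant f delta k x : (0 < k)%N ->
  (`|mollify rho Omega f (delta k) x|%:E <= scalar_majorant rho Omega f delta x)%E.
Proof.
case: k => // k _; rewrite /scalar_majorant.
set u := fun k => mollify rho Omega f (delta k) x.
apply: (@le_trans _ _ (`|u 1|%:E + \sum_(1 <= j < k.+1) `|u j.+1 - u j|%:E)%E).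
  elim: k => [|k IH]; first by rewrite big_geq// adde0.
  rewrite big_nat_recr//= addeA.
  apply: (@le_trans _ _ (`|u k.+1|%:E + `|u k.+2 - u k.+1|%:E)%E).
    have := ler_normD (u k.+1) (u k.+2 - u k.+1).
    by rewrite -EFinD lee_fin [u k.+1 + _]addrC subrK.
  by rewrite leeD2r.
apply: (@le_trans _ _ (`|u 1|%:E + \sum_(1 <= j <oo) `|u j.+1 - u j|%:E)%E).
  by rewrite leeD2l//; apply: nneseries_lim_ge => *; rewrite lee_fin.
by rewrite leeDl// lee_fin.
Qed.

End mollification_bounds.

(** * Spreading a density over a set *)

(** Almost everywhere uniqueness carries the change of variables from the chosen
Radon-Nikodym derivative to the density g. *)
Lemma integral_density d (T : measurableType d) (R : realType)
    (nu : {finite_measure set T -> \bar R})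
    (mu : {sigma_finite_measure set T -> \bar R}) (g f : T -> \bar R) :
  mu.-integrable setT g ->
  (forall A, measurable A -> nu A = \int[mu]_(x in A) g x)%E ->
  nu.-integrable setT f -> (\int[nu]_x f x = \int[mu]_x (f x * g x))%E.
Proof.
move=> ig nuE fi.
have numu : nu `<< mu.
  apply/null_content_dominatesP => A mA A0; rewrite nuE//.
  by apply: null_set_integral => //; apply: measurable_funTS; exact: measurable_int ig.
rewrite -(Radon_Nikodym_change_of_variables numu)//.
set r := Radon_Nikodym _ _.
have ir : mu.-integrable setT r by exact: Radon_Nikodym_integrable.
apply: ae_eq_integral => //.
- by apply: emeasurable_funM; [exact: measurable_int fi|exact: measurable_int ir].
- by apply: emeasurable_funM; [exact: measurable_int fi|exact: measurable_int ig].
- apply: ae_eqe_mul2l; apply: integral_ae_eq => //; first exact: measurable_int ig.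
  move=> A _ mA; rewrite -nuE// -Radon_Nikodym_integral//.
Qed.

Lemma density_measure d (T : measurableType d) (R : realType)
    (mu : {measure set T -> \bar R}) (g : T -> \bar R) :
  measurable_fun setT g -> (forall x, 0 <= g x)%E ->
  (\int[mu]_x g x < +oo)%E ->
  exists nu : {finite_measure set T -> \bar R},
    forall A, nu A = (\int[mu]_(x in A) g x)%E.
Proof.
move=> mg g0 goo; pose nu A := (\int[mu]_(x in A) g x)%E.
have nu0 : nu set0 = 0%E by exact: integral_set0.
have nu_ge0 A : (0 <= nu A)%E by exact: integral_ge0.
have snu : semi_sigma_additive nu by exact: semi_sigma_additive_nng_induced.
pose m : {measure set T -> \bar R} :=
  HB.pack nu (isMeasure.Build _ _ _ nu nu0 nu_ge0 snu).
have fnu : fin_num_fun m.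
  move=> A mA; rewrite ge0_fin_numE// (le_lt_trans _ goo)//.
  exact: ge0_subset_integral.
pose m' : {finite_measure set T -> \bar R} :=
  HB.pack (Measure.sort m) (Measure_isFinite.Build _ _ _ (Measure.sort m) fnu).
by exists m'.
Qed.

Section kernel.
Context {R : realType} {n : nat}.
Local Notation L := (lebesgue_Rn n).
Variables (sigma : {finite_measure set (borelRn R n) -> \bar R})
  (S : set (borelRn R n)) (r : R) (p : borelRn R n -> R).
Hypothesis mS : measurable S.
Hypothesis sigmaS : sigma (~` S) = 0%E.
Hypothesis p0 : forall y, 0 <= p y.
Hypothesis pi : L.-integrable setT (EFin \o p).

Let N (y : borelRn R n) : R := fine (sigma (eball (y : 'rV_n) r)).

Hypothesis N0 : forall y, p y != 0 -> 0 < N y.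

Let near_pair : set (borelRn R n * borelRn R n) :=
  [set z | enorm ((z.2 : 'rV[R]_n) - z.1) < r].

Let mnear_pair : measurable near_pair.
Proof.
have mf : measurable_fun setT (fun z : borelRn R n * borelRn R n =>
    enorm ((z.2 : 'rV[R]_n) - z.1) : R).
  apply: (measurableT_comp (@measurable_enorm R n)
    (g := fun z : borelRn R n * borelRn R n => ((z.2 : 'rV_n) - z.1 : borelRn R n))).
  apply: measurable_rV => i.
  rewrite (_ : (fun _ => _) = (fun z : borelRn R n * borelRn R n =>
    (z.2 : 'rV_n) 0 i - (z.1 : 'rV_n) 0 i)); last by apply/funext => z; rewrite !mxE.
  by apply: measurable_funB; apply: (measurableT_comp (measurable_coord i)).
have := mf measurableT _ (measurable_itv `]-oo, r[).
by rewrite setTI; congr measurable; apply/seteqP; split=> z /=; rewrite in_itv.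
Qed.

Let near_pairE x y : \1_near_pair (x, y) = \1_(eball (x : 'rV[R]_n) r) y :> R.
Proof. by []. Qed.

Let near_pairE' x y : \1_near_pair (x, y) = \1_(eball (y : 'rV[R]_n) r) x :> R.
Proof.
by rewrite !indicE; congr ((_ : bool)%:R); apply/idP/idP; rewrite !inE /=;
  rewrite /near_pair /eball/= enormBC.
Qed.

Let N_ge0 y : 0 <= N y. Proof. exact: fine_ge0. Qed.

Let measurable_N : measurable_fun setT N.
Proof.
have fin (A : set (borelRn R n)) : open (A : set 'rV[R]_n) -> sigma A \is a fin_num.
  by move=> oA; apply: fin_num_measure; exact: open_measurable_Rn.
have le (A B : set (borelRn R n)) : open (A : set 'rV[R]_n) ->
    open (B : set 'rV[R]_n) -> A `<=` B -> (sigma A <= sigma B)%E.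
  by move=> oA oB AB; apply: le_measure; rewrite ?inE//; exact: open_measurable_Rn.
have setD (A B : set (borelRn R n)) : open (A : set 'rV[R]_n) ->
    open (B : set 'rV[R]_n) -> B `<=` A -> (sigma A <= sigma B + sigma (A `\` B))%E.
  move=> oA oB BA; have mA := open_measurable_Rn oA; have mB := open_measurable_Rn oB.
  rewrite (measureDI sigma mA mB) (_ : A `&` B = B) 1?addeC//.
  exact: setIidr.
exact: (measurable_ball_function fin le setD).
Qed.

Let measurable_p : measurable_fun setT p.
Proof. by apply/measurable_EFinP; exact: measurable_int pi. Qed.

(** Transports the mass p(y) to the part of S in the r-ball around y,
distributed proportionally to sigma; N is the normalization. *)
Let k (z : borelRn R n * borelRn R n) : R :=
  \1_S z.1 * (\1_near_pair z * (p z.2 / N z.2)).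

Let kE x y : k (x, y) = \1_S x * (\1_(eball (y : 'rV[R]_n) r) x * (p y / N y)).
Proof. by rewrite -near_pairE'. Qed.

Let k_ge0 z : 0 <= k z.
Proof. by rewrite !mulr_ge0// invr_ge0. Qed.

Let measurable_k : measurable_fun setT k.
Proof.
apply: measurable_funM.
  have mi : measurable_fun setT (\1_S : borelRn R n -> R) by exact: measurable_indic.
  exact: (measurableT_comp mi measurable_fst).
apply: measurable_funM; first exact: measurable_indic.
have mpN : measurable_fun setT (fun y => p y / N y).
  apply: measurable_funM => //.
  exact: measurableT_comp (@measurable_invr R) measurable_N.
exact: (measurableT_comp mpN measurable_snd).
Qed.

(** The density with respect to sigma of the transported measure. *)
Definition spread (x : borelRn R n) : \bar R := (\int[L]_y (k (x, y))%:E)%E.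

Let mk : measurable_fun setT (EFin \o k). Proof. exact/measurable_EFinP. Qed.

Lemma spread_ge0 x : (0 <= spread x)%E.
Proof. by apply: integral_ge0 => y _; rewrite lee_fin. Qed.

Lemma measurable_spread : measurable_fun setT spread.
Proof.
apply: (measurable_fun_fubini_tonelli_F (m2 := L) (EFin \o k)) => //.
Qed.

Let int_k y : (\int[sigma]_x (k (x, y))%:E = (p y)%:E)%E.
Proof.
have [py0|py0] := eqVneq (p y) 0.
  by rewrite integral0_eq ?py0// => x _; rewrite kE py0 mul0r !mulr0.
have Ny := N0 py0.
have mSB : measurable (S `&` eball (y : 'rV[R]_n) r).
  by apply: measurableI => //; exact: measurable_eball.
transitivity (\int[sigma]_x
    ((p y / N y)%:E * (\1_(S `&` eball (y : 'rV[R]_n) r) x)%:E))%E.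
  apply: eq_integral => x _; rewrite -EFinM; congr EFin.
  by rewrite kE indicI /= mulrA mulrC.
have pN0 : 0 <= p y / N y by rewrite divr_ge0.
have mi : measurable_fun setT
    (fun x => (\1_(S `&` eball (y : 'rV[R]_n) r) x)%:E : \bar R).
  by apply/measurable_EFinP; exact: measurable_indic.
rewrite ge0_integralZl_EFin//.
rewrite integral_indic// setIT.
have sSB : sigma (S `&` eball (y : 'rV[R]_n) r) = (N y)%:E.
  rewrite fineK; last by apply: fin_num_measure; exact: measurable_eball.
  have mB := measurable_eball (y : 'rV[R]_n) r.
  apply/esym; etransitivity; first exact: (measureDI sigma mB mS).
  rewrite [X in (X + _)%E](_ : _ = 0%E) ?add0e 1?setIC//.
  apply: (@subset_measure0 _ _ _ sigma _ (~` S)) => //.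
  - exact: measurableD.
  - exact: measurableC.
transitivity ((p y / N y)%:E * (N y)%:E)%E; first by congr (_ * _)%E; exact: sSB.
by rewrite -EFinM mulfVK// gt_eqF.
Qed.

(** For each y the kernel has sigma-integral p(y), so no mass is lost. *)
Lemma integral_spread : (\int[sigma]_x spread x = \int[L]_y (p y)%:E)%E.
Proof.
rewrite /spread (fubini_tonelli (EFin \o k))//=.
by apply: eq_integral => y _; exact: int_k.
Qed.

Let k_int : (sigma \x L)%E.-integrable setT (EFin \o k).
Proof.
apply/integrable12ltyP => //=.
rewrite (eq_integral spread) => [|x _]; last first.
  by apply: eq_integral => y _; rewrite /= ger0_norm.
by rewrite integral_spread; rewrite ltey_eq integrable_fin_num.
Qed.

(** Replacing p by its spread moves mass by less than r, hence changes the
integral of phi by at most its oscillation at scale r times the total mass. *)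
Lemma spread_coupling (phi : 'rV[R]_n -> R) V (eta : R)
    (lam : {finite_measure set (borelRn R n) -> \bar R}) :
  Cc V phi -> (forall x y, enorm (y - x) < r -> `|phi y - phi x| <= eta) ->
  (forall A, measurable A -> lam A = \int[sigma]_(x in A) spread x)%E ->
  `|\int[L]_y (phi y * p y) - \int[lam]_x phi x| <= eta * fine (lam setT).
Proof.
move=> Cphi Hphi lamE; have [M HM] := Cc_bounded Cphi.
have mphi := measurable_Cc Cphi.
have spread_int : sigma.-integrable setT spread.
  apply/integrableP; split; first exact: measurable_spread.
  rewrite (eq_integral spread) => [|x _]; last by rewrite gee0_abs// spread_ge0.
  by rewrite integral_spread ltey_eq integrable_fin_num.
have lamoo : (lam setT < +oo)%E by rewrite ltey_eq fin_num_measure.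
have bounded_int (f : borelRn R n * borelRn R n -> R) (C : R) :
    measurable_fun setT f -> (forall z, `|f z| <= C) ->
    (sigma \x L)%E.-integrable setT (fun z => (f z * k z)%:E).
  move=> mf fC; apply: (le_integrable measurableT _ _ (integrableZl measurableT C k_int)).
    by apply/measurable_EFinP; exact: measurable_funM.
  move=> z _; rewrite /= lee_fin normrM [leRHS]normrM [`|k z|]ger0_norm//.
  by rewrite ler_wpM2r// (le_trans (fC z))// ler_norm.
have mphi1 : measurable_fun setT (fun z : borelRn R n * borelRn R n => phi z.1).
  exact: (measurableT_comp mphi measurable_fst).
have mphi2 : measurable_fun setT (fun z : borelRn R n * borelRn R n => phi z.2).
  exact: (measurableT_comp mphi measurable_snd).
have i1 := bounded_int _ M mphi1 (fun z => HM z.1).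
have i2 := bounded_int _ M mphi2 (fun z => HM z.2).
have E2 : (\int[L]_y (phi y * p y)%:E =
    \int[(sigma \x L)%E]_z (phi z.2 * k z)%:E)%E.
  rewrite -(integral21_prod_meas1 i2); apply: eq_integral => y _.
  rewrite /fubini_G /= EFinM -int_k.
  under [RHS]eq_integral do rewrite EFinM.
  rewrite integralZl//; apply/integrableP; split.
    apply/measurable_EFinP; apply: (measurableT_comp measurable_k).
    exact: measurable_pair2.
  rewrite (eq_integral (fun x => (k (x, y))%:E)) => [|x _]; last first.
    by rewrite /= ger0_norm.
  by rewrite int_k ltry.
have E1 : (\int[lam]_x (phi x)%:E =
    \int[(sigma \x L)%E]_z (phi z.1 * k z)%:E)%E.
  rewrite -(integral12_prod_meas1 i1).
  rewrite (integral_density spread_int lamE (integrable_Cc lamoo Cphi)).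
  apply: ae_eq_integral => //.
  - by apply: emeasurable_funM; [exact/measurable_EFinP|exact: measurable_spread].
  - exact: measurable_fubini_F i1.
  have := integrable_ae measurableT spread_int.
  apply: filterS => x /(_ Logic.I) fx _; rewrite /fubini_F /=.
  under [RHS]eq_integral do rewrite EFinM.
  rewrite integralZl//; apply/integrableP; split.
    apply/measurable_EFinP; apply: (measurableT_comp measurable_k).
    exact: measurable_pair1.
  rewrite (eq_integral (fun y => (k (x, y))%:E)) => [|y _]; last first.
    by rewrite /= ger0_norm.
  by move: fx; rewrite ge0_fin_numE ?spread_ge0.
rewrite /Rintegral E1 E2 -fineB; [|exact: integrable_fin_num..].
rewrite -integralB//.
have i21 := integrableB measurableT i2 i1.
rewrite -lee_fin -abse_EFin fineK; last exact: integrable_fin_num.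
apply: (le_trans (le_abse_integral _ measurableT (measurable_int _ i21))).
apply: (@le_trans _ _ (\int[(sigma \x L)%E]_z (eta%:E * (k z)%:E))%E).
  apply: ge0_le_integral => //.
  - by apply: measurableT_comp => //; exact: measurable_int i21.
  - by apply: measurable_funeM.
  move=> z _; rewrite /= -EFinM lee_fin -mulrBl normrM [`|k z|]ger0_norm//.
  case: z => x y /=; have [xy|xy] := pselect (eball (x : 'rV[R]_n) r y).
    by rewrite ler_wpM2r// Hphi.
  rewrite (_ : k (x, y) = 0) ?mulr0//.
  by rewrite /k/= near_pairE [X in _ * (X * _)]indicE memNset// mul0r mulr0.
rewrite integralZl// EFinM fineK ?fin_num_measure// lamE// integral_spread.
rewrite (fubini_tonelli2 (EFin \o k))//= .
by rewrite le_eqVlt; apply/orP; left; apply/eqP; congr (_ * _)%E; apply: eq_integral => y _; exact: int_k.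
Qed.

(** Mass arrives at x only from the points y of the r-ball around x, each of them
contributing p(y) / N(y). *)
Lemma spread_le (beta : R) x : 0 < beta -> (forall y, p y != 0 -> beta <= N y) ->
  (spread x <= beta^-1%:E * \int[L]_(y in eball (x : 'rV[R]_n) r) (p y)%:E)%E.
Proof.
move=> b0 bN; have mB := measurable_eball (x : 'rV[R]_n) r.
have mp : measurable_fun setT (fun y => (p y)%:E) by exact/measurable_EFinP.
rewrite -ge0_integralZl_EFin//; last 3 first.
- by move=> y _; rewrite lee_fin.
- exact: measurable_funTS.
- by rewrite invr_ge0 ltW.
rewrite integral_mkcond; apply: ge0_le_integral => //.
- by move=> y _; rewrite lee_fin.
- apply: (measurableT_comp mk); exact: measurable_pair1.
- apply/(measurable_restrictT _ _).1 => //; apply: measurable_funeM.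
  exact: measurable_funTS.
move=> y _; rewrite patchE; case: ifPn => [/set_mem xy|xy]; last first.
  have xy' : ~ eball (x : 'rV[R]_n) r y by move=> H; move/negP: xy; apply; exact: mem_set.
  by rewrite /= /k /= near_pairE [X in _ * (X * _)]indicE memNset// mul0r mulr0.
rewrite /= lee_fin /k /= near_pairE [X in _ * (X * _)]indicE mem_set// mul1r.
have pNb : p y / N y <= beta^-1 * p y.
  have [->|py] := eqVneq (p y) 0; first by rewrite mul0r mulr0.
  by rewrite mulrC ler_wpM2r// lef_pV2 ?posrE ?bN// (lt_le_trans b0)// bN.
apply: le_trans pNb; rewrite indicE; case: (_ \in _); first by rewrite mul1r.
by rewrite mul0r divr_ge0.
Qed.

End kernel.

(** * The components of a vector field *)

Section field_estimate.
Context {R : realType} {n : nat}.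
Variables (rho : 'rV[R]_n -> R) (rhoP : standard_mollifier rho).
Local Notation L := (lebesgue_Rn n).
Variables (Omega : set (borelRn R n)) (F : 'rV[R]_n -> 'rV[R]_n).
Hypothesis mOmega : measurable Omega.
Hypothesis F1 : L1_field Omega F.

Let Fpos i : 'rV[R]_n -> R := (fun x => F x 0 i)^\+.
Let Fneg i : 'rV[R]_n -> R := (fun x => F x 0 i)^\-.

Let Fpos_int i : L.-integrable Omega (EFin \o (Fpos i : borelRn R n -> R)).
Proof. exact: integrable_funrpos mOmega (F1 i). Qed.

Let Fneg_int i : L.-integrable Omega (EFin \o (Fneg i : borelRn R n -> R)).
Proof. exact: integrable_funrneg mOmega (F1 i). Qed.

Lemma enorm_field_le x : enorm (F x) <= \sum_i (Fpos i x + Fneg i x).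
Proof.
apply: (le_trans (enorm_le_sum _)); apply: ler_sum => i _.
have := congr1 (fun f => f x) (funrposDneg (fun x => F x 0 i)).
by rewrite /= => <-.
Qed.

Lemma measurable_enorm_field :
  measurable_fun Omega (fun x : borelRn R n => enorm (F x)).
Proof.
rewrite /enorm; apply: (measurableT_comp (continuous_measurable_fun (@sqrt_continuous R))).
apply: measurable_sum => i; apply: measurable_funX.
by apply/measurable_EFinP; exact: measurable_int (F1 i).
Qed.

Let sum_int : L.-integrable Omega
  (fun x : borelRn R n => \sum_i ((Fpos i x)%:E + (Fneg i x)%:E)%E)%E.
Proof.
apply: integrable_sum => // i _; apply: integrableD => //.
- exact: Fpos_int.
- exact: Fneg_int.
Qed.

Lemma integrable_enorm_field :
  L.-integrable Omega (fun x : borelRn R n => (enorm (F x))%:E).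
Proof.
apply: (le_integrable mOmega _ _ sum_int).
  by apply/measurable_EFinP; exact: measurable_enorm_field.
move=> x _; rewrite (_ : (\sum_i _)%E = (\sum_i (Fpos i x + Fneg i x))%:E); last first.
  by rewrite -sumEFin; apply: eq_bigr.
rewrite /= lee_fin ger0_norm ?enorm_ge0//.
by rewrite (le_trans (enorm_field_le x))// ler_norm.
Qed.

Lemma enorm_field_mollify (s delta : R) x :
  (forall z, enorm z < s -> rho 0 / 2 <= rho z) -> 0 < delta ->
  (\int[L]_(y in Omega `&` eball x (s * delta)) (enorm (F y))%:E <=
   (2 * delta ^+ n / rho 0)%:E *
     (\sum_i (mollify rho Omega (Fpos i) delta x +
              mollify rho Omega (Fneg i) delta x))%:E)%E.
Proof.
move=> rhos d0; have mB := measurable_eball x (s * delta).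
have mOB := measurableI _ _ mOmega mB.
have OB : Omega `&` eball x (s * delta) `<=` Omega by exact: subIsetl.
have mp i : measurable_fun (Omega `&` eball x (s * delta))
    (fun y : borelRn R n => (Fpos i y)%:E).
  exact: measurable_funS mOmega OB (measurable_int _ (Fpos_int i)).
have mn i : measurable_fun (Omega `&` eball x (s * delta))
    (fun y : borelRn R n => (Fneg i y)%:E).
  exact: measurable_funS mOmega OB (measurable_int _ (Fneg_int i)).
have p0 i y : (0 <= (Fpos i y)%:E)%E by rewrite lee_fin funrpos_ge0.
have n0 i y : (0 <= (Fneg i y)%:E)%E by rewrite lee_fin funrneg_ge0.
apply: (@le_trans _ _ (\int[L]_(y in Omega `&` eball x (s * delta)%R)
    (\sum_i ((Fpos i y)%:E + (Fneg i y)%:E)))%E).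
  apply: ge0_le_integral => //.
  - by move=> y _; rewrite lee_fin enorm_ge0.
  - apply/measurable_EFinP.
    exact: measurable_funS mOmega OB measurable_enorm_field.
  - apply: emeasurable_sum => i; exact: emeasurable_funD.
  - move=> y _; rewrite (_ : (\sum_i _)%E = (\sum_i (Fpos i y + Fneg i y))%:E); last first.
      by rewrite -sumEFin; apply: eq_bigr.
    by rewrite lee_fin; exact: enorm_field_le.
rewrite ge0_integral_sum//; last 2 first.
- by move=> i; exact: emeasurable_funD.
- by move=> i y _; exact: adde_ge0.
rewrite -EFinM mulr_sumr -sumEFin; apply: lee_sum => i _.
rewrite ge0_integralD// mulrDr EFinD; apply: leeD.
  exact: mollify_lower_bound (Fpos_int i) (@funrpos_ge0 _ _ _) d0.
exact: mollify_lower_bound (Fneg_int i) (@funrneg_ge0 _ _ _) d0.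
Qed.

Lemma mollified_field_le_majorant (h : 'rV[R]_n -> \bar R) delta k x :
  (0 < k)%N -> 0 <= delta k ->
  h x = (\sum_i (scalar_majorant rho Omega (Fpos i) delta x +
                 scalar_majorant rho Omega (Fneg i) delta x))%E ->
  ((\sum_i (mollify rho Omega (Fpos i) (delta k) x +
            mollify rho Omega (Fneg i) (delta k) x))%:E <= h x)%E.
Proof.
move=> k0 dk ->; rewrite -sumEFin; apply: lee_sum => i _; rewrite EFinD.
apply: leeD.
  rewrite -[X in X%:E]ger0_norm; first exact: mollify_le_majorant.
  by apply: mollify_ge0 => // y; exact: funrpos_ge0.
rewrite -[X in X%:E]ger0_norm; first exact: mollify_le_majorant.
by apply: mollify_ge0 => // y; exact: funrneg_ge0.
Qed.

End field_estimate.

(** * Inner layers of the boundary *)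

Section boundary_layers.
Context {R : realType} {n : nat}.
Local Notation L := (lebesgue_Rn n).
Variables (Omega U : set 'rV[R]_n) (m : 'rV[R]_n -> R).
Let S : set (borelRn R n) := boundary U.

Hypothesis mOmega : measurable (Omega : set (borelRn R n)).
Hypothesis oU : open U.
Hypothesis UO : U `<=` Omega.
Hypothesis m0 : forall x, 0 <= m x.
Hypothesis mi : L.-integrable Omega (EFin \o (m : borelRn R n -> R)).

Definition layer (e : R) : set (borelRn R n) := U `&` neighborhood (boundary U) e.

Lemma measurable_layer e : measurable (layer e).
Proof.
by apply: measurableI; apply: open_measurable_Rn => //; exact: open_neighborhood.
Qed.

Let layer_sub e : layer e `<=` Omega.
Proof. by move=> x [/UO]. Qed.

Definition layer_density (e : R) : borelRn R n -> R :=
  fun y => e^-1 * (m \_ (layer e)) y.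

Lemma layer_density_ge0 e y : 0 < e -> 0 <= layer_density e y.
Proof.
by move=> e0; rewrite mulr_ge0 ?invr_ge0 ?(ltW e0)// patchE; case: ifP.
Qed.

Lemma layer_density_neq0 e y : layer_density e y != 0 -> layer e y.
Proof.
apply: contraPP => yD; apply/negP; rewrite negbK /layer_density patchE memNset//.
by rewrite mulr0.
Qed.

Let mi_layer e : L.-integrable setT (EFin \o (m \_ (layer e))).
Proof.
have : L.-integrable (layer e) (EFin \o (m : borelRn R n -> R)).
  exact: (integrableS mOmega (measurable_layer e) (@layer_sub e) mi).
move=> /(integrable_mkcond _ (measurable_layer e)).
by rewrite restrict_EFin.
Qed.

Lemma integrable_layer_density e : L.-integrable setT (EFin \o layer_density e).
Proof.
have := integrableZl measurableT e^-1 (mi_layer e).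
by under eq_fun do rewrite -EFinM.
Qed.

Lemma integral_layer_density e : 0 < e ->
  (\int[L]_y (layer_density e y)%:E = e^-1%:E * \int[L]_(y in layer e) (m y)%:E)%E.
Proof.
move=> e0; rewrite [in RHS]integral_mkcond.
transitivity (\int[L]_y (e^-1%:E * ((m \_ (layer e)) y)%:E))%E.
  by apply: eq_integral => y _; rewrite -EFinM.
rewrite (integralZl measurableT (mi_layer e)); congr (_ * _)%E.
by apply: eq_integral => y _; rewrite restrict_EFin.
Qed.

Lemma Rintegral_layer_density e V (phi : 'rV[R]_n -> R) : 0 < e -> Cc V phi ->
  \int[L]_y (phi y * layer_density e y) =
  e^-1 * \int[L]_(y in layer e) (phi y * m y).
Proof.
move=> e0 Cphi; rewrite [in RHS]Rintegral_mkcond.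
have [M HM] := Cc_bounded Cphi.
have ip : L.-integrable setT (EFin \o ((fun y => phi y * m y) \_ (layer e))).
  apply: (le_integrable measurableT _ _ (integrableZl measurableT M (mi_layer e))).
    apply/measurable_EFinP.
    rewrite (_ : _ \_ _ = (fun y => phi y * (m \_ (layer e)) y)).
      apply: measurable_funM; first exact: measurable_Cc Cphi.
      by apply/measurable_EFinP; exact: measurable_int (mi_layer e).
    by apply/funext => y; rewrite !patchE; case: ifP; rewrite ?mulr0.
  move=> y _; rewrite /= lee_fin !patchE; case: ifP => _.
    by rewrite !normrM ler_wpM2r// (le_trans (HM y))// ler_norm.
  by rewrite normr0.
rewrite -RintegralZl//; apply: eq_Rintegral => y _.
rewrite /layer_density !patchE; case: ifP => _; last by rewrite !mulr0.
by rewrite mulrCA.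
Qed.

End boundary_layers.

Section layers_limit.
Context {R : realType} {n : nat}.
Local Notation L := (lebesgue_Rn n).
Variables (Omega U : set 'rV[R]_n) (m : 'rV[R]_n -> R).
Let S : set (borelRn R n) := boundary U.
Hypothesis mOmega : measurable (Omega : set (borelRn R n)).
Hypothesis oU : open U.
Hypothesis UO : U `<=` Omega.
Hypothesis m0 : forall x, 0 <= m x.
Hypothesis mi : L.-integrable Omega (EFin \o (m : borelRn R n -> R)).
Variable sigma : {finite_measure set (borelRn R n) -> \bar R}.
Hypothesis sigmaS : sigma (~` S) = 0%E.
Variable e : nat -> R.
Hypothesis e_dec : decreases_to_0 e.
Hypothesis sigma_layer : forall k y, layer U (e k) y ->
  (0 < sigma (eball (y : 'rV_n) (e k *+ 2)))%E.
Variable G : borelRn R n -> \bar R.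
Hypothesis mG : measurable_fun setT G.
Hypothesis G0 : forall x, (0 <= G x)%E.
Hypothesis Goo : (\int[sigma]_x G x < +oo)%E.

Let p k := layer_density U m (e k).
Let g k : borelRn R n -> \bar R := spread sigma S (e k *+ 2) (p k).

Hypothesis gG : forall k x, (g k x <= G x)%E.

Let e0 k : 0 < e k. Proof. by case: e_dec. Qed.
Let mS : measurable S. Proof. by apply: measurable_closed; exact: closed_boundary. Qed.
Let p0 k y : 0 <= p k y. Proof. exact: layer_density_ge0. Qed.
Let pi k : L.-integrable setT (EFin \o p k).
Proof. exact: (integrable_layer_density mOmega oU UO). Qed.
Let N0 k y : p k y != 0 -> 0 < fine (sigma (eball (y : 'rV_n) (e k *+ 2))).
Proof.
move=> /layer_density_neq0 /sigma_layer H; rewrite fine_gt0// H/= ltey_eq.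
by rewrite fin_num_measure//; exact: measurable_eball.
Qed.

Let mg k : measurable_fun setT (g k).
Proof. exact: (measurable_spread sigma _ mS (p0 k) (pi k)). Qed.
Let g0 k x : (0 <= g k x)%E.
Proof. exact: (spread_ge0 _ _ _ (p0 k)). Qed.
Let int_g k : (\int[sigma]_x g k x = \int[L]_y (p k y)%:E)%E.
Proof. exact: (integral_spread mS sigmaS (p0 k) (pi k) (N0 (k := k))). Qed.
Let int_gG k A : measurable A -> (\int[sigma]_(x in A) g k x <= \int[sigma]_(x in A) G x)%E.
Proof.
by move=> mA; apply: ge0_le_integral => //; exact: measurable_funTS.
Qed.

Lemma layer_average_le k :
  ((e k)^-1%:E * \int[L]_(y in layer U (e k)) (m y)%:E <= \int[sigma]_x G x)%E.
Proof.
by rewrite -(integral_layer_density mOmega oU UO mi)// -int_g; exact: int_gG.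
Qed.

(** The spread layers are dominated by the finite measure of density G with
respect to sigma, hence converge weakly along a subsequence; the layers have
the same limit, since spreading moves mass by less than 2 e_k. *)
Lemma layers_weak_limit : exists mU : {finite_measure set (borelRn R n) -> \bar R},
  limiting_measure Omega m U mU /\
  forall A, measurable A -> (mU A <= \int[sigma]_(x in A) G x)%E.
Proof.
have [tau tauE] := density_measure mG G0 Goo.
have gfin k : (\int[sigma]_x g k x < +oo)%E by exact: le_lt_trans (int_gG k measurableT) Goo.
have /choice[lam lamE] k := density_measure (mg k) (g0 k) (gfin k).
have lam_tau k A : measurable A -> (lam k A <= tau A)%E.
  by move=> mA; rewrite lamE tauE; exact: int_gG.
have [mU [s [mU_tau s_nd s_ge s_cvg]]] :=
  @weak_subsequence R n tau (fun k => lam k) lam_tau.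
exists mU; split; last by move=> A mA; rewrite -tauE; exact: mU_tau.
have [_ e_nd e_cvg] := e_dec.
have e_le i j : (i <= j)%N -> e j <= e i.
  by move=> ij; exact: (nonincreasing_seqP _).1.
have es_cvg : e (s k) @[k --> \oo] --> (0 : R).
  apply: squeeze_cvgr (cvg_cst 0) e_cvg; apply: nearW => k.
  by rewrite ltW ?e_le//.
exists (e \o s).
  by split=> [k|k|]; [exact: e0|exact: e_le|exact: es_cvg].
move=> phi CphiO.
have Cphi : Cc setT phi by case: CphiO => ? [K [? _ ?]]; split=> //; exists K; split.
rewrite (_ : \int[mU]_(x in Omega) phi x = \int[mU]_x phi x); last first.
  rewrite Rintegral_mkcond; apply: eq_Rintegral => x _.
  rewrite patchE; case: ifPn => // /negP; rewrite inE => Ox.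
  by case: CphiO => _ [K [_ KO ->]] // /KO.
under eq_fun do rewrite -(Rintegral_layer_density mOmega oU UO mi (e0 _) Cphi).
apply/cvgrPdist_lt => r r0.
set t := fine (tau setT).
have t0 : 0 <= t by exact: fine_ge0.
have r20 : 0 < r / 2 by rewrite divr_gt0.
have eta0 : 0 < r / 2 / (t + 1) by rewrite divr_gt0// ltr_wpDl.
have etat : r / 2 / (t + 1) * t < r / 2.
  by rewrite mulrAC ltr_pdivrMr ?ltr_wpDl// ltr_pM2l// ltrDl.
have [d d0 Hd] := Cc_unif_continuous Cphi eta0.
have /cvgrPdist_lt /(_ _ r20) near1 := s_cvg _ _ Cphi.
have d20 : 0 < d / 2 by rewrite divr_gt0.
have /cvgrPdist_lt /(_ _ d20) near2 := es_cvg.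
near=> k.
have H1 : `|\int[mU]_x phi x - \int[lam (s k)]_x phi x| < r / 2 by near: k.
have H2 : e (s k) < d / 2.
  have : `|0 - e (s k)| < d / 2 by near: k.
  by rewrite sub0r normrN gtr0_norm.
have osc x y : enorm (y - x) < e (s k) *+ 2 -> `|phi y - phi x| <= r / 2 / (t + 1).
  move=> xy; apply: Hd; apply: lt_trans xy _.
  by rewrite -mulr_natr -ltr_pdivlMr.
have := spread_coupling mS sigmaS (p0 (s k)) (pi (s k)) (N0 (k := s k)) Cphi osc
  (fun A _ => lamE (s k) A).
have lamt : fine (lam (s k) setT) <= t.
  by apply: fine_le; rewrite ?fin_num_measure// lam_tau.
move=> H3.
have H4 : `|\int[L]_y (phi y * p (s k) y) - \int[lam (s k)]_x phi x| < r / 2.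
  apply: le_lt_trans H3 _; apply: le_lt_trans etat.
  by rewrite ler_wpM2l// ltW.
rewrite (le_lt_trans (ler_distD (\int[lam (s k)]_x phi x) _ _))//.
by rewrite [ltRHS]splitr ltrD// distrC.
Unshelve. all: by end_near. Qed.

End layers_limit.

Lemma liminf_le_along_sequence (R : realType) (f : R -> \bar R) (u : nat -> R) (M : \bar R) :
  decreases_to_0 u -> (forall k, f (u k) <= M)%E -> (limf_einf f 0^'+ <= M)%E.
Proof.
move=> [u0 _ ucvg] fM; rewrite limf_einfE; apply: ge_ereal_sup => _ [V /= V0 <-].
have [k uk] : exists k, V (u k).
  have [e /= e0 eV] := V0.
  have /cvgrPdist_lt /(_ _ e0) [k _ Hk] := ucvg.
  by exists k; apply: eV; [exact: (Hk k (leqnn k))|exact: u0].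
apply: ge_ereal_inf; by exists (f (u k)) => //; exists (u k).
Qed.

(** A point y of the layer is at distance less than e from some point of the
boundary, whose e-ball is contained in the 2e-ball around y. *)
Lemma layer_ball_mass (R : realType) (n : nat) (U : set 'rV[R]_n) (gamma0 R0 e : R) y :
  (forall x0 r, boundary U x0 -> 0 < r < R0 ->
    ((gamma0 * r ^+ n.-1)%:E <= hausdorff n.-1 (boundary U `&` eball x0 r))%E) ->
  0 < e < R0 -> layer U e y ->
  ((gamma0 * e ^+ n.-1)%:E <=
    hausdorff n.-1 (eball (y : 'rV_n) (e *+ 2) `&` boundary U))%E.
Proof.
move=> low eR [_ [a Sa ya]]; apply: (le_trans (low _ _ Sa eR)).
apply: (@le_outer_measure _ _ (hausdorff n.-1)) => x [Sx ax]; split => //.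
move: x ax {Sx}; apply: eball_triangle.
by rewrite mulr2n lerD2l; exact: ltW ya.
Qed.

(** * The limiting measure and its density *)

(** The integral of a nonnegative function is a supremum over the simple
functions below it: it is monotone also for non-measurable integrands. *)
Lemma le_lower_integral d (T : measurableType d) (R : realType)
    (mu : {measure set T -> \bar R}) D (f g : T -> \bar R) :
  (forall x, D x -> 0 <= f x)%E -> (forall x, D x -> f x <= g x)%E ->
  (\int[mu]_(x in D) f x <= \int[mu]_(x in D) g x)%E.
Proof.
move=> f0 fg; rewrite !ge0_integralE//; last first.
  by move=> x Dx; apply: le_trans (fg x Dx); exact: f0.
apply: ereal_sup_le => _ [h hf <-]; exists h => // x.
apply: (le_trans (hf x)); rewrite !patchE; case: ifPn => // /set_mem Dx.
exact: fg.
Qed.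

Lemma integral_trace d (T : measurableType d) (R : realType)
    (mu nu : {measure set T -> \bar R}) (S A : set T) (f : T -> \bar R) :
  measurable S -> measurable A -> (forall B, nu B = mu (B `&` S)) ->
  measurable_fun setT f -> (forall x, 0 <= f x)%E ->
  (\int[nu]_(x in A) f x = \int[mu]_(x in A `&` S) f x)%E.
Proof.
move=> mS mA nuE mf f0.
have AE : A = (A `&` S) `|` (A `\` S) by rewrite setUIDK.
have mAS := measurableI _ _ mA mS; have mADS := measurableD mA mS.
transitivity (\int[nu]_(x in A `&` S) f x + \int[nu]_(x in A `\` S) f x)%E.
  rewrite {1}AE; apply: ge0_integral_setU => //; first exact: measurable_funTS.
  by rewrite disj_set2E; apply/eqP; apply/seteqP; split => // x [[_ ?] []].
rewrite [X in (_ + X)%E](_ : _ = 0%E) ?adde0.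
  apply: eq_measure_integral => B mB BS; rewrite nuE.
  by congr (mu _); apply/setIidl => x /BS[].
apply: null_set_integral => //; first exact: measurable_funTS.
by rewrite nuE setDE -setIA setICl setI0 measure0.
Qed.

Lemma finite_trace d (T : measurableType d) (R : realType)
    (mu : {measure set T -> \bar R}) (S : set T) :
  measurable S -> (mu S < +oo)%E ->
  exists sigma : {finite_measure set T -> \bar R}, forall A, sigma A = mu (A `&` S).
Proof.
move=> mS Soo; pose m : {measure set T -> \bar R} := mrestr mu mS.
have fm : fin_num_fun m.
  move=> A mA; rewrite ge0_fin_numE//; apply: le_lt_trans Soo.
  apply: le_measure; [rewrite inE; exact: measurableI|by rewrite inE|].
  by apply: subIsetr.
pose m' : {finite_measure set T -> \bar R} :=
  HB.pack (Measure.sort m) (Measure_isFinite.Build _ _ _ (Measure.sort m) fm).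
by exists m' => A.
Qed.

(** The boundary carries no more Hausdorff measure than the reduced boundary, so
the integrability of h on the latter is integrability on the former. *)
Lemma integral_boundary_lty (R : realType) (n d : nat) (rho : 'rV[R]_n -> R)
    (U Omega : set 'rV[R]_n) (h G : borelRn R n -> \bar R) (c : R) :
  standard_mollifier rho -> finite_perimeter U -> boundary U `<=` Omega ->
  (hausdorff d (boundary U) < +oo)%E ->
  hausdorff d (boundary U) = hausdorff d (reduced_boundary U) ->
  0 < c -> measurable_fun setT G -> (forall x, 0 <= G x)%E ->
  (forall x, boundary U x -> G x <= c%:E * h x)%E ->
  (\int[hausdorff d]_(x in reduced_boundary U `&` Omega) h x < +oo)%E ->
  (\int[hausdorff d]_(x in boundary U) G x < +oo)%E.
Proof.
move=> rhoP fpU SO Soo SRB c0 mG G0 Gh hoo.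
have mRB := measurable_reduced_boundary rhoP fpU.
have RBS := @reduced_boundary_sub R n rho rhoP U.
have mS : measurable (boundary U : set (borelRn R n)).
  by apply: measurable_closed; exact: closed_boundary.
have mD : measurable (boundary U `\` reduced_boundary U : set (borelRn R n)).
  exact: measurableD.
have D0 : hausdorff d (boundary U `\` reduced_boundary U : set (borelRn R n)) = 0%E.
  have fRB : hausdorff d (reduced_boundary U) \is a fin_num.
    by rewrite ge0_fin_numE ?measure_ge0// -SRB.
  apply: eq_trans (@measureD _ _ _ (hausdorff d) _ _ mS mRB Soo) _.
  rewrite (setIidr RBS); apply: eq_trans (subee fRB).
  by congr (_ - _)%E; exact: SRB.
have SE : boundary U = reduced_boundary U `|` (boundary U `\` reduced_boundary U).
  by rewrite setDUK.
have -> : (\int[hausdorff d]_(x in (boundary U : set (borelRn R n))) G x =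
    \int[hausdorff d]_(x in (reduced_boundary U : set (borelRn R n))) G x)%E.
  transitivity (\int[hausdorff d]_(x in (reduced_boundary U : set (borelRn R n))) G x +
    \int[hausdorff d]_(x in (boundary U `\` reduced_boundary U : set (borelRn R n))) G x)%E.
    rewrite {1}SE; apply: ge0_integral_setU => //; first exact: measurable_funTS.
    by rewrite disj_set2E setDIK.
  rewrite [X in (_ + X)%E](_ : _ = 0%E) ?adde0//.
  by apply: null_set_integral => //; exact: measurable_funTS.
have RBO : reduced_boundary U `&` Omega = reduced_boundary U.
  by apply: setIidl => x /RBS /SO.
move: hoo; rewrite RBO => hoo.
pose RB : set (borelRn R n) := reduced_boundary U.
change (is_true (\int[hausdorff d]_(x in RB) G x < +oo)%E).
change (is_true (\int[hausdorff d]_(x in RB) h x < +oo)%E) in hoo.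
have mG' : measurable_fun RB G by exact: measurable_funTS.
have : (c^-1%:E * \int[hausdorff d]_(x in RB) G x < +oo)%E.
  rewrite -ge0_integralZl_EFin ?invr_ge0 ?(ltW c0)//.
  apply: le_lt_trans hoo; apply: le_lower_integral => x RBx.
    by rewrite mule_ge0// lee_fin invr_ge0 ltW.
  by rewrite lee_pdivrMl// Gh//; exact: RBS.
have I0 : (0 <= \int[hausdorff d]_(x in RB) G x)%E by exact: integral_ge0.
move: I0; case: (\int[_]_(x in _) _)%E => [r|//|//] _ ; rewrite ?ltry//.
by rewrite gt0_muley ?lte_fin ?invr_gt0.
Qed.

Theorem theorem5p7 (R : realType) (n : nat) (n_ge2 : (2 <= n)%N)
    (rho : 'rV[R]_n -> R) (rhoP : standard_mollifier rho) (gamma0 : R) :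
  exists2 c : R, 0 < c &
    forall (Omega : set 'rV[R]_n) (F : 'rV[R]_n -> 'rV[R]_n)
        (h : 'rV[R]_n -> \bar R) (U : set 'rV[R]_n),
      let m := fun x => enorm (F x) in
      open Omega ->
      DM1 Omega F ->
      precise_majorant rho Omega F h ->
      open U -> compactly_contained U Omega -> finite_perimeter U ->
      hausdorff n.-1 (boundary U) = hausdorff n.-1 (reduced_boundary U) ->
      uniform_lower_density gamma0 (boundary U) ->
      perimeter_class Omega h U ->
      open_class Omega m U /\
      exists mU : {finite_measure set (borelRn R n) -> \bar R},
        limiting_measure Omega m U mU /\
        forall A : set (borelRn R n), measurable A -> A `<=` Omega ->
          (mU A <= \int[hausdorff n.-1]_(x in A `&` boundary U)
                     (c%:E * h x))%E.
Proof.
have [s s0 rhos] := mollifier_lower rhoP.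
have rho0 : 0 < rho 0 by case: rhoP.
(* For e = s * delta / 2 the estimates below multiply to
   (gamma0 * e ^+ n.-1)^-1 * e^-1 * (2 * delta ^+ n / rho 0) = K / gamma0. *)
pose K : R := 2 / rho 0 * (2 / s) ^+ n.
have K0 : 0 < K by rewrite mulr_gt0 ?divr_gt0 ?exprn_gt0 ?divr_gt0.
(* The sign of gamma0 comes with the density condition; the absolute value and
   the summand 1 make the constant positive beforehand. *)
exists (K / `|gamma0| + 1); first by rewrite ltr_wpDl// divr_ge0// ltW.
set c := K / `|gamma0| + 1.
move=> Omega F h U m oO [F1 _] [delta [[d0 d_nd d_cvg] _ hE]] oU [cU UO'] fpU SRB.
move=> [mS' Sfin g0 [R0 R00 low]] [UO _ _ hoo].
have c0 : 0 < c by rewrite ltr_wpDl// divr_ge0// ltW.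
have Kc : K / gamma0 <= c by rewrite /c gtr0_norm// lerDl.
pose S : set (borelRn R n) := boundary U.
have mS : measurable S by [].
have mO : measurable (Omega : set (borelRn R n)) by exact: open_measurable_Rn.
have SO : boundary U `<=` Omega by move=> x [/UO'].
have cS : compact (boundary U).
  apply: (subclosed_compact _ cU); first exact: closed_boundary.
  by move=> x [].
have Soo : (hausdorff n.-1 (boundary U) < +oo)%E.
  by have := Sfin _ cS; rewrite setIid.
have [sigma sigmaE] := finite_trace (mu := hausdorff n.-1) mS Soo.
have [k0 Hk0] : exists k0, forall k, (k0 <= k)%N -> s * delta k / 2 < R0.
  have e0 : 0 < R0 * 2 / s by rewrite divr_gt0 ?mulr_gt0.
  have /cvgrPdist_lt /(_ _ e0) [k0 _ Hk] := d_cvg.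
  exists k0 => k /Hk /=; rewrite sub0r normrN gtr0_norm//.
  by rewrite ltr_pdivrMr// ltr_pdivlMr// mulrC.
(* The majorant uses delta from index 1 on, and the density condition holds for
   radii below R0. *)
pose idx k := (k + k0).+1.
pose e k := s * delta (idx k) / 2.
have e0 k : 0 < e k by rewrite divr_gt0 ?mulr_gt0.
have eR k : e k < R0 by apply: Hk0; rewrite /idx ltnW// ltnS leq_addl.
have e_dec : decreases_to_0 e.
  split=> // [k|].
    by rewrite /e /idx addSn ler_pM2r ?invr_gt0// ler_pM2l.
  have : s * delta k / 2 @[k --> \oo] --> s * 0 / 2.
    by apply: cvgMl; apply: cvgMr; exact: d_cvg.
  rewrite mulr0 mul0r => H.
  apply: (@cvg_comp _ _ _ idx (fun k => s * delta k / 2) _ \oo) => //.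
  rewrite /idx => A [N _ NA]; exists N => // k /= Nk; apply: NA => /=.
  by rewrite (leq_trans Nk)// ltnW// ltnS leq_addr.
have m0 x : 0 <= m x by exact: enorm_ge0.
have mi := integrable_enorm_field mO F1.
have eball2 k : e k *+ 2 = s * delta (idx k) by rewrite /e -mulr_natr divfK.
have low_layer k y : layer U (e k) y ->
    ((gamma0 * e k ^+ n.-1)%:E <= sigma (eball (y : 'rV_n) (e k *+ 2)))%E.
  by move=> Ly; rewrite sigmaE; apply: layer_ball_mass low _ Ly; rewrite e0 eR.
have sigma_layer k y : layer U (e k) y -> (0 < sigma (eball (y : 'rV_n) (e k *+ 2)))%E.
  move=> /low_layer; apply: lt_le_trans.
  by rewrite lte_fin mulr_gt0// exprn_gt0.
pose p k := layer_density U m (e k).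
have p0 k y : 0 <= p k y by exact: layer_density_ge0.
have pi k := integrable_layer_density mO oU UO mi (e k).
pose g k : borelRn R n -> \bar R := spread sigma S (e k *+ 2) (p k).
(* The supremum of the spread densities is Borel, whereas the majorant h is
   compared with it pointwise, on the boundary only. *)
pose G := fun x => esups (g ^~ x) 0%N.
have mG : measurable_fun setT G.
  by apply: measurable_fun_esups => k; exact: (measurable_spread sigma _ mS (p0 k) (pi k)).
have gG k x : (g k x <= G x)%E.
  by apply: ereal_sup_ubound; exists k.
have G0 x : (0 <= G x)%E.
  by apply: le_trans (gG 0%N x); exact: (spread_ge0 _ _ _ (p0 0%N)).
have h0 x : Omega x -> (0 <= h x)%E.
  move=> Ox; rewrite hE//; apply: sume_ge0 => i _; apply: adde_ge0.
    by apply: adde_ge0; [apply: adde_ge0 => //; apply: nneseries_ge0|].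
  by apply: adde_ge0; [apply: adde_ge0 => //; apply: nneseries_ge0|].
have gh k x : boundary U x -> (g k x <= c%:E * h x)%E.
  move=> Sx; have Ox := SO _ Sx.
  have b0 : 0 < gamma0 * e k ^+ n.-1 by rewrite mulr_gt0// exprn_gt0.
  have bN y : p k y != 0 -> gamma0 * e k ^+ n.-1 <=
      fine (sigma (eball (y : 'rV_n) (e k *+ 2))).
    move=> /layer_density_neq0 /low_layer; rewrite -lee_fin fineK// .
    by apply: fin_num_measure; exact: measurable_eball.
  apply: (le_trans (spread_le mS (p0 k) (pi k) x b0 bN)); rewrite eball2.
  set M := \sum_i (mollify rho Omega (fun x => F x 0 i)^\+ (delta (idx k)) x +
              mollify rho Omega (fun x => F x 0 i)^\- (delta (idx k)) x).
  have Mh : (M%:E <= h x)%E.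
    by apply: (mollified_field_le_majorant rhoP _ _ (hE x Ox)) => //; exact: ltW.
  have M0 : 0 <= M.
    apply: sumr_ge0 => i _; apply: addr_ge0.
      by apply: (mollify_ge0 rhoP) => [y|]; [exact: funrpos_ge0|exact: ltW].
    by apply: (mollify_ge0 rhoP) => [y|]; [exact: funrneg_ge0|exact: ltW].
  pose B : set (borelRn R n) := eball x (s * delta (idx k)).
  have mB : measurable B by exact: measurable_eball.
  pose mO' : borelRn R n -> \bar R := (fun y => (m y)%:E) \_ Omega.
  have mO'0 y : (0 <= mO' y)%E by rewrite /mO' patchE; case: ifP => // _; rewrite lee_fin.
  have mmO' : measurable_fun B mO'.
    apply: measurable_funTS; apply/(measurable_restrictT _ mO).
    exact: measurable_int mi.
  have int_le : (\int[lebesgue_Rn n]_(y in B) (p k y)%:E <=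
      ((e k)^-1 * (2 * delta (idx k) ^+ n / rho 0) * M)%:E)%E.
    apply: (@le_trans _ _ (\int[lebesgue_Rn n]_(y in B) ((e k)^-1%:E * mO' y))%E).
      apply: le_lower_integral => y _; first by rewrite lee_fin.
      rewrite /p /layer_density /mO' EFinM lee_pmul2l ?lte_fin ?invr_gt0// !patchE.
      case: ifPn => [/set_mem[/UO yO _]|_]; first by rewrite mem_set.
      by case: ifP => // _; rewrite lee_fin.
    rewrite ge0_integralZl_EFin ?invr_ge0 ?(ltW (e0 k))//.
    rewrite -mulrA EFinM lee_pmul2l ?lte_fin ?invr_gt0// EFinM.
    rewrite /mO' -integral_mkcondr setIC.
    exact: (enorm_field_mollify rhoP mO F1 x rhos (d0 _)).
  apply: (@le_trans _ _ (c%:E * M%:E)%E); last first.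
    by rewrite lee_pmul2l ?lte_fin.
  apply: (@le_trans _ _ (((gamma0 * e k ^+ n.-1)^-1)%:E *
     ((e k)^-1 * (2 * delta (idx k) ^+ n / rho 0) * M)%:E)%E).
    by rewrite lee_pmul2l ?lte_fin ?invr_gt0.
  rewrite -!EFinM lee_fin mulrA ler_wpM2r//; apply: le_trans Kc.
  have en : e k ^+ n.-1 * e k = s ^+ n * delta (idx k) ^+ n / 2 ^+ n.
    by rewrite -exprSr prednK ?(ltnW n_ge2)// /e expr_div_n exprMn.
  rewrite le_eqVlt; apply/orP; left; apply/eqP.
  rewrite mulrA -invfM -(mulrA gamma0) en /K expr_div_n; field.
  by rewrite !gt_eqF ?exprn_gt0.
have Gh x : boundary U x -> (G x <= c%:E * h x)%E.
  by move=> Sx; apply: ge_ereal_sup => _ [k _ <-]; exact: gh.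
have traceG A : measurable A -> (\int[sigma]_(x in A) G x =
    \int[hausdorff n.-1]_(x in A `&` S) G x)%E.
  by move=> mA; apply: (integral_trace (mu := hausdorff n.-1)).
have Goo : (\int[sigma]_x G x < +oo)%E.
  rewrite traceG// setTI.
  exact: (integral_boundary_lty rhoP fpU SO Soo SRB c0 mG G0 Gh hoo).
have sigmaS : sigma (~` S) = 0%E by rewrite sigmaE setICl measure0.
split.
  split => //.
  apply: le_lt_trans Goo; apply: (liminf_le_along_sequence e_dec) => k.
  exact: (layer_average_le mO oU UO m0 mi sigmaS e_dec sigma_layer mG gG).
have [mU [limU mU_le]] := layers_weak_limit mO oU UO m0 mi sigmaS e_dec sigma_layer
  mG G0 Goo gG.
exists mU; split=> // A mA AO; apply: (le_trans (mU_le A mA)).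
rewrite traceG//; apply: le_lower_integral => x [Ax Sx]; first exact: G0.
exact: Gh.
Qed.
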